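(* Let $n\ge 3$, $p>p_S:=\frac{n+2}{n-2}$, and $u_0\in L^\infty(\mathbb{R}^n)$. Assume that either (a) $\nabla u_0\in L^q(\mathbb{R}^n)$ for some $q\in\bigl[2,\frac{n(p-1)}{p+1}\bigr)$; or (b) $u_0\in BC^1(\mathbb{R}^n)$ and $|\nabla u_0(x)|=o\bigl(|x|^{-\frac{2}{p-1}-1}\bigr)$ as $|x|\to\infty$. Let $u$ be the maximal classical solution of the Cauchy problem $u_t-\Delta u=|u|^{p-1}u$ in $\mathbb{R}^n\times(0,\infty)$, $u(\cdot,0)=u_0$. If $u$ is global, then $$\sup_{t\ge 0}\|u(t)\|_\infty<\infty \qquad\text{and}\qquad \lim_{t\to\infty}t^{1/(p-1)}\|u(t)\|_\infty=0.$$
   Context: For $p>1$ and $u_0\in L^\infty(\mathbb{R}^n)$ (possibly sign-changing), the problem $u_t-\Delta u=|u|^{p-1}u$, $u(\cdot,0)=u_0$ in $\mathbb{R}^n$ admits a unique maximal classical solution $u$, with maximal existence time $T_{max}=T_{max}(u_0)\in(0,\infty]$; it is bounded on $\mathbb{R}^n\times[0,T']$ for each $T'<T_{max}$ and satisfies the variation-of-constants formula $u(t)=G_t*u_0+\int_0^tG_{t-s}*(|u|^{p-1}u)(s)\,ds$, where $G_t(x)=(4\pi t)^{-n/2}e^{-|x|^2/4t}$. If $T_{max}<\infty$ then $\lim_{t\to T_{max}}\|u(t)\|_\infty=\infty$. The solution is called global if $T_{max}=\infty$. $\|\cdot\|_\infty$ is the $L^\infty(\mathbb{R}^n)$ norm.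 $BC^1(\mathbb{R}^n)$ is the set of $C^1$ functions that are bounded together with their first order derivatives. In (a), $\nabla u_0$ is the distributional gradient. *)

(* Defs.v *)
From HB Require Import structures.
From mathcomp Require Import all_boot all_order all_algebra.
From mathcomp Require Import all_classical all_reals all_analysis.

Set Implicit Arguments.
Unset Strict Implicit.
Unset Printing Implicit Defensive.

Import Order.TTheory GRing.Theory Num.Theory.
Import numFieldNormedType.Exports.

Local Open Scope classical_set_scope.
Local Open Scope ring_scope.

(* R^n is 'rV[R]_n with its library topology (the one of the sup norm).  Its
   sigma-algebra is the one generated by the coordinates, which is the Borel
   one; every Lebesgue class has a Borel representative. *)
Section measurable_rV.
Context {R : realType} (n : nat).

Let coors (i : 'I_n) (x : 'rV[R]_n) : R := x 0 i.

Let rV_set0 : g_sigma_preimage coors set0.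
Proof. exact: sigma_algebra0. Qed.

Let rV_setC A : g_sigma_preimage coors A -> g_sigma_preimage coors (~` A).
Proof. exact: sigma_algebraC. Qed.

Let rV_bigcup (F : (set 'rV[R]_n)^nat) :
  (forall i, g_sigma_preimage coors (F i)) ->
  g_sigma_preimage coors (\bigcup_i (F i)).
Proof. exact: sigma_algebra_bigcup. Qed.

HB.instance Definition _ := @isMeasurable.Build default_measure_display
  'rV[R]_n (g_sigma_preimage coors) rV_set0 rV_setC rV_bigcup.

Lemma measurable_coord (i : 'I_n) :
  measurable_fun [set: 'rV[R]_n] (fun x => x 0 i).
Proof.
move=> _ Y mY; rewrite setTI; apply: sub_sigma_algebra => /=.
rewrite -bigcup_seq/=; exists i => /=; first by rewrite mem_index_enum.
by exists Y => //; rewrite setTI.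
Qed.

Lemma measurable_fun_rV d (T : measurableType d) (f : T -> 'rV[R]_n) :
  (forall i, measurable_fun [set: T] (fun x => f x 0 i)) ->
  measurable_fun [set: T] f.
Proof.
move=> mf _ Y mY; rewrite setTI.
suff : g_sigma_preimage coors `<=` [set A | measurable (f @^-1` A)] by apply.
apply: smallest_sub.
  split => /=.
  - by rewrite preimage_set0.
  - by move=> A mA; rewrite setTD -preimage_setC; exact: measurableC.
  - by move=> F mF; rewrite preimage_bigcup; exact: bigcup_measurable.
rewrite -bigcup_seq; apply: bigcup_sub => i _ _ [B mB <-] /=.
rewrite setTI -comp_preimage; have := mf i measurableT B mB.
by rewrite setTI.
Qed.
End measurable_rV.

Section lebesgue_rV.
Context {R : realType}.

Definition cons_rV n (z : measurableTypeR R * 'rV[R]_n) : 'rV[R]_n.+1 :=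
  row_mx (z.1 : R)%:M z.2.

Lemma measurable_cons_rV n : measurable_fun [set: _] (@cons_rV n).
Proof.
apply: measurable_fun_rV => i.
rewrite /cons_rV; have [j ->|j ->] := @split_ordP 1 n i.
- under eq_fun do rewrite (@row_mxEl _ _ 1) mxE ord1 eqxx mulr1n.
  exact: measurable_fst.
- under eq_fun do rewrite (@row_mxEr _ _ 1).
  apply: (measurableT_comp (measurable_coord j)).
  exact: measurable_snd.
Qed.

Lemma cons_rV0 n z : cons_rV z 0 (ord0 : 'I_n.+1) = z.1.
Proof.
rewrite /cons_rV (_ : ord0 = lshift n (ord0 : 'I_1)); last exact/val_inj.
by rewrite (@row_mxEl _ _ 1) mxE eqxx mulr1n.
Qed.

Lemma cons_rVS n z (i : 'I_n) : cons_rV z 0 (lift ord0 i) = z.2 0 i.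
Proof.
rewrite /cons_rV (_ : lift ord0 i = rshift 1 i); last exact/val_inj.
by rewrite (@row_mxEr _ _ 1).
Qed.

Let uncons_rV n (x : 'rV[R]_n.+1) : measurableTypeR R * 'rV[R]_n :=
  (x 0 ord0, \row_j x 0 (lift ord0 j)).

Let cons_rVK n : cancel (@cons_rV n) (@uncons_rV n).
Proof.
move=> z; rewrite /uncons_rV cons_rV0 [RHS]surjective_pairing; congr (_, _).
by apply/rowP => j; rewrite mxE cons_rVS.
Qed.

Let measurable_uncons_rV n : measurable_fun [set: _] (@uncons_rV n).
Proof.
apply: measurable_fun_pair; first exact: (@measurable_coord R n.+1 ord0).
apply: measurable_fun_rV => j; under eq_fun do rewrite mxE.
exact: measurable_coord.
Qed.

Section step.
Variables (n : nat) (mu : {sigma_finite_measure set 'rV[R]_n -> \bar R}).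

Definition lebesgue_rVS : set 'rV[R]_n.+1 -> \bar R :=
  pushforward (@lebesgue_measure R \x mu)%E (@cons_rV n).

Let lebesgue_rVS0 : lebesgue_rVS set0 = 0%E.
Proof. by rewrite /lebesgue_rVS /pushforward preimage_set0 measure0. Qed.

Let lebesgue_rVS_ge0 A : (0 <= lebesgue_rVS A)%E.
Proof.
have mc := @measurable_cons_rV n.
exact: (@measure_ge0 _ _ _
  (pushforward (@lebesgue_measure R \x mu)%E (@cons_rV n))).
Qed.

Let lebesgue_rVS_sigma_additive : semi_sigma_additive lebesgue_rVS.
Proof.
have mc := @measurable_cons_rV n.
exact: (@measure_semi_sigma_additive _ _ _
  (pushforward (@lebesgue_measure R \x mu)%E (@cons_rV n))).
Qed.

HB.instance Definition _ := isMeasure.Build _ _ _ lebesgue_rVS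
  lebesgue_rVS0 lebesgue_rVS_ge0 lebesgue_rVS_sigma_additive.

Let lebesgue_rVS_sigma_finite : sigma_finite setT lebesgue_rVS.
Proof.
have /sigma_finiteP[F [TF ndF Foo]] := sigma_finiteT (@lebesgue_measure R).
have /sigma_finiteP[G [TG ndG Goo]] := sigma_finiteT mu.
have mtl := @measurable_uncons_rV n.
exists (fun k => @uncons_rV n @^-1` (F k `*` G k)).
  rewrite -preimage_bigcup (_ : \bigcup_k _ = setT) ?preimage_setT//.
  rewrite -setXTT TF TG; apply/seteqP; split => -[x y] /=.
    by move=> [k _ [Fkx Gky]]; split; exists k.
  move=> [[k _ Fkx] [l _ Gly]]; exists (maxn k l) => //; split.
  - by move: x Fkx; exact/subsetPset/ndF/leq_maxl.
  - by move: y Gly; exact/subsetPset/ndG/leq_maxr.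
move=> k; have [mF Fkoo] := Foo k; have [mG Gkoo] := Goo k; split.
  by rewrite -[X in measurable X]setTI; apply: mtl => //; exact: measurableX.
rewrite /lebesgue_rVS /pushforward -comp_preimage.
rewrite (_ : _ \o _ = id) ?preimage_id; last exact/funext/cons_rVK.
by rewrite product_measure1E// lte_mul_pinfty// ge0_fin_numE.
Qed.

HB.instance Definition _ := @Measure_isSigmaFinite.Build _ _ _ lebesgue_rVS
  lebesgue_rVS_sigma_finite.

End step.

Fixpoint lebesgue_rV n : {sigma_finite_measure set 'rV[R]_n -> \bar R} :=
  match n with
  | 0%N => [the {sigma_finite_measure set 'rV[R]_0 -> \bar R} of
            \d_(0 : 'rV[R]_0)]
  | m.+1 => [the {sigma_finite_measure set 'rV[R]_m.+1 -> \bar R} of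
             lebesgue_rVS (lebesgue_rV m)]
  end.

Lemma lebesgue_rV_box n (A : 'I_n -> set R) :
  (forall i, measurable (A i)) ->
  lebesgue_rV n [set x | forall i, A i (x 0 i)] =
  (\prod_(i < n) lebesgue_measure (A i))%E.
Proof.
elim: n A => [|n IH] A mA.
  rewrite big_ord0 (_ : mkset _ = setT); first by rewrite /= diracT.
  by apply/seteqP; split => // x _ [].
have mB : measurable [set x : 'rV[R]_n | forall i, A (lift ord0 i) (x 0 i)].
  rewrite (_ : mkset _ = \big[setI/setT]_(i < n)
      ((fun x : 'rV[R]_n => x 0 i) @^-1` (A (lift ord0 i)))).
    apply: bigsetI_measurable => i _; rewrite -[X in measurable X]setTI.
    by apply: measurable_coord.
  rewrite -bigcap_seq; apply/seteqP; split => x /= h i; first by move=> _; apply: h.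
  by apply: (h i); rewrite /= mem_index_enum.
rewrite big_ord_recl -IH// -product_measure1E//; last exact: (mA ord0).
rewrite -[LHS]/((lebesgue_measure \x lebesgue_rV n)%E (@cons_rV n @^-1` _)).
congr (product_measure1 _ _ _); apply/seteqP; split => -[a y] /=.
  by move=> h; split=> [|i]; [have := h ord0; rewrite cons_rV0 |
    have := h (lift ord0 i); rewrite cons_rVS].
move=> [h1 h2] i; have [j ->|->] := unliftP ord0 i.
  by rewrite cons_rVS; exact: h2.
by rewrite cons_rV0; exact: h1.
Qed.

End lebesgue_rV.

Section calculus_rV.
Context {R : realType} {n : nat}.
Implicit Types (f : 'rV[R]_n -> R) (x : 'rV[R]_n).

(* The Euclidean norm; `|x| is the sup norm on 'rV[R]_n. *)
Definition enorm x : R := Num.sqrt (\sum_(i < n) x 0 i ^+ 2).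

Definition partial (i : 'I_n) f : 'rV[R]_n -> R :=
  fun x => 'D_(delta_mx 0 i) f x.

Definition gradient f x : 'rV[R]_n := \row_i partial i f x.

Definition laplacian f x : R := \sum_(i < n) partial i (partial i f) x.

Definition Linfty_norm f : \bar R := ('N[lebesgue_rV n]_+oo [EFin \o f])%E.

Definition C1 f : Prop :=
  continuous f /\
  forall i, (forall x, derivable f x (delta_mx 0 i)) /\
            continuous (partial i f).

Definition BC1 f : Prop :=
  [/\ C1 f, bounded_fun f & forall i, bounded_fun (partial i f)].

Definition smooth f : Prop := forall s : seq 'I_n, C1 (foldr partial f s).

Definition test_function f : Prop :=
  smooth f /\ compact (closure [set x | f x != 0]).

(* [f] has a distributional gradient, and it belongs to L^q. *)
Definition gradient_in_Lq f (q : R) : Prop :=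
  exists g : 'rV[R]_n -> 'rV[R]_n,
    [/\ measurable_fun [set: 'rV[R]_n] g,
        finite_norm (lebesgue_rV n) q%:E (enorm \o g) &
        forall phi, test_function phi -> forall i,
          (\int[lebesgue_rV n]_x (f x * partial i phi x) =
           - \int[lebesgue_rV n]_x (g x 0 i * phi x))%R].

Definition infty_rV : set_system 'rV[R]_n :=
  filter_from [set: R] (fun A => [set x | A < enorm x]).

Global Instance infty_rV_filter : Filter infty_rV.
Proof.
apply: filter_from_filter; first by exists 0.
move=> A B _ _; exists (Num.max A B) => // x /=.
by rewrite gt_max => /andP[].
Qed.

Canonical infty_rV_filter_on := FilterType infty_rV infty_rV_filter.

End calculus_rV.

Section nonlinear_heat.
Context {R : realType} {n : nat}.
Implicit Types (u : R -> 'rV[R]_n -> R).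

Definition power_nonlinearity (p v : R) : R := `|v| `^ (p - 1) * v.

Definition heat_kernel (t : R) (x : 'rV[R]_n) : R :=
  (4 * pi * t) `^ (- (n%:R / 2)) * expR (- (enorm x ^+ 2 / (4 * t))).

Definition heat_convolution (t : R) (f : 'rV[R]_n -> R) (x : 'rV[R]_n) : R :=
  \int[lebesgue_rV n]_y (heat_kernel t (x - y) * f y).

(* [u] is of class C^{2,1} (two derivatives in x, one in t) on
   R^n x (0, T) and satisfies the equation there. *)
Definition solves_equation (p : R) (T : \bar R) u : Prop :=
  forall (t : R) (x : 'rV[R]_n), 0 < t -> (t%:E < T)%E ->
  [/\ {for (t, x), continuous (fun z : R * 'rV[R]_n => u z.1 z.2)},
      derivable (u ^~ x) t 1 /\
      {for (t, x), continuous (fun z : R * 'rV[R]_n => derive1 (u ^~ z.2) z.1)},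
      forall i, derivable (u t) x (delta_mx 0 i) /\
      {for (t, x), continuous (fun z : R * 'rV[R]_n => partial i (u z.1) z.2)},
      forall i j, derivable (partial i (u t)) x (delta_mx 0 j) /\
      {for (t, x), continuous
         (fun z : R * 'rV[R]_n => partial j (partial i (u z.1)) z.2)} &
      derive1 (u ^~ x) t - laplacian (u t) x = power_nonlinearity p (u t x)].

Definition duhamel (p : R) (u0 : 'rV[R]_n -> R) (T : \bar R) u : Prop :=
  forall (t : R) (x : 'rV[R]_n), 0 < t -> (t%:E < T)%E ->
  u t x = heat_convolution t u0 x +
          \int[lebesgue_measure]_(s in `[0, t])
            heat_convolution (t - s)
              (fun y => power_nonlinearity p (u s y)) x.

(* Classical solutions on R^n x [0, T).  Since [u0] is only in L^oo, the
   solution need not be continuous at t = 0; the initial condition is encoded by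
   the variation-of-constants formula, and [u 0] is a representative of [u0]. *)
Definition classical_solution (p : R) (u0 : 'rV[R]_n -> R)
    (T : \bar R) u : Prop :=
  [/\ (0 < T)%E,
      {ae lebesgue_rV n, forall x, u 0 x = u0 x},
      solves_equation p T u,
      forall T' : R, (T'%:E < T)%E ->
        (ereal_sup [set Linfty_norm (u t) | t in `[0%R, T']] < +oo)%E &
      duhamel p u0 T u].

Definition maximal_classical_solution (p : R) (u0 : 'rV[R]_n -> R)
    (Tmax : \bar R) u : Prop :=
  classical_solution p u0 Tmax u /\
  forall (T : \bar R) (v : R -> 'rV[R]_n -> R),
    (Tmax < T)%E -> classical_solution p u0 T v ->
    ~ (forall t x, 0 < t -> (t%:E < Tmax)%E -> v t x = u t x).

End nonlinear_heat.

(* Main.v *)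
(* Write beta = 1/(p-1), G_t for the heat kernel and P_t for the heat semigroup.  For a point a and
   a time T, the self-similar rescaling w(s,y) = e^{-beta s} u(T - e^{-s}, a + e^{-s/2} y) has a
   nonincreasing Gaussian energy, and the identity for d/ds of the mass int w^2 G_1 shows that the
   mass stays small as long as the energy is small, because w exists for all s < oo and is bounded
   (u is global).  In unscaled terms, at a positive time t0, the energy is small as soon as
   tau^{2 beta + 1} P_tau |grad u(t0)|^2 and tau^{2 beta} P_tau u(t0)^2 are.

   Both hypotheses (a) and (b) give P_tau |grad u0|^2 = o(tau^{-2 beta - 1}) uniformly in space, and
   this passes to u(t0) since |grad u(t0)| <= C P_{2 t0} |grad u0| for t0 small.  As the energy is
   bounded by a gradient term and a constant, a first application gives P_tau u(t0)^2 =
   O(tau^{-2 beta}); as |d/dtau P_tau u^2| is controlled by tau^{-1/2} times the geometric mean of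
   P_{2 tau} u^2 and P_{2 tau} |grad u|^2, integration from infinity improves O to o, and a second
   application gives tau^{2 beta} P_tau u(t)^2 <= delta whenever t >= t0 and t + tau is large.
   Restarting the equation at the midpoint of [T1, s] and a continuation argument then yield
   |u(s)| <= eta (s - T1)^{-beta} with eta arbitrarily small. *)

Require Import Defs.
From HB Require Import structures.
From mathcomp Require Import all_boot all_order all_algebra.
From mathcomp Require Import all_classical all_reals all_analysis.
From mathcomp Require Import measurable_realfun ring lra.

Set Implicit Arguments.
Unset Strict Implicit.
Unset Printing Implicit Defensive.

Import Order.TTheory GRing.Theory Num.Theory.
Import numFieldNormedType.Exports.

Local Open Scope classical_set_scope.
Local Open Scope ring_scope.

(** * Integration on R^n *)

(** The solution may change sign and u0 is merely bounded, so neither comparison nor an energy over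
    the whole space is available: all energies carry a Gaussian weight, and the centre a and the
    time T are free parameters. Globality enters through one fact. For every T the rescaled solution
    lives for all s and tends to 0, since u stays bounded up to T. A mass above its threshold would,
    at small energy, have to keep growing, which contradicts this limit. Supercriticality decides
    whether the averaged initial gradient is small: a localized gradient has P_tau |grad u0|^2 of
    size tau^{-n/2}, and 2 beta + 1 < n/2 is exactly p > p_S. Likewise q (2 beta + 1) < n is exactly
    the bound on q in (a). The notion of solution gives no bound on derivatives and u0 has none in
    the classical sense. Derivative estimates are therefore obtained from the variation-of-constants
    formula applied to increments, and divided by the step only at the end. *)

Section measurability.
Context {R : realType}.

(** The sigma-algebra of ['rV[R]_n] is generated by the coordinates, so measurability of continuous
    functions has to be derived. Here [q k] rounds a point to a cell of a countable grid and [e k]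
    picks a point of the cell; f is then a pointwise limit of countably valued measurable
    functions. *)
Lemma measurable_fun_countable_approx d (T : measurableType d)
    (I : countType) (q : nat -> T -> I) (e : nat -> I -> T) (f : T -> R)
    (D : set T) :
  (forall k i, measurable (q k @^-1` [set i])) ->
  (forall x, D x -> f (e k (q k x)) @[k --> \oo] --> f x) ->
  measurable_fun D f.
Proof.
move=> mq cvgf.
apply: (@measurable_fun_cvg _ _ _ _ (fun k x => f (e k (q k x)))) => //.
move=> k; apply: measurable_funTS => _ Y mY; rewrite setTI.
rewrite (_ : _ @^-1` _ = \bigcup_(i in [set i | Y (f (e k i))]) (q k @^-1` [set i])).
  rewrite bigcup_mkcond; apply: countable_bigcupT_measurable => [|i].
    exact: countableP.
  by case: ifPn => // _; exact: mq.
apply/seteqP; split => [x /= Yx|x /= [i /= Yi qx]]; last by rewrite /= qx.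
by exists (q k x).
Qed.

Lemma measurable_floor_preimage (k : nat) (m : int) :
  measurable ((fun x : measurableTypeR R => Num.floor (k.+1%:R * x)) @^-1` [set m]).
Proof.
rewrite (_ : _ @^-1` _ = ((fun x : measurableTypeR R => k.+1%:R * x : R)%R @^-1` `[m%:~R, (m + 1)%:~R[)).
  rewrite -[X in measurable X]setTI.
  have : measurable_fun setT (fun x : measurableTypeR R => k.+1%:R * x : R)%R.
    exact: measurable_funM.
  by apply => //; exact: measurable_itv.
apply/seteqP; split => x /=; rewrite in_itv/=.
  by move=> <-; rewrite floor_le ?floorD1_gt.
exact: floor_def.
Qed.

Lemma cvg_floor_approx (x : R) :
  (Num.floor (k.+1%:R * x))%:~R / k.+1%:R @[k --> \oo] --> x.
Proof.
apply/cvgrPdist_le => e e0.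
near=> k.
have k0 : 0 < k.+1%:R :> R by [].
have h1 := floor_le (k.+1%:R * x).
have h2 := floorD1_gt (k.+1%:R * x).
rewrite intrD in h2.
set m := (Num.floor _)%:~R in h1 h2 *.
have ke : k.+1%:R^-1 <= e :> R.
  near: k; have := @cvg_harmonic R; move/cvgrPdist_le/(_ _ e0).
  by apply: filterS => n /=; rewrite /harmonic sub0r normrN ger0_norm.
rewrite (_ : x - m / k.+1%:R = (k.+1%:R * x - m) / k.+1%:R); last by field; rewrite gt_eqF.
rewrite ger0_norm; last by rewrite divr_ge0// subr_ge0.
rewrite (le_trans _ ke)// ler_pdivrMr// mulVf ?gt_eqF//.
by rewrite lerBlDr addrC ltW.
Unshelve. all: end_near. Qed.

Lemma normr_rV_le n (x : 'rV[R]_n) (e : R) : 0 <= e ->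
  (forall i, `|x 0 i| <= e) -> `|x| <= e.
Proof.
move=> e0 h; rewrite [leLHS]/Num.norm/= mx_normrE.
by apply: bigmax_le => // -[i j] _ /=; rewrite ord1; exact: h.
Qed.

Lemma cvg_rV (T : Type) (F : set_system T) {FF : Filter F} n
    (x : 'rV[R]_n) (y : T -> 'rV[R]_n) :
  (forall i, y k 0 i @[k --> F] --> x 0 i) -> y k @[k --> F] --> x.
Proof.
move=> h; apply/cvgrPdist_le => e e0.
have : \forall k \near F, forall i : 'I_n, `|x 0 i - y k 0 i| <= e.
  by apply: filter_forall => i; have /cvgrPdist_le/(_ _ e0) := h i.
apply: filterS => k hk; apply: normr_rV_le => [|i]; first exact: ltW.
by rewrite !mxE.
Qed.

Lemma measurable_rV_int_preimage n (k : nat) (m : 'rV[int]_n) :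
  measurable ((fun x : 'rV[R]_n => \row_i Num.floor (k.+1%:R * x 0 i) : 'rV[int]_n) @^-1` [set m]).
Proof.
rewrite (_ : _ @^-1` _ = \big[setI/setT]_(i < n)
   ((fun x : 'rV[R]_n => x 0 i) @^-1`
     ((fun x : measurableTypeR R => Num.floor (k.+1%:R * x)) @^-1` [set m 0 i]))).
  apply: bigsetI_measurable => i _; rewrite -[X in measurable X]setTI.
  by apply: measurable_coord => //; exact: measurable_floor_preimage.
rewrite -bigcap_seq; apply/seteqP; split => x /=.
  by move=> /= <- i _ /=; rewrite mxE.
by move=> h; apply/rowP => i; rewrite mxE; apply: (h i); rewrite /= mem_index_enum.
Qed.

Lemma continuous_measurable_rV n (f : 'rV[R]_n -> R) :
  continuous f -> measurable_fun setT f.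
Proof.
move=> cf.
apply: (@measurable_fun_countable_approx _ _ ('rV[int]_n)
  (fun k (x : 'rV[R]_n) => \row_i Num.floor (k.+1%:R * x 0 i))
  (fun k m => \row_i ((m 0 i)%:~R / k.+1%:R : R))) => //.
  by move=> k i; exact: measurable_rV_int_preimage.
move=> x _; apply: continuous_cvg; first exact: cf.
apply: cvg_rV => i.
under eq_fun do rewrite 2!mxE.
exact: cvg_floor_approx.
Qed.

Lemma continuous_measurable_prod n (f : R * 'rV[R]_n -> R) :
  (forall t x, 0 < t -> {for (t, x), continuous f}) ->
  measurable_fun ([set z | 0 < z.1] : set (measurableTypeR R * 'rV[R]_n)) f.
Proof.
move=> cf.
apply: (@measurable_fun_countable_approx _ (measurableTypeR R * 'rV[R]_n)%type (int * 'rV[int]_n)%type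
  (fun k (x : measurableTypeR R * 'rV[R]_n) => (Num.floor (k.+1%:R * x.1), \row_i Num.floor (k.+1%:R * x.2 0 i)))
  (fun k m => ((m.1 + 1)%:~R / k.+1%:R : R, \row_i ((m.2 0 i)%:~R / k.+1%:R)))).
  move=> k [i j].
  rewrite (_ : _ @^-1` _ = ((fun x : measurableTypeR R => Num.floor (k.+1%:R * x)) @^-1` [set i]) `*` ((fun x : 'rV[R]_n => \row_i Num.floor (k.+1%:R * x 0 i) : 'rV[int]_n) @^-1` [set j])).
    apply: measurableX; first exact: measurable_floor_preimage.
    exact: measurable_rV_int_preimage.
  by apply/seteqP; split => [[a b] [] /= <- <-|[a b] [] /= -> ->].
move=> [t x] /= t0.
apply: (@cvg_comp _ _ _ (fun k : nat => ((Num.floor (k.+1%:R * t) + 1)%:~R / k.+1%:R : R,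
    \row_i (((\row_i Num.floor (k.+1%:R * x 0 i) : 'rV[int]_n) 0 i)%:~R / k.+1%:R) : 'rV[R]_n))
  f _ (nbhs ((t : R, x) : R * 'rV[R]_n))); last exact: (cf t x t0).
have h1 : (Num.floor (k.+1%:R * t) + 1)%:~R / k.+1%:R @[k --> \oo] --> (t : R).
  rewrite -[t in X in _ --> X]addr0.
  under eq_fun do rewrite intrD mulrDl mul1r.
  by apply: cvgD; [exact: cvg_floor_approx|exact: cvg_harmonic].
have h2 : \row_i (((\row_i Num.floor (k.+1%:R * x 0 i) : 'rV[int]_n) 0 i)%:~R / k.+1%:R)
    @[k --> \oo] --> (x : 'rV[R]_n).
  apply: cvg_rV => i; under eq_fun do rewrite 2!mxE.
  exact: cvg_floor_approx.
exact: (cvg_pair h1 h2).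
Qed.

End measurability.
Section lebesgue_rV_integral.
Context {R : realType}.
Local Open Scope ereal_scope.
Local Notation leb := (@lebesgue_measure R).

(** The image of Lebesgue measure under x -> a + c x, multiplied by c, gives half-open intervals
    their length, so it is Lebesgue measure by uniqueness. *)
Lemma ge0_integral_affine (a c : R) (f : R -> \bar R) : (0 < c)%R ->
  measurable_fun [set: R] f -> (forall x, 0 <= f x) ->
  c%:E * \int[leb]_x f (a + c * x)%R = \int[leb]_x f x.
Proof.
move=> c0 mf f0.
pose phi (x : measurableTypeR R) : measurableTypeR R := (a + c * x)%R.
have mphi : measurable_fun setT phi.
  by apply: measurable_funD => //; exact: measurable_funM.
pose c' : {nonneg R} := NngNum (ltW c0).
rewrite -[LHS]/(c'%:num%:E * \int[leb]_(x in phi @^-1` setT) (f \o phi) x).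
rewrite -(@ge0_integral_pushforward _ _ _ _ _ phi mphi leb setT f)//.
rewrite -ge0_integral_mscale//.
apply: eq_measure_integral => A mA _.
apply/esym/lebesgue_measure_unique => //= X [[u v] _ <-].
rewrite /mscale/= /pushforward (_ : phi @^-1` _ = `]((u - a) / c)%R, ((v - a) / c)%R]%classic); last first.
  apply/seteqP; split => x /=; rewrite !in_itv/= /phi ltr_pdivrMr// ler_pdivlMr// ltrBlDl lerBrDl mulrC//.
rewrite !lebesgue_measure_itv/= !lte_fin ltr_pM2r ?invr_gt0// ltrD2r.
case: ifPn => _; last by rewrite mule0.
by rewrite -EFinM -EFinB; congr EFin; field; rewrite gt_eqF.
Qed.

Lemma ge0_integral_rVS n (f : 'rV[R]_n.+1 -> \bar R) :
  measurable_fun setT f -> (forall x, 0 <= f x) ->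
  \int[lebesgue_rV n.+1]_x f x =
  \int[leb]_a \int[lebesgue_rV n]_x f (cons_rV (a, x)).
Proof.
move=> mf f0.
rewrite -[LHS]/(\int[pushforward (leb \x lebesgue_rV n) (@cons_rV R n)]_x f x).
rewrite ge0_integral_pushforward//; last exact: measurable_cons_rV.
rewrite preimage_setT fubini_tonelli1//.
  exact: (measurableT_comp mf (@measurable_cons_rV R n)).
by move=> x; exact: f0.
Qed.

Lemma ge0_integral_rV0 (f : 'rV[R]_0 -> \bar R) :
  measurable_fun setT f -> (forall x, 0 <= f x) ->
  \int[lebesgue_rV 0]_x f x = f 0%R.
Proof. by move=> mf f0; rewrite /= integral_dirac// diracT mul1e. Qed.

Lemma measurable_cons_snd n (a : R) : measurable_fun setT (fun x : 'rV[R]_n => cons_rV (a, x)).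
Proof.
apply: (measurableT_comp (@measurable_cons_rV R n)).
exact: (@pair1_measurable _ _ (measurableTypeR R) _ a).
Qed.

Lemma measurable_affine_rV n (a : 'rV[R]_n) (c : R) :
  measurable_fun setT (fun x : 'rV[R]_n => a + c *: x)%R.
Proof.
apply: measurable_fun_rV => i; under eq_fun do rewrite !mxE.
apply: measurable_funD => //; apply: measurable_funM => //.
exact: measurable_coord.
Qed.

Lemma measurable_integral_cons n (f : 'rV[R]_n.+1 -> \bar R) :
  measurable_fun setT f -> (forall x, 0 <= f x) ->
  measurable_fun [set: measurableTypeR R] (fun a => \int[lebesgue_rV n]_x f (cons_rV (a, x))).
Proof.
move=> mf f0.
apply: (@measurable_fun_fubini_tonelli_F _ _ _ _ _ (lebesgue_rV n) (f \o @cons_rV R n)) => //.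
  exact: (measurableT_comp mf (@measurable_cons_rV R n)).
by move=> x; exact: f0.
Qed.

(** Induction on the dimension: a dilation with translation acts separately on the first coordinate
    and on the remaining ones. *)
Lemma ge0_integral_affine_rV n (a : 'rV[R]_n) (c : R) (f : 'rV[R]_n -> \bar R) : (0 < c)%R ->
  measurable_fun setT f -> (forall x, 0 <= f x) ->
  (c ^+ n)%:E * \int[lebesgue_rV n]_x f (a + c *: x)%R = \int[lebesgue_rV n]_x f x.
Proof.
move=> c0; elim: n a f => [|n IH] a f mf f0.
  rewrite !ge0_integral_rV0// ?expr0 ?mul1e; last first.
    exact: (measurableT_comp mf (measurable_affine_rV _ _)).
  by congr f; apply/rowP => -[].
have mfa : measurable_fun setT (fun x : 'rV[R]_n.+1 => f (a + c *: x)%R).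
  exact: (measurableT_comp mf (measurable_affine_rV _ _)).
rewrite !ge0_integral_rVS//.
have E z x : (a + c *: cons_rV (z, x) =
    cons_rV (a 0 ord0 + c * z, (\row_j a 0 (lift ord0 j)) + c *: x))%R.
  apply/rowP => i; rewrite [LHS]mxE [X in (_ + X)%R]mxE.
  by have [j ->|->] := unliftP ord0 i; rewrite ?cons_rVS ?cons_rV0 ?mxE.
rewrite -[RHS](@ge0_integral_affine (a 0%R ord0) c
  (fun z => \int[lebesgue_rV n]_x f (cons_rV (z, x)))); last 3 first.
- exact: c0.
- exact: measurable_integral_cons.
- by move=> x; exact: integral_ge0.
rewrite exprS EFinM -muleA; congr (_ * _).
rewrite -ge0_integralZl//; last 3 first.
- exact: (measurable_integral_cons mfa).
- by move=> z _; exact: integral_ge0.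
- by rewrite lee_fin exprn_ge0// ltW.
apply: eq_integral => z _.
under eq_integral do rewrite E.
rewrite (IH (\row_j a 0 (lift ord0 j))%R (fun x => f (cons_rV (_, x))))//.
exact: (measurableT_comp mf (@measurable_cons_snd n _)).
Qed.

Lemma measurable_fun_prod_coord n (f : 'I_n -> R -> R) :
  (forall i, measurable_fun setT (f i)) ->
  measurable_fun setT (fun x : 'rV[R]_n => \prod_(i < n) f i (x 0 i))%R.
Proof.
move=> mf; apply: measurable_prod => i _.
exact: (measurableT_comp (mf i) (measurable_coord i)).
Qed.

Lemma ge0_integral_prod_rV n (f : 'I_n -> R -> R) :
  (forall i, measurable_fun setT (f i)) -> (forall i x, (0 <= f i x)%R) ->
  \int[lebesgue_rV n]_x (\prod_(i < n) f i (x 0 i))%:E =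
  \prod_(i < n) \int[leb]_x (f i x)%:E.
Proof.
elim: n f => [|n IH] f mf f0.
  rewrite big_ord0 ge0_integral_rV0//; first by rewrite big_ord0.
    apply/measurable_EFinP; exact: measurable_fun_prod_coord.
  by move=> x; rewrite lee_fin prodr_ge0.
rewrite ge0_integral_rVS//; last 2 first.
- by apply/measurable_EFinP; exact: measurable_fun_prod_coord.
- by move=> x; rewrite lee_fin prodr_ge0.
rewrite big_ord_recl -(IH (fun i => f (lift ord0 i)))//.
rewrite -ge0_integralZr//=; last 3 first.
- by apply/measurable_EFinP; exact: mf.
- by move=> x _; rewrite lee_fin.
- by apply: integral_ge0 => x _; rewrite lee_fin prodr_ge0.
apply: eq_integral => a _.
rewrite -ge0_integralZl//; last 3 first.
- apply/measurable_EFinP.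
  exact: (measurable_fun_prod_coord (fun i => mf (lift ord0 i))).
- by move=> x _; rewrite lee_fin prodr_ge0.
- by rewrite lee_fin.
apply: eq_integral => x _; rewrite -EFinM big_ord_recl cons_rV0.
by congr (_ * _)%:E; apply: eq_bigr => i _; rewrite cons_rVS.
Qed.

End lebesgue_rV_integral.

(** * The heat kernel *)

Lemma cvg_bigsum (R : realType) (T I : Type) (F : set_system T) {FF : Filter F}
    (s : seq I) (f : I -> T -> R) (l : I -> R) :
  (forall i, f i x @[x --> F] --> l i) ->
  \sum_(i <- s) f i x @[x --> F] --> \sum_(i <- s) l i.
Proof.
move=> fl; elim: s => [|i s IH].
  by rewrite big_nil; under eq_fun do rewrite big_nil; exact: cvg_cst.
by rewrite big_cons; under eq_fun do rewrite big_cons; exact: cvgD.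
Qed.

Section heat_kernel_facts.
Context {R : realType} {n : nat}.
Implicit Types (x y z : 'rV[R]_n) (s t : R).
Local Notation mu := (@lebesgue_rV R n).

Lemma enorm_sqr x : enorm x ^+ 2 = \sum_(i < n) x 0 i ^+ 2.
Proof. by rewrite sqr_sqrtr// sumr_ge0// => i _; rewrite sqr_ge0. Qed.

Lemma enorm_ge0 x : 0 <= enorm x. Proof. exact: sqrtr_ge0. Qed.

Lemma coord_le_enorm x i : `|x 0 i| <= enorm x.
Proof.
rewrite -sqrtr_sqr ler_wsqrtr// (bigD1 i)//= lerDl sumr_ge0// => j _.
exact: sqr_ge0.
Qed.

Lemma enormZ (c : R) x : enorm (c *: x) ^+ 2 = c ^+ 2 * enorm x ^+ 2.
Proof.
rewrite !enorm_sqr mulr_sumr; apply: eq_bigr => i _.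
by rewrite mxE exprMn.
Qed.

Lemma enormN x : enorm (- x) = enorm x.
Proof. by congr Num.sqrt; apply: eq_bigr => i _; rewrite mxE sqrrN. Qed.

Lemma continuous_coord i : continuous (fun x => x 0 i).
Proof. by move=> x; apply: (@coord_continuous _ 1 n 0 i). Qed.

Lemma continuous_enorm_sqr : continuous (fun x => enorm x ^+ 2).
Proof.
move=> x; rewrite /continuous_at enorm_sqr.
under eq_fun do rewrite enorm_sqr.
apply: (@cvg_bigsum _ _ _ (nbhs x) _ (index_enum 'I_n)
  (fun i (x : 'rV[R]_n) => x 0 i ^+ 2)) => i.
apply: (@continuous_comp _ _ _ (fun x : 'rV[R]_n => x 0 i) (fun r : R => r ^+ 2)).
  exact: continuous_coord.
exact: exprn_continuous.
Qed.

Lemma measurable_enorm_sqr : measurable_fun setT (fun x => enorm x ^+ 2).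
Proof. by apply: continuous_measurable_rV; exact: continuous_enorm_sqr. Qed.

Lemma heat_kernel_ge0 t x : 0 <= heat_kernel t x.
Proof. by rewrite /heat_kernel mulr_ge0// ?powR_ge0// expR_ge0. Qed.

Lemma heat_kernelN t x : heat_kernel t (- x) = heat_kernel t x.
Proof. by rewrite /heat_kernel enormN. Qed.

Lemma continuous_heat_kernel t : continuous (@heat_kernel R n t).
Proof.
rewrite /heat_kernel => x.
apply: (@continuousM _ _ (fun=> (4 * pi * t) `^ (- (n%:R / 2)))
  (fun x : 'rV[R]_n => expR (- (enorm x ^+ 2 / (4 * t))))); first exact: cst_continuous.
apply: (@continuous_comp _ _ _ (fun x : 'rV[R]_n => - (enorm x ^+ 2 / (4 * t))) expR);
  last exact: continuous_expR.
apply: (@continuousN _ _ _ (fun x : 'rV[R]_n => enorm x ^+ 2 / (4 * t))).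
apply: (@continuousM _ _ (fun x : 'rV[R]_n => enorm x ^+ 2) (fun=> (4 * t)^-1)).
  exact: continuous_enorm_sqr.
exact: cst_continuous.
Qed.

Lemma measurable_heat_kernel t : measurable_fun setT (@heat_kernel R n t).
Proof. by apply: continuous_measurable_rV; exact: continuous_heat_kernel. Qed.

(** Completing the square in z: the product is a Gaussian in z around the weighted mean of x and y,
    times a factor free of z. Integrating z out gives the semigroup law. *)
Lemma heat_kernelM s t x y z : 0 < s -> 0 < t ->
  heat_kernel s (x - z) * heat_kernel t (z - y) =
  heat_kernel (s + t) (x - y) *
  heat_kernel (s * t / (s + t)) (z - (s + t)^-1 *: (t *: x + s *: y)).
Proof.
move=> s0 t0; have st0 : 0 < s + t by rewrite addr_gt0.
rewrite /heat_kernel mulrACA [RHS]mulrACA; congr (_ * _).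
  have pi0 : 0 <= pi :> R := pi_ge0 R.
  have s0' := ltW s0; have t0' := ltW t0; have st0' := ltW st0.
  rewrite -!powRM; do ?[by repeat first [assumption | apply: mulr_ge0 | rewrite invr_ge0]].
  by congr (_ `^ _); field; rewrite gt_eqF.
rewrite -!expRD; congr expR; rewrite !enorm_sqr -!opprD !mulr_suml -!big_split/=.
congr (- _); apply: eq_bigr => i _; rewrite !mxE; field.
by rewrite !gt_eqF.
Qed.

Lemma heat_kernel_scale t x : 0 < t ->
  heat_kernel t (Num.sqrt t *: x) * Num.sqrt t ^+ n = heat_kernel 1 x.
Proof.
move=> t0; rewrite /heat_kernel enormZ sqr_sqrtr ?ltW// mulr1 mulr1.
have -> : t * enorm x ^+ 2 / (4 * t) = enorm x ^+ 2 / 4 by field; rewrite gt_eqF.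
rewrite mulrAC; congr (_ * _).
rewrite [in LHS]powRM ?mulr_ge0 ?pi_ge0 ?(ltW t0)// -mulrA -[RHS]mulr1; congr (_ * _).
rewrite -powR12_sqrt ?ltW// -powR_mulrn ?powR_ge0// -powRrM -powRD.
  by rewrite mulrC addNr powRr0.
by apply/implyP => _; rewrite gt_eqF.
Qed.

End heat_kernel_facts.

Section heat_kernel_integral.
Context {R : realType}.
Local Open Scope ereal_scope.

Lemma heat_kernel1_prod n (x : 'rV[R]_n) :
  heat_kernel 1 x = (\prod_(i < n) ((4 * pi) `^ (- 2^-1) * expR (- ((x 0 i) ^+ 2 / 4))))%R.
Proof.
rewrite /heat_kernel !mulr1 big_split/= prodr_const card_ord; congr (_ * _)%R.
  by rewrite -powR_mulrn ?powR_ge0// -powRrM; congr (_ `^ _)%R; rewrite mulNr mulrC.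
rewrite -expR_sum; congr expR; rewrite enorm_sqr mulr_suml -sumrN.
by [].
Qed.

Lemma integral_gauss1 :
  \int[lebesgue_measure]_x ((4 * pi) `^ (- 2^-1) * expR (- (x ^+ 2 / 4)) : R)%:E = 1.
Proof.
set f := fun x : R => _.
have mf : measurable_fun [set: R] f.
  apply/measurable_EFinP; apply: measurable_funM => //.
  apply: measurableT_comp => //; apply: measurableT_comp => //.
  by apply: measurable_funM => //; exact: exprn_measurable.
rewrite -(@ge0_integral_affine _ 0 2 f)//; last first.
  by move=> x; rewrite lee_fin mulr_ge0 ?powR_ge0 ?expR_ge0.
rewrite /f; under eq_integral => x _.
  rewrite add0r (_ : (2 * x) ^+ 2 / 4 = x ^+ 2)%R; last by field.
  rewrite EFinM -[expR _]/(gauss_fun x); over.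
rewrite ge0_integralZl//; last 3 first.
- by apply/measurable_EFinP; exact: measurable_gauss_fun.
- by move=> x _; rewrite lee_fin gauss_fun_ge0.
- by rewrite lee_fin powR_ge0.
rewrite integralT_gauss -!EFinM; congr EFin.
rewrite powRN powR12_sqrt ?mulr_ge0 ?pi_ge0// sqrtrM// (_ : 4 = 2 ^+ 2)%R; last by ring.
rewrite sqrtr_sqr ger0_norm//; field.
by rewrite gt_eqF// sqrtr_gt0 pi_gt0.
Qed.

Lemma integral_heat_kernel1 n : \int[@lebesgue_rV R n]_x (heat_kernel 1 x)%:E = 1.
Proof.
under eq_integral do rewrite heat_kernel1_prod.
rewrite (@ge0_integral_prod_rV _ _ (fun _ x => ((4 * pi) `^ (- 2^-1) * expR (- (x ^+ 2 / 4)))%R)).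
- by rewrite big1// => i _; exact: integral_gauss1.
- move=> _; apply: measurable_funM => //.
  apply: measurableT_comp => //; apply: measurableT_comp => //.
  by apply: measurable_funM => //; exact: exprn_measurable.
- by move=> _ x; rewrite mulr_ge0 ?powR_ge0 ?expR_ge0.
Qed.

End heat_kernel_integral.
Section gaussian_expectation.
Context {R : realType} {n : nat}.
Implicit Types (x y z : 'rV[R]_n) (s t : R).
Local Notation mu := (@lebesgue_rV R n).

(** Stated without integrability: both sides are differences of the integrals of the positive and
    negative parts, and each part falls under the nonnegative case. *)
Lemma integral_affine_rV (a : 'rV[R]_n) (c : R) (F : 'rV[R]_n -> R) : 0 < c ->
  measurable_fun setT F ->
  (\int[mu]_x (F x)%:E = \int[mu]_x (c ^+ n * F (a + c *: x))%:E)%E.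
Proof.
move=> c0 mF.
have mFa : measurable_fun setT (fun x : 'rV[R]_n => F (a + c *: x)).
  exact: (measurableT_comp mF (measurable_affine_rV _ _)).
have cn0 : 0 <= c ^+ n by rewrite exprn_ge0// ltW.
have E (G : 'rV[R]_n -> R) : measurable_fun setT G -> (forall x, 0 <= G x) ->
    (\int[mu]_x (G x)%:E = \int[mu]_x (c ^+ n * G (a + c *: x))%:E)%E.
  move=> mG G0; rewrite -(@ge0_integral_affine_rV _ n a c (EFin \o G))//; last first.
    exact/measurable_EFinP.
  under [RHS]eq_integral do rewrite EFinM.
  rewrite ge0_integralZl//.
  - apply/measurable_EFinP.
    exact: (measurableT_comp mG (measurable_affine_rV _ _)).
  - by move=> x _; rewrite lee_fin.
rewrite [LHS]integralE [RHS]integralE; congr (_ - _)%E.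
  transitivity (\int[mu]_x (F^\+ x)%:E)%E.
    by apply: eq_integral => x _; rewrite -[LHS]/((EFin \o F)^\+ x)%E funerpos.
  rewrite (E _ (measurable_funrpos mF) (@funrpos_ge0 _ _ F)).
  apply: eq_integral => x _.
  rewrite -[RHS]/((EFin \o (fun x => c ^+ n * F (a + c *: x))%R)^\+ x)%E funerpos/=.
  by rewrite /funrpos/= maxr_pMr ?mulr0.
transitivity (\int[mu]_x (F^\- x)%:E)%E.
  by apply: eq_integral => x _; rewrite -[LHS]/((EFin \o F)^\- x)%E funerneg.
rewrite (E _ (measurable_funrneg mF) (@funrneg_ge0 _ _ F)).
apply: eq_integral => x _.
rewrite -[RHS]/((EFin \o (fun x => c ^+ n * F (a + c *: x))%R)^\- x)%E funerneg/=.
by rewrite /funrneg/= maxr_pMr ?mulr0 ?mulrN.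
Qed.

(** Every heat convolution is rewritten through this fixed Gaussian by the substitution y = x +
    sqrt(t) z. The time then sits in the argument of f, so limits and derivatives in time act on f
    and not on the kernel. *)
Definition gexp (f : 'rV[R]_n -> R) : R := \int[mu]_z (heat_kernel 1 z * f z).

(** The heat semigroup on nonnegative functions with values in [0, +oo]. Tonelli applies to it
    without integrability, which suits gradients known only to lie in some L^q. *)
Definition heatE t (f : 'rV[R]_n -> \bar R) x : \bar R :=
  (\int[mu]_y ((heat_kernel t (x - y)%R)%:E * f y))%E.

Lemma measurable_subr_l x : measurable_fun setT (fun y : 'rV[R]_n => x - y).
Proof.
apply: measurable_fun_rV => i; under eq_fun do rewrite !mxE.
by apply: measurable_funB => //; exact: measurable_coord.
Qed.

Lemma measurable_heat_kernel_l t x :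
  measurable_fun setT (fun y : 'rV[R]_n => heat_kernel t (x - y)).
Proof. exact: (measurableT_comp (measurable_heat_kernel t) (measurable_subr_l x)). Qed.

Lemma heat_kernel_affine t x z : 0 < t ->
  Num.sqrt t ^+ n * heat_kernel t (x - (x + Num.sqrt t *: z)) = heat_kernel 1 z.
Proof.
move=> t0; rewrite opprD addrA subrr add0r heat_kernelN mulrC.
exact: heat_kernel_scale.
Qed.

Lemma ge0_integralZl_real d (T : measurableType d) (m : {measure set T -> \bar R})
    (f : T -> \bar R) (k : R) :
  0 <= k -> measurable_fun setT f -> (forall w, 0 <= f w)%E ->
  (\int[m]_w (k%:E * f w) = k%:E * \int[m]_w f w)%E.
Proof. by move=> k0 mf f0; rewrite ge0_integralZl. Qed.

Lemma heat_convolutionE t (f : 'rV[R]_n -> R) x : 0 < t ->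
  measurable_fun setT f ->
  heat_convolution t f x = gexp (fun z => f (x + Num.sqrt t *: z)).
Proof.
move=> t0 mf; rewrite /heat_convolution /gexp /Rintegral; congr fine.
rewrite (@integral_affine_rV x (Num.sqrt t)) ?sqrtr_gt0//; last first.
  by apply: measurable_funM => //; exact: measurable_heat_kernel_l.
by apply: eq_integral => z _; rewrite mulrA heat_kernel_affine.
Qed.

Lemma heatEE t (f : 'rV[R]_n -> \bar R) x : 0 < t ->
  measurable_fun setT f -> (forall y, 0 <= f y)%E ->
  (heatE t f x = \int[mu]_z ((heat_kernel 1 z)%:E * f (x + Num.sqrt t *: z)%R))%E.
Proof.
move=> t0 mf f0; have s0 : 0 < Num.sqrt t by rewrite sqrtr_gt0.
have mk : measurable_fun setT (fun y : 'rV[R]_n => (heat_kernel t (x - y)%R)%:E * f y)%E.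
  apply: emeasurable_funM => //; apply/measurable_EFinP.
  exact: measurable_heat_kernel_l.
rewrite /heatE -(@ge0_integral_affine_rV _ n x (Num.sqrt t))//; last first.
  by move=> y; rewrite mule_ge0// lee_fin heat_kernel_ge0.
rewrite -(@ge0_integralZl_real _ _ mu); last 3 first.
- by rewrite exprn_ge0// ltW.
- exact: (measurableT_comp mk (measurable_affine_rV x (Num.sqrt t))).
- by move=> y; rewrite mule_ge0// lee_fin heat_kernel_ge0.
by apply: eq_integral => z _; rewrite muleA -EFinM heat_kernel_affine.
Qed.

Lemma integral_heat_kernel t y : 0 < t ->
  (\int[mu]_z (heat_kernel t (z - y)%R)%:E = 1)%E.
Proof.
move=> t0; rewrite -[RHS](@integral_heat_kernel1 R n).
have -> : (\int[mu]_z (heat_kernel t (z - y)%R)%:E = heatE t (cst 1) y)%E.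
  by apply: eq_integral => z _; rewrite mule1 -heat_kernelN opprB.
by rewrite heatEE//; apply: eq_integral => z _; rewrite mule1.
Qed.

Lemma heatE_ge0 t f x : (forall y, 0 <= f y)%E -> (0 <= heatE t f x)%E.
Proof.
by move=> f0; apply: integral_ge0 => y _; rewrite mule_ge0// lee_fin heat_kernel_ge0.
Qed.

Lemma measurable_heat_kernel2 t :
  measurable_fun setT (fun z : 'rV[R]_n * 'rV[R]_n => heat_kernel t (z.1 - z.2)).
Proof.
apply: (measurableT_comp (measurable_heat_kernel t)).
apply: measurable_fun_rV => i; under eq_fun do rewrite !mxE.
apply: measurable_funB.
  exact: (measurableT_comp (measurable_coord i) measurable_fst).
exact: (measurableT_comp (measurable_coord i) measurable_snd).
Qed.

Lemma measurable_heatE t f : measurable_fun setT f -> (forall y, 0 <= f y)%E ->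
  measurable_fun setT (heatE t f).
Proof.
move=> mf f0.
apply: (measurable_fun_fubini_tonelli_F (m2 := mu)
  (fun z : 'rV[R]_n * 'rV[R]_n => (heat_kernel t (z.1 - z.2)%R)%:E * f z.2)%E).
  apply: emeasurable_funM; last exact: (measurableT_comp mf measurable_snd).
  apply/measurable_EFinP; exact: measurable_heat_kernel2.
by move=> z; rewrite mule_ge0// lee_fin heat_kernel_ge0.
Qed.

Lemma heatE_semigroup s t f x : 0 < s -> 0 < t ->
  measurable_fun setT f -> (forall y, 0 <= f y)%E ->
  heatE s (heatE t f) x = heatE (s + t) f x.
Proof.
move=> s0 t0 mf f0; have st0 : 0 < s + t by rewrite addr_gt0.
rewrite /heatE.
transitivity (\int[mu]_z \int[mu]_y ((heat_kernel s (x - z)%R)%:E *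
    ((heat_kernel t (z - y)%R)%:E * f y)))%E.
  apply: eq_integral => z _; rewrite -(@ge0_integralZl_real _ _ mu) ?heat_kernel_ge0//.
  - apply: emeasurable_funM => //; apply/measurable_EFinP.
    exact: measurable_heat_kernel_l.
  - by move=> y; rewrite mule_ge0// lee_fin heat_kernel_ge0.
rewrite (fubini_tonelli (fun z : 'rV[R]_n * 'rV[R]_n => (heat_kernel s (x - z.1)%R)%:E *
    ((heat_kernel t (z.1 - z.2)%R)%:E * f z.2))%E)/=; last 2 first.
- apply: emeasurable_funM; first apply/measurable_EFinP.
    exact: (measurableT_comp (measurable_heat_kernel_l s x) measurable_fst).
  apply: emeasurable_funM; last exact: (measurableT_comp mf measurable_snd).
  by apply/measurable_EFinP; exact: measurable_heat_kernel2.
- by move=> z; rewrite !mule_ge0// lee_fin heat_kernel_ge0.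
apply: eq_integral => y _.
have st : 0 < s * t / (s + t) by rewrite divr_gt0// mulr_gt0.
pose m := (s + t)^-1 *: (t *: x + s *: y).
transitivity (\int[mu]_z (((heat_kernel (s + t) (x - y)%R)%:E * f y) *
    (heat_kernel (s * t / (s + t)) (z - m)%R)%:E))%E.
  apply: eq_integral => z _.
  by rewrite muleA -EFinM heat_kernelM// EFinM muleAC.
rewrite ge0_integralZl.
- by rewrite integral_heat_kernel// mule1.
- exact: measurableT.
- apply/measurable_EFinP; apply: (measurableT_comp (measurable_heat_kernel _)).
  apply: measurable_fun_rV => i; under eq_fun do rewrite !mxE.
  by apply: measurable_funB => //; exact: measurable_coord.
- by move=> z _; rewrite lee_fin heat_kernel_ge0.
- by rewrite mule_ge0// lee_fin heat_kernel_ge0.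
Qed.

End gaussian_expectation.

Lemma cvg_le_cst (R : realType) (T : Type) (F : set_system T)
    {FF : ProperFilter F} (u : T -> R) (l K : R) :
  u x @[x --> F] --> l -> (\forall x \near F, u x <= K) -> l <= K.
Proof.
move=> ul uK; have <- : lim (u x @[x --> F]) = l by apply/cvg_lim.
by apply: limr_le => //; apply/cvg_ex; exists l.
Qed.

(** * Gaussian expectations of functions of polynomial growth *)

Section tame_functions.
Context {R : realType} {n : nat}.
Implicit Types (f g : 'rV[R]_n -> R).
Local Notation mu := (@lebesgue_rV R n).

(** From 1 + y <= e^y at y = X / (8k), raised to the power k. *)
Lemma poly_exp_bound k : exists2 C : R, 0 <= C &
  forall X, 0 <= X -> (1 + X) ^+ k * expR (- (X / 8)) <= C.
Proof.
case: k => [|k].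
  exists 1 => // X X0; rewrite expr0 mul1r -expR0 ler_expR oppr_le0.
  by rewrite divr_ge0.
have k0 : 0 < k.+1%:R :> R by [].
have k1 : 1 <= k.+1%:R :> R by rewrite ler1n.
exists ((8 * k.+1%:R) ^+ k.+1); first by rewrite exprn_ge0// mulr_ge0.
move=> X X0.
have h : 1 + X <= 8 * k.+1%:R * expR (X / (8 * k.+1%:R)).
  have h1 := expR_ge1Dx (X / (8 * k.+1%:R)).
  have h2 : 8 * k.+1%:R * (1 + X / (8 * k.+1%:R)) = 8 * k.+1%:R + X.
    by field; rewrite gt_eqF.
  apply: le_trans (_ : 8 * k.+1%:R + X <= _); first by rewrite lerD2r; lra.
  by rewrite -h2 ler_pM2l// mulr_gt0.
have -> : expR (- (X / 8)) = (expR (- (X / (8 * k.+1%:R)))) ^+ k.+1.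
  rewrite -expRM_natl; congr expR; rewrite mulrN; congr (- _).
  by field; rewrite gt_eqF.
rewrite -exprMn lerXn2r ?nnegrE ?mulr_ge0 ?expR_ge0 ?addr_ge0//.
by rewrite expRN ler_pdivrMr ?expR_gt0.
Qed.

(** The kernels at times 1 and 2 decay like e^{-X/4} and e^{-X/8} with X = |z|^2; the spare factor
    e^{-X/8} absorbs the polynomial. Trading a weight for a doubling of time recurs throughout. *)
Lemma heat_kernel1_poly k : exists2 C : R, 0 <= C &
  forall z : 'rV[R]_n, heat_kernel 1 z * (1 + enorm z ^+ 2) ^+ k <= C * heat_kernel 2 z.
Proof.
have [C C0 CP] := poly_exp_bound k.
have a0 : 0 < (4 * pi * 2 : R) `^ (- (n%:R / 2)).
  by rewrite powR_gt0// !mulr_gt0// pi_gt0.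
exists (C * ((4 * pi * 1) `^ (- (n%:R / 2)) / (4 * pi * 2) `^ (- (n%:R / 2)))).
  by rewrite mulr_ge0// divr_ge0// powR_ge0.
move=> z; rewrite /heat_kernel; set X := enorm z ^+ 2.
have X0 : 0 <= X by exact: sqr_ge0.
rewrite [leRHS](_ : _ = (4 * pi * 1) `^ (- (n%:R / 2)) * (C * expR (- (X / (4 * 2))))); last first.
  by field; rewrite gt_eqF.
rewrite -mulrA ler_wpM2l ?powR_ge0// mulr1.
have -> : - (X / 4) = - (X / 8) + - (X / (4 * 2)) by field.
rewrite expRD mulrAC ler_wpM2r ?expR_ge0// mulrC.
exact: CP.
Qed.

Lemma integrable_heat_kernel t (x : 'rV[R]_n) : 0 < t ->
  mu.-integrable setT (fun z => (heat_kernel t (x - z))%:E).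
Proof.
move=> t0; apply/integrableP; split.
  by apply/measurable_EFinP; exact: measurable_heat_kernel_l.
under eq_integral => z _ do
  rewrite gee0_abs ?lee_fin ?heat_kernel_ge0// -heat_kernelN opprB.
by rewrite integral_heat_kernel// ltry.
Qed.

Definition poly_bounded f : Prop :=
  exists K k, forall z, `|f z| <= K * (1 + enorm z ^+ 2) ^+ k.

(** Closed under products and integrable against the Gaussian. Bounded functions would not suffice:
    integration by parts produces the weights z_i. *)
Definition tame f : Prop := measurable_fun setT f /\ poly_bounded f.

Lemma ge1_bracket (z : 'rV[R]_n) : 1 <= 1 + enorm z ^+ 2.
Proof. by rewrite lerDl sqr_ge0. Qed.

Lemma poly_bounded_ge0 f : poly_bounded f ->
  exists K k, 0 <= K /\ forall z, `|f z| <= K * (1 + enorm z ^+ 2) ^+ k.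
Proof.
move=> [K [k h]]; exists `|K|, k; split=> // z.
by rewrite (le_trans (h z))// ler_wpM2r ?ler_norm// exprn_ge0// (le_trans _ (ge1_bracket z)).
Qed.

Lemma tame_bounded f K : measurable_fun setT f -> (forall z, `|f z| <= K) -> tame f.
Proof. by move=> mf h; split=> //; exists K, 0%N => z; rewrite expr0 mulr1. Qed.

Lemma tame_cst c : tame (fun=> c).
Proof. exact: (@tame_bounded _ `|c|). Qed.

Lemma tameM f g : tame f -> tame g -> tame (fun z => f z * g z).
Proof.
move=> [mf /poly_bounded_ge0[K [k [K0 hf]]]] [mg [L [l hg]]].
split; first exact: measurable_funM.
exists (K * L), (k + l)%N => z.
by rewrite normrM exprD mulrACA ler_pM.
Qed.

Lemma tameD f g : tame f -> tame g -> tame (fun z => f z + g z).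
Proof.
move=> [mf /poly_bounded_ge0[K [k [K0 hf]]]] [mg /poly_bounded_ge0[L [l [L0 hg]]]].
split; first exact: measurable_funD.
exists (K + L), (k + l)%N => z.
rewrite (le_trans (ler_normD _ _))// mulrDl lerD//.
  by rewrite (le_trans (hf z))// ler_wpM2l// ler_weXn2l ?ge1_bracket// leq_addr.
by rewrite (le_trans (hg z))// ler_wpM2l// ler_weXn2l ?ge1_bracket// leq_addl.
Qed.

Lemma tameZ c f : tame f -> tame (fun z => c * f z).
Proof. by move=> tf; apply: tameM => //; exact: tame_cst. Qed.

Lemma tameN f : tame f -> tame (fun z => - f z).
Proof.
move=> [mf [K [k h]]]; split; first exact: measurable_funN.
by exists K, k => z; rewrite normrN.
Qed.

Lemma tameB f g : tame f -> tame g -> tame (fun z => f z - g z).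
Proof. by move=> tf tg; apply: tameD => //; exact: tameN. Qed.

Lemma tame_sum I (s : seq I) (F : I -> 'rV[R]_n -> R) :
  (forall i, tame (F i)) -> tame (fun z => \sum_(i <- s) F i z).
Proof.
move=> tF; elim: s => [|i s IH].
  by under eq_fun do rewrite big_nil; exact: tame_cst.
by under eq_fun do rewrite big_cons; exact: tameD.
Qed.

Lemma tame_norm f : tame f -> tame (fun z => `|f z|).
Proof.
move=> [mf [K [k h]]]; split; first exact: measurableT_comp.
by exists K, k => z; rewrite normr_id.
Qed.

Lemma coord_le_bracket (z : 'rV[R]_n) i : `|z 0 i| <= 1 + enorm z ^+ 2.
Proof.
apply: le_trans (coord_le_enorm z i) _; have := enorm_ge0 z.
by have := sqr_ge0 (enorm z - 1); nra.
Qed.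

Lemma tame_coord i : tame (fun z => z 0 i).
Proof.
split; first exact: measurable_coord.
by exists 1, 1%N => z; rewrite expr1 mul1r coord_le_bracket.
Qed.

Lemma integrable_tame f : tame f ->
  mu.-integrable setT (fun z => (heat_kernel 1 z * f z)%:E).
Proof.
move=> [mf /poly_bounded_ge0[K [k [K0 h]]]].
have [C C0 CP] := heat_kernel1_poly k.
have i2 := integrable_heat_kernel 0 (ltr0n R 2).
apply: (le_integrable _ _ _ (integrableZl measurableT (K * C) i2)) => //.
  by apply/measurable_EFinP/measurable_funM => //; exact: measurable_heat_kernel.
move=> z _; rewrite sub0r heat_kernelN lee_fin.
rewrite [leLHS]normrM (ger0_norm (heat_kernel_ge0 _ _)).
rewrite [leRHS]ger0_norm; last first.
  by apply: mulr_ge0; [exact: mulr_ge0|exact: heat_kernel_ge0].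
rewrite -(mulrA K); apply: le_trans (ler_wpM2l K0 (CP z)).
by rewrite mulrCA ler_wpM2l ?heat_kernel_ge0.
Qed.

Lemma gexp_EFin f : tame f -> (gexp f)%:E = (\int[mu]_z (heat_kernel 1 z * f z)%:E)%E.
Proof. by move=> tf; rewrite /gexp fineK//; apply: integrable_fin_num => //; exact: integrable_tame. Qed.

Lemma eq_gexp f g : f =1 g -> gexp f = gexp g.
Proof. by move=> /funext ->. Qed.

Lemma gexpD f g : tame f -> tame g -> gexp (fun z => f z + g z) = gexp f + gexp g.
Proof.
move=> tf tg; rewrite /gexp -RintegralD//; try exact: integrable_tame.
by apply: eq_Rintegral => z _; rewrite mulrDr.
Qed.

Lemma gexpZ c f : tame f -> gexp (fun z => c * f z) = c * gexp f.
Proof.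
move=> tf; rewrite /gexp -RintegralZl//; try exact: integrable_tame.
by apply: eq_Rintegral => z _; rewrite mulrCA.
Qed.

Lemma gexpN f : tame f -> gexp (fun z => - f z) = - gexp f.
Proof. by move=> tf; rewrite -mulN1r -gexpZ//; apply: eq_gexp => z; rewrite mulN1r. Qed.

Lemma gexpB f g : tame f -> tame g -> gexp (fun z => f z - g z) = gexp f - gexp g.
Proof. by move=> tf tg; rewrite gexpD ?gexpN//; exact: tameN. Qed.

Lemma gexp_cst (c : R) : gexp (fun _ : 'rV[R]_n => c) = c.
Proof.
apply: EFin_inj; rewrite gexp_EFin; last exact: tame_cst.
have := @integral_heat_kernel1 R n.
under [in X in _ -> X]eq_integral do rewrite mulrC EFinM.
move=> h; rewrite integralZl// ?h ?mule1//.
have := @integrable_heat_kernel 1 0 ltr01.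
by apply: eq_integrable => // z _; rewrite sub0r heat_kernelN.
Qed.

Lemma gexp_sum I (s : seq I) (F : I -> 'rV[R]_n -> R) :
  (forall i, tame (F i)) ->
  gexp (fun z => \sum_(i <- s) F i z) = \sum_(i <- s) gexp (F i).
Proof.
move=> tF; elim: s => [|i s IH].
  by rewrite big_nil -[RHS]gexp_cst; apply: eq_gexp => z; rewrite big_nil.
rewrite big_cons -IH -gexpD//; last exact: tame_sum.
by apply: eq_gexp => z; rewrite big_cons.
Qed.

Lemma ler_gexp f g : tame f -> tame g -> (forall z, f z <= g z) -> gexp f <= gexp g.
Proof.
move=> tf tg fg; apply: le_Rintegral => //; try exact: integrable_tame.
by move=> z _; rewrite ler_wpM2l ?heat_kernel_ge0.
Qed.

Lemma gexp_ge0 f : (forall z, 0 <= f z) -> 0 <= gexp f.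
Proof. by move=> f0; apply: Rintegral_ge0 => z _; rewrite mulr_ge0 ?heat_kernel_ge0. Qed.

Lemma ler_norm_gexp f : tame f -> `|gexp f| <= gexp (fun z => `|f z|).
Proof.
move=> tf; apply: (le_trans (le_normr_Rintegral _ _)) => //.
  exact: integrable_tame.
rewrite le_eqVlt; apply/orP; left; apply/eqP; apply: eq_Rintegral => z _.
by rewrite normrM ger0_norm ?heat_kernel_ge0.
Qed.

Lemma gexp_bounded f K : measurable_fun setT f -> (forall z, `|f z| <= K) -> `|gexp f| <= K.
Proof.
move=> mf fK; have tf := tame_bounded mf fK.
apply: le_trans (ler_norm_gexp tf) _; rewrite -[leRHS]gexp_cst.
by apply: ler_gexp => //; [exact: tame_norm|exact: tame_cst].
Qed.

Lemma cvg_gexp (F : nat -> 'rV[R]_n -> R) f K k :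
  (forall m, measurable_fun setT (F m)) ->
  (forall m z, `|F m z| <= K * (1 + enorm z ^+ 2) ^+ k) ->
  (forall z, F m z @[m --> \oo] --> f z) ->
  gexp (F m) @[m --> \oo] --> gexp f.
Proof.
move=> mF FK Ff.
have tF m : tame (F m) by split=> //; exists K, k.
have mf : measurable_fun setT f by apply: measurable_fun_cvg => // z _; exact: Ff.
have tb : tame (fun z : 'rV[R]_n => K * (1 + enorm z ^+ 2) ^+ k).
  split.
    apply: measurable_funM => //; apply: (measurableT_comp (exprn_measurable k)).
    by apply: measurable_funD => //; exact: measurable_enorm_sqr.
  exists `|K|, k => z; rewrite normrM [X in _ * X]ger0_norm// exprn_ge0//.
  exact: le_trans (ge1_bracket z).
have fK z : `|f z| <= K * (1 + enorm z ^+ 2) ^+ k.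
  apply: (cvg_le_cst (cvg_norm (Ff z))).
  by apply: nearW => m; exact: FK.
have tf : tame f by split=> //; exists K, k.
have dom z m : setT z -> (`|(heat_kernel 1 z * F m z)%:E| <=
    (heat_kernel 1 z * (K * (1 + enorm z ^+ 2) ^+ k))%:E)%E.
  by move=> _; rewrite lee_fin normrM ger0_norm ?ler_wpM2l ?heat_kernel_ge0.
have pw z : setT z -> (heat_kernel 1 z * F m z)%:E @[m --> \oo] --> (heat_kernel 1 z * f z)%:E.
  move=> _; apply: cvg_EFin; first exact: nearW.
  by apply: cvgM; [exact: cvg_cst|exact: Ff].
have [_ _ h] := @dominated_convergence _ _ _ mu setT measurableT
  (fun m z => (heat_kernel 1 z * F m z)%:E) (fun z => (heat_kernel 1 z * f z)%:E)
  (fun z => (heat_kernel 1 z * (K * (1 + enorm z ^+ 2) ^+ k))%:E)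
  (fun m => (measurable_int _ (integrable_tame (tF m))))
  (measurable_int _ (integrable_tame tf))
  (aeW _ pw) (integrable_tame tb) (aeW _ dom).
rewrite -[gexp f]/(fine (gexp f)%:E).
by apply: fine_cvg; rewrite gexp_EFin.
Qed.

End tame_functions.

(** * The heat semigroup and mild solutions *)

Section heat_operator.
Context {R : realType} {n : nat}.
Implicit Types (f g : 'rV[R]_n -> R) (s t K : R).
Local Notation mu := (@lebesgue_rV R n).

Lemma measurable_comp_affine f (a : 'rV[R]_n) (c : R) : measurable_fun setT f ->
  measurable_fun setT (fun z : 'rV[R]_n => f (a + c *: z)).
Proof. by move=> mf; exact: (measurableT_comp mf (measurable_affine_rV _ _)). Qed.

Lemma tame_comp_affine f (a : 'rV[R]_n) (c K : R) : measurable_fun setT f ->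
  (forall z, `|f z| <= K) -> tame (fun z : 'rV[R]_n => f (a + c *: z)).
Proof. by move=> mf fK; apply: (@tame_bounded _ _ _ K) => //; exact: measurable_comp_affine. Qed.

Lemma heat_convolution_bound t f K x : 0 < t -> measurable_fun setT f ->
  (forall z, `|f z| <= K) -> `|heat_convolution t f x| <= K.
Proof.
move=> t0 mf fK; rewrite heat_convolutionE//.
by apply: gexp_bounded => //; exact: measurable_comp_affine.
Qed.

Lemma heat_convolution_cst t (c : R) (x : 'rV[R]_n) : 0 < t ->
  heat_convolution t (fun=> c) x = c.
Proof. by move=> t0; rewrite heat_convolutionE// gexp_cst. Qed.

Lemma heat_convolutionD t f g Kf Kg x : 0 < t ->
  measurable_fun setT f -> (forall z, `|f z| <= Kf) ->
  measurable_fun setT g -> (forall z, `|g z| <= Kg) ->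
  heat_convolution t (fun z => f z + g z) x =
  heat_convolution t f x + heat_convolution t g x.
Proof.
move=> t0 mf fK mg gK; rewrite !heat_convolutionE//; last exact: measurable_funD.
by rewrite gexpD//; [exact: tame_comp_affine fK|exact: tame_comp_affine gK].
Qed.

Lemma heat_convolutionB t f g Kf Kg x : 0 < t ->
  measurable_fun setT f -> (forall z, `|f z| <= Kf) ->
  measurable_fun setT g -> (forall z, `|g z| <= Kg) ->
  heat_convolution t (fun z => f z - g z) x =
  heat_convolution t f x - heat_convolution t g x.
Proof.
move=> t0 mf fK mg gK; rewrite !heat_convolutionE//; last exact: measurable_funB.
by rewrite gexpB//; [exact: tame_comp_affine fK|exact: tame_comp_affine gK].
Qed.

Lemma ler_heat_convolution t f g Kf Kg x : 0 < t ->
  measurable_fun setT f -> (forall z, `|f z| <= Kf) ->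
  measurable_fun setT g -> (forall z, `|g z| <= Kg) ->
  (forall z, f z <= g z) ->
  heat_convolution t f x <= heat_convolution t g x.
Proof.
move=> t0 mf fK mg gK fg; rewrite !heat_convolutionE//.
by apply: ler_gexp => //; [exact: tame_comp_affine fK|exact: tame_comp_affine gK].
Qed.

Lemma heat_convolution_ge0 t f x : (forall z, 0 <= f z) -> 0 <= heat_convolution t f x.
Proof. by move=> f0; apply: Rintegral_ge0 => z _; rewrite mulr_ge0 ?heat_kernel_ge0. Qed.

Lemma ler_norm_heat_convolution t f K x : 0 < t ->
  measurable_fun setT f -> (forall z, `|f z| <= K) ->
  `|heat_convolution t f x| <= heat_convolution t (fun z => `|f z|) x.
Proof.
move=> t0 mf fK; rewrite !heat_convolutionE//; last exact: measurableT_comp.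
by apply: ler_norm_gexp; exact: tame_comp_affine fK.
Qed.

Lemma heat_convolution_EFin t f K x : 0 < t ->
  measurable_fun setT f -> (forall z, 0 <= f z) -> (forall z, `|f z| <= K) ->
  (heat_convolution t f x)%:E = heatE t (EFin \o f) x.
Proof.
move=> t0 mf f0 fK; rewrite heat_convolutionE// heatEE//; last exact/measurable_EFinP.
rewrite gexp_EFin; last exact: tame_comp_affine fK.
by apply: eq_integral => z _; rewrite EFinM.
Qed.

Lemma heat_convolution_shift t f (h x : 'rV[R]_n) : 0 < t -> measurable_fun setT f ->
  heat_convolution t f (x + h) = heat_convolution t (fun z => f (z + h)) x.
Proof.
move=> t0 mf; rewrite !heat_convolutionE//.
  by apply: eq_gexp => z; rewrite addrAC.
have := measurable_comp_affine h 1 mf.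
by under eq_fun do rewrite scale1r addrC.
Qed.

(** Adding the constant K makes f nonnegative, where measurability comes from Tonelli; P_t K = K is
    then subtracted. The same shift extends the semigroup law and Fubini to bounded functions of any
    sign. *)
Lemma measurable_heat_convolution t f K : 0 < t ->
  measurable_fun setT f -> (forall z, `|f z| <= K) ->
  measurable_fun setT (heat_convolution t f).
Proof.
move=> t0 mf fK.
have K0 : 0 <= K by exact: le_trans (normr_ge0 _) (fK 0).
have fK' z : 0 <= f z + K by have := fK z; rewrite ler_norml => /andP[h _]; rewrite -lerBlDr sub0r.
have mfK : measurable_fun setT (fun z => f z + K) by exact: measurable_funD.
have h z : `|f z + K| <= K + K by rewrite (le_trans (ler_normD _ _))// lerD// ger0_norm.
have E : heat_convolution t f = fun x => fine (heatE t (EFin \o (fun z => f z + K)) x) - K.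
  apply/funext => x; rewrite -(heat_convolution_EFin _ t0 mfK fK' h)/=.
  rewrite (@heat_convolutionD t f (fun=> K) K K)//; last by move=> _; rewrite ger0_norm.
  by rewrite heat_convolution_cst// addrK.
rewrite E; apply: measurable_funB => //.
apply: measurableT_comp; first exact: fine_measurable.
apply: measurable_heatE; first exact/measurable_EFinP.
by move=> y; rewrite lee_fin.
Qed.

Lemma heat_semigroup_ge0 s t f K x : 0 < s -> 0 < t ->
  measurable_fun setT f -> (forall z, 0 <= f z) -> (forall z, `|f z| <= K) ->
  heat_convolution s (heat_convolution t f) x = heat_convolution (s + t) f x.
Proof.
move=> s0 t0 mf f0 fK; apply: EFin_inj.
rewrite (@heat_convolution_EFin s _ K)//; last 3 first.
- exact: measurable_heat_convolution fK.
- by move=> z; exact: heat_convolution_ge0.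
- by move=> z; exact: heat_convolution_bound.
rewrite (@heat_convolution_EFin (s + t) _ K) ?addr_gt0//.
rewrite -heatE_semigroup//; last exact/measurable_EFinP.
congr (heatE s _ x); apply/funext => y /=.
exact: heat_convolution_EFin.
Qed.

Lemma heat_semigroup s t f K x : 0 < s -> 0 < t ->
  measurable_fun setT f -> (forall z, `|f z| <= K) ->
  heat_convolution s (heat_convolution t f) x = heat_convolution (s + t) f x.
Proof.
move=> s0 t0 mf fK; have st0 : 0 < s + t by rewrite addr_gt0.
have K0 : 0 <= K by exact: le_trans (normr_ge0 _) (fK 0).
have fK' z : 0 <= f z + K by have := fK z; rewrite ler_norml => /andP[h _]; rewrite -lerBlDr sub0r.
have mfK : measurable_fun setT (fun z => f z + K) by exact: measurable_funD.
have h z : `|f z + K| <= K + K by rewrite (le_trans (ler_normD _ _))// lerD// ger0_norm.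
have KK (z : 'rV[R]_n) : `|K| <= K by rewrite ger0_norm.
have := heat_semigroup_ge0 x s0 t0 mfK fK' h.
rewrite (@heat_convolutionD (s + t) f (fun=> K) K K)// heat_convolution_cst//.
have -> : heat_convolution t (fun z => f z + K) = fun z => heat_convolution t f z + K.
  by apply/funext => z; rewrite (@heat_convolutionD t f (fun=> K) K K)// heat_convolution_cst.
rewrite (@heat_convolutionD s _ (fun=> K) K K)//; last 2 first.
- exact: measurable_heat_convolution fK.
- by move=> z; exact: heat_convolution_bound.
by rewrite heat_convolution_cst// => /addIr.
Qed.

Lemma expR_sub1_bound (a : R) : `|expR a - 1| <= `|a| * expR `|a|.
Proof.
have [a0|a0] := leP 0 a.
  rewrite (ger0_norm a0) ger0_norm; last by rewrite subr_ge0 -[leLHS]expR0 ler_expR.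
  have := expR_ge1Dx (- a); rewrite expRN => h.
  have e0 := expR_gt0 a.
  have : 1 - a <= (expR a)^-1 by [].
  rewrite -(ler_pM2r e0) mulVf ?gt_eqF// => h2.
  by rewrite lerBlDr; lra.
rewrite (ltr0_norm a0) ler0_norm; last by rewrite subr_le0 -[leRHS]expR0 ler_expR ltW.
have := expR_ge1Dx a => h.
apply: le_trans (_ : - a <= _); first by lra.
by rewrite ler_peMr ?oppr_ge0 ?(ltW a0)// -[leLHS]expR0 ler_expR oppr_ge0 ltW.
Qed.

Definition unit_vec (i : 'I_n) : 'rV[R]_n := delta_mx 0 i.

Lemma enorm_shift (z : 'rV[R]_n) (k : R) i :
  enorm (z + k *: unit_vec i) ^+ 2 = enorm z ^+ 2 + 2 * k * z 0 i + k ^+ 2.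
Proof.
rewrite !enorm_sqr (bigD1 i)//= [in RHS](bigD1 i)//= !mxE !eqxx/= mulr1.
rewrite (eq_bigr (fun j => z 0 j ^+ 2)); first by ring.
by move=> j ji; rewrite !mxE (negbTE ji) andbF mulr0 addr0.
Qed.

(** The shifted kernel is the kernel times e^a with |a| <= |k| T, so |e^a - 1| <= |a| e^{|a|} yields
    the factor |k|, and T e^T is absorbed by passing to time 2. *)
Lemma heat_kernel1_shift : exists2 C : R, 0 <= C & forall i (z : 'rV[R]_n) k, `|k| <= 1 ->
  `|heat_kernel 1 (z + k *: unit_vec i) - heat_kernel 1 z| <= `|k| * (C * heat_kernel 2 z).
Proof.
pose A : R := (4 * pi * 1) `^ (- (n%:R / 2)).
pose B : R := (4 * pi * 2) `^ (- (n%:R / 2)).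
have A0 : 0 <= A by exact: powR_ge0.
have B0 : 0 < B by rewrite powR_gt0// !mulr_gt0// pi_gt0.
pose D : R := expR (5 / 2).
exists (A / B * D).
  by rewrite mulr_ge0 ?expR_ge0// divr_ge0// ltW.
move=> i z k k1.
pose a : R := - ((2 * k * z 0 i + k ^+ 2) / 4).
have -> : heat_kernel 1 (z + k *: unit_vec i) = heat_kernel 1 z * expR a.
  rewrite /heat_kernel enorm_shift -[RHS]mulrA -expRD; congr (_ * expR _).
  by rewrite /a; field.
rewrite -{2}[heat_kernel 1 z]mulr1 -mulrBr normrM (ger0_norm (heat_kernel_ge0 _ _)).
have aK : `|a| <= `|k| * ((2 * `|z 0 i| + 1) / 4).
  rewrite /a normrN normrM [`|4^-1|]ger0_norm// mulrA ler_wpM2r//.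
  rewrite (le_trans (ler_normD _ _))// normrX !normrM ger0_norm// mulrDr mulr1 lerD//.
    by rewrite mulrCA mulrA.
  by rewrite expr2 ler_piMr.
pose T := (2 * `|z 0 i| + 1) / 4.
have T0 : 0 <= T by rewrite divr_ge0// addr_ge0// mulr_ge0.
have aT : `|a| <= T by apply: (le_trans aK); rewrite ler_piMl.
have h1 : `|expR a - 1| <= `|k| * (T * expR T).
  apply: (le_trans (expR_sub1_bound a)); rewrite mulrA.
  by apply: ler_pM; rewrite ?expR_ge0// ler_expR.
apply: le_trans (ler_wpM2l (heat_kernel_ge0 1 z) h1) _.
rewrite mulrCA ler_wpM2l//.
(* Here T e^T <= e^{2T} and 2T = |z_i| + 1/2 <= |z|^2 / 8 + 2 + 1/2, which explains the exponent 5/2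
   in [D]. *)
have h2 : T * expR T <= expR (enorm z ^+ 2 / 8) * D.
  apply: le_trans (_ : expR T * expR T <= _).
    by rewrite ler_wpM2r ?expR_ge0//; have := expR_ge1Dx T; lra.
  rewrite -!expRD ler_expR.
  have hz := coord_le_enorm z i; have e0 := enorm_ge0 z.
  have : `|z 0 i| <= enorm z ^+ 2 / 8 + 2.
    by have := sqr_ge0 (enorm z - 4); nra.
  by rewrite /T; lra.
apply: le_trans (ler_wpM2l (heat_kernel_ge0 1 z) h2) _.
rewrite /heat_kernel -/A -/B.
have -> : A / B * D * (B * expR (- (enorm z ^+ 2 / (4 * 2)))) =
   A * expR (- (enorm z ^+ 2 / (4 * 2))) * D by field; rewrite gt_eqF.
rewrite mulrA ler_wpM2r ?expR_ge0// -mulrA ler_wpM2l// -expRD ler_expR.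
by rewrite le_eqVlt; apply/orP; left; apply/eqP; field.
Qed.

(** Smoothing at rate t^{-1/2}, in the form of increments: after rescaling, the shift by k becomes a
    shift by k / sqrt(t) of the unit Gaussian. *)
Lemma heat_convolution_lip : exists2 C : R, 0 <= C & forall t f K i k x, 0 < t ->
  measurable_fun setT f -> (forall z, `|f z| <= K) ->
  `|heat_convolution t f (x + k *: unit_vec i) - heat_convolution t f x| <=
  C * (`|k| / Num.sqrt t) * K.
Proof.
have [C0 C00 CP] := heat_kernel1_shift.
exists (C0 + 2); first by rewrite addr_ge0.
move=> t f K i k x t0 mf fK.
have K0 : 0 <= K by exact: le_trans (normr_ge0 _) (fK 0).
have s0 : 0 < Num.sqrt t by rewrite sqrtr_gt0.
pose q := k / Num.sqrt t.
have -> : `|k| / Num.sqrt t = `|q| by rewrite /q normrM normfV (gtr0_norm s0).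
(* For |q| > 1 the increment is at most 2 K, hence at most 2 |q| K; this is the 2 in the constant C0
   + 2. *)
have [q1|q1] := leP `|q| 1; last first.
  apply: le_trans (_ : K + K <= _).
    rewrite (le_trans (ler_normB _ _))// lerD//; exact: heat_convolution_bound.
  rewrite (_ : K + K = 2 * 1 * K); last by ring.
  apply: ler_wpM2r => //; apply: ler_pM => //; [by rewrite lerDr|exact: ltW].
pose g z := f (x + Num.sqrt t *: z).
have mg : measurable_fun setT g by exact: measurable_comp_affine.
have gK z : `|g z| <= K by exact: fK.
pose F z := heat_kernel 1 (z + (- q) *: unit_vec i) * g z.
have mk : measurable_fun setT (fun z : 'rV[R]_n => heat_kernel 1 (z + (- q) *: unit_vec i)).
  have := measurable_comp_affine ((- q) *: unit_vec i) 1 (measurable_heat_kernel 1).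
  by under eq_fun do rewrite scale1r addrC.
have mF : measurable_fun setT F by exact: measurable_funM.
have iF : mu.-integrable setT (EFin \o F).
  apply: (le_integrable _ _ _ (integrableZl measurableT K
     (integrable_heat_kernel (q *: unit_vec i) (@ltr01 R)))) => //.
    exact/measurable_EFinP.
  move=> z _; rewrite lee_fin /F -heat_kernelN opprD scaleNr opprK addrC.
  rewrite [leRHS]ger0_norm; last by apply: mulr_ge0 => //; exact: heat_kernel_ge0.
  rewrite [leLHS]normrM (ger0_norm (heat_kernel_ge0 _ _)) mulrC.
  by apply: ler_wpM2r => //; exact: heat_kernel_ge0.
have ig : mu.-integrable setT (EFin \o (fun z => heat_kernel 1 z * g z)).
  by apply: integrable_tame; exact: (tame_bounded mg gK).
have E : heat_convolution t f (x + k *: unit_vec i) = \int[mu]_z F z.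
  rewrite heat_convolutionE// /gexp /Rintegral; congr fine.
  rewrite [RHS](@integral_affine_rV _ _ (q *: unit_vec i) 1)//.
  apply: eq_integral => z _; rewrite expr1n mul1r scale1r /F; congr (_ * _)%:E.
    by congr (heat_kernel 1 _); rewrite scaleNr addrAC subrr add0r.
  by rewrite /g scalerDr scalerA mulrC divfK ?gt_eqF// addrA.
rewrite E heat_convolutionE// /gexp -RintegralB//.
have iB : mu.-integrable setT (EFin \o (fun z => F z - heat_kernel 1 z * g z)).
  exact: (integrableB measurableT iF ig).
have iK : mu.-integrable setT (EFin \o (fun z : 'rV[R]_n => `|q| * C0 * K * heat_kernel 2 z)).
  have := integrableZl measurableT (`|q| * C0 * K)
    (integrable_heat_kernel (0 : 'rV[R]_n) (@ltr0n R 2)).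
  by apply: eq_integrable => // z _; rewrite /= sub0r heat_kernelN EFinM.
apply: (le_trans (le_normr_Rintegral _ iB)) => //.
apply: le_trans (_ : \int[mu]_z (`|q| * C0 * K * heat_kernel 2 z) <= _).
  apply: le_Rintegral => //; first exact: integrable_norm.
  move=> z _; rewrite /F -mulrBl normrM.
  rewrite (_ : _ * _ = `|q| * (C0 * heat_kernel 2 z) * K); last by ring.
  rewrite ler_pM//; have := CP i z (- q).
  by rewrite normrN => /(_ q1).
rewrite RintegralZl//; last first.
  have := integrable_heat_kernel (0 : 'rV[R]_n) (@ltr0n R 2).
  by apply: eq_integrable => // z _; rewrite /= sub0r heat_kernelN.
have h2 : (\int[mu]_z (heat_kernel 2 z)%:E = 1)%E.
  apply: etrans (integral_heat_kernel (0 : 'rV[R]_n) (@ltr0n R 2)).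
  by apply: eq_integral => z _; rewrite subr0.
rewrite [X in _ * X](_ : _ = 1); last by rewrite /Rintegral h2.
rewrite mulr1 -mulrA mulrCA mulrA ler_wpM2r// ler_wpM2r//.
by rewrite lerDl.
Qed.

End heat_operator.

(** * Duhamel integrals of bounded sources *)

Section duhamel_operator.
Context {R : realType} {n : nat}.
Implicit Types (F : R -> 'rV[R]_n -> R) (s t K : R).
Local Notation mu := (@lebesgue_rV R n).
Local Notation leb := (@lebesgue_measure R).

Definition joint_bounded F K : Prop :=
  measurable_fun setT (fun z : measurableTypeR R * 'rV[R]_n => F z.1 z.2) /\
  forall s y, `|F s y| <= K.

(** This is P_{b-s} F(s) for s < b. Written through [gexp], it also makes sense for s >= b, where
    the square root vanishes and its value is F(s, y); it is thus bounded and jointly measurable for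
    all s. *)
Definition propag (b : R) F (s : R) (y : 'rV[R]_n) : R :=
  gexp (fun z => F s (y + Num.sqrt (b - s) *: z)).

Lemma joint_bounded_ge0 F K : joint_bounded F K -> 0 <= K.
Proof. by move=> [_ h]; exact: le_trans (normr_ge0 _) (h 0 0). Qed.

Lemma joint_bounded_slice F K s : joint_bounded F K -> measurable_fun setT (F s).
Proof.
move=> [mF _].
exact: (measurableT_comp mF (@pair1_measurable _ _ (measurableTypeR R) _ s)).
Qed.

Lemma measurable_joint_comp d (T : measurableType d) F (a : T -> R) (b : T -> 'rV[R]_n) :
  measurable_fun setT (fun z : measurableTypeR R * 'rV[R]_n => F z.1 z.2) ->
  measurable_fun setT a -> measurable_fun setT b ->
  measurable_fun setT (fun w => F (a w) (b w)).
Proof.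
by move=> mF ma mb; exact: (measurableT_comp mF (measurable_fun_pair ma mb)).
Qed.

Lemma joint_boundedD F G K L : joint_bounded F K -> joint_bounded G L ->
  joint_bounded (fun s y => F s y + G s y) (K + L).
Proof.
move=> [mF hF] [mG hG]; split; first exact: measurable_funD.
by move=> s y; rewrite (le_trans (ler_normD _ _))// lerD.
Qed.

Lemma joint_bounded_cst (K : R) : joint_bounded (fun _ _ => K) `|K|.
Proof. by split. Qed.

Lemma joint_bounded_norm F K : joint_bounded F K -> joint_bounded (fun s y => `|F s y|) K.
Proof. by move=> [mF hF]; split; [exact: measurableT_comp|move=> s y; rewrite normr_id]. Qed.

Lemma joint_bounded_shift F K (h : 'rV[R]_n) : joint_bounded F K ->
  joint_bounded (fun s y => F s (y + h)) K.
Proof.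
move=> [mF hF]; split=> //.
apply: (measurable_joint_comp mF); first exact: measurable_fst.
apply: measurable_fun_rV => i; under eq_fun do rewrite mxE.
apply: measurable_funD => //.
exact: (measurableT_comp (measurable_coord i) measurable_snd).
Qed.

Lemma propag_tame F K b s y : joint_bounded F K ->
  tame (fun z => F s (y + Num.sqrt (b - s) *: z)).
Proof.
move=> jF; apply: (@tame_comp_affine _ _ (F s) y (Num.sqrt (b - s)) K).
  exact: joint_bounded_slice jF.
by case: jF.
Qed.

Lemma propag_bound F K b s y : joint_bounded F K -> `|propag b F s y| <= K.
Proof.
move=> jF; apply: gexp_bounded; last by case: jF => _ h z; exact: h.
by case: (propag_tame b s y jF).
Qed.

Lemma propagD F G K L b s y : joint_bounded F K -> joint_bounded G L ->
  propag b (fun s y => F s y + G s y) s y = propag b F s y + propag b G s y.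
Proof. by move=> jF jG; apply: gexpD; [exact: propag_tame jF|exact: propag_tame jG]. Qed.

Lemma propagN F K b s y : joint_bounded F K ->
  propag b (fun s y => - F s y) s y = - propag b F s y.
Proof. by move=> jF; apply: gexpN; exact: propag_tame jF. Qed.

Lemma ler_norm_propag F K b s y : joint_bounded F K ->
  `|propag b F s y| <= propag b (fun s y => `|F s y|) s y.
Proof. by move=> jF; apply: ler_norm_gexp; exact: propag_tame jF. Qed.

Lemma ler_propag F G K L b s y : joint_bounded F K -> joint_bounded G L ->
  (forall z, F s z <= G s z) -> propag b F s y <= propag b G s y.
Proof.
move=> jF jG FG; apply: ler_gexp; [exact: propag_tame jF|exact: propag_tame jG|].
by move=> z; exact: FG.
Qed.

Lemma propag_shift F b s y h :
  propag b F s (y + h) = propag b (fun s y => F s (y + h)) s y.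
Proof. by apply: eq_gexp => z; rewrite addrAC. Qed.

Lemma propagE F K b s : joint_bounded F K -> s < b ->
  propag b F s = heat_convolution (b - s) (F s).
Proof.
move=> jF sb; apply/funext => y; rewrite heat_convolutionE ?subr_gt0//.
exact: joint_bounded_slice jF.
Qed.

Lemma measurable_sqrt : measurable_fun setT (@Num.sqrt R).
Proof. by apply: continuous_measurable_fun; exact: sqrt_continuous. Qed.

Lemma joint_bounded_gexp F K (tau : R -> R) : measurable_fun setT tau ->
  joint_bounded F K ->
  joint_bounded (fun s y => gexp (fun z => F s (y + Num.sqrt (tau s) *: z))) K.
Proof.
move=> mtau jF.
have tF s y (G : R -> 'rV[R]_n -> R) L : joint_bounded G L ->
    tame (fun z => G s (y + Num.sqrt (tau s) *: z)).
  move=> jG; apply: (@tame_comp_affine _ _ (G s) y (Num.sqrt (tau s)) L).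
    exact: joint_bounded_slice jG.
  by case: jG.
split; last first.
  move=> s y; apply: gexp_bounded; first by case: (tF s y F K jF).
  by case: jF => _ h z; exact: h.
have K0 := joint_bounded_ge0 jF.
have jK := joint_bounded_cst K.
have jFK := joint_boundedD jF jK.
have FK0 s y : 0 <= F s y + K.
  by case: jF => _ /(_ s y); rewrite ler_norml => /andP[h _]; rewrite -lerBlDr sub0r.
pose G (w : (measurableTypeR R * 'rV[R]_n) * 'rV[R]_n) : R :=
  heat_kernel 1 w.2 * (F w.1.1 (w.1.2 + Num.sqrt (tau w.1.1) *: w.2) + K).
have mG : measurable_fun setT G.
  apply: measurable_funM.
    exact: (measurableT_comp (measurable_heat_kernel 1) measurable_snd).
  apply: measurable_funD => //; case: (jF) => mF _.
  have m11 : measurable_fun setT (fun w : (measurableTypeR R * 'rV[R]_n) * 'rV[R]_n => w.1.1).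
    exact: (measurableT_comp measurable_fst measurable_fst).
  apply: (measurable_joint_comp mF) => //.
  apply: measurable_fun_rV => i; under eq_fun do rewrite !mxE.
  apply: measurable_funD.
    apply: (measurableT_comp (measurable_coord i)).
    exact: (measurableT_comp measurable_snd measurable_fst).
  apply: measurable_funM.
    apply: (measurableT_comp measurable_sqrt).
    exact: (measurableT_comp mtau m11).
  exact: (measurableT_comp (measurable_coord i) measurable_snd).
have G0 w : 0 <= G w by apply: mulr_ge0 => //; exact: heat_kernel_ge0.
have E : (fun z : measurableTypeR R * 'rV[R]_n =>
     gexp (fun y => F z.1 (z.2 + Num.sqrt (tau z.1) *: y))) =
    (fun z => fine (\int[mu]_y (EFin \o G) (z, y))%E - K).
  apply/funext => z.
  rewrite -[X in X - K]/(gexp (fun y => F z.1 (z.2 + Num.sqrt (tau z.1) *: y) + K)).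
  rewrite gexpD ?gexp_cst ?addrK//; first exact: tF jF.
  exact: tame_cst.
rewrite E; apply: measurable_funB => //.
apply: measurableT_comp; first exact: fine_measurable.
apply: (measurable_fun_fubini_tonelli_F (m2 := mu) (EFin \o G)).
  exact/measurable_EFinP.
by move=> w; rewrite lee_fin.
Qed.

Lemma joint_bounded_propag F K b : joint_bounded F K -> joint_bounded (propag b F) K.
Proof. by move=> jF; apply: joint_bounded_gexp => //; exact: measurable_funB. Qed.

Lemma joint_bounded_heat F K t : 0 < t -> joint_bounded F K ->
  joint_bounded (fun s => heat_convolution t (F s)) K.
Proof.
move=> t0 jF.
have -> : (fun s => heat_convolution t (F s)) =
    (fun s y => gexp (fun z => F s (y + Num.sqrt t *: z))).
  apply/funext => s; apply/funext => y; rewrite heat_convolutionE//.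
  exact: joint_bounded_slice jF.
exact: (@joint_bounded_gexp F K (fun=> t)).
Qed.

Lemma lebesgue_itvco (a b : R) : (leb `[a, b[ = if (a < b)%R then (b - a)%:E else 0)%E.
Proof. by have := @lebesgue_measure_itv R `[a, b[; rewrite /= lte_fin -EFinB. Qed.

Lemma integrable_joint F K (a b : R) y : joint_bounded F K ->
  leb.-integrable `[a, b[ (EFin \o (fun s => F s y)).
Proof.
move=> [mF hF]; apply: measurable_bounded_integrable => //.
- suff : (leb `[a, b[ < +oo)%E by [].
  by rewrite lebesgue_itvco; case: ifPn => _; rewrite ltry.
- apply: measurable_funTS.
  exact: (measurableT_comp mF (@pair2_measurable _ _ (measurableTypeR R) _ y)).
- exists K; split; first exact: num_real.
  by move=> x xK z _ /=; rewrite (le_trans (hF _ _))// ltW.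
Qed.

Lemma Rintegral_itv_cst (a b c : R) : a <= b -> \int[leb]_(s in `[a, b[) c = c * (b - a).
Proof.
move=> ab; rewrite Rintegral_cst// -[fine _]/(fine (leb `[a, b[)) lebesgue_itvco.
by have [//|ba] := ltP a b; rewrite (@le_anti _ _ a b) ?ab ?ba ?subrr.
Qed.

Lemma Rintegral_joint_bound F K (a b : R) y : a <= b -> joint_bounded F K ->
  `|\int[leb]_(s in `[a, b[) F s y| <= K * (b - a).
Proof.
move=> ab jF; have K0 := joint_bounded_ge0 jF.
apply: (le_trans (le_normr_Rintegral _ (integrable_joint a b y jF))) => //.
rewrite -Rintegral_itv_cst//; apply: le_Rintegral => //.
- exact: (integrable_joint a b y (joint_bounded_norm jF)).
- have := integrable_joint a b y (joint_bounded_cst K).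
  by apply.
- by move=> s _; case: jF.
Qed.

Lemma measurable_Rintegral_joint F K (a b : R) : joint_bounded F K ->
  measurable_fun setT (fun y => \int[leb]_(s in `[a, b[) F s y).
Proof.
move=> jF; have K0 := joint_bounded_ge0 jF.
have FK0 s y : 0 <= F s y + K.
  by case: jF => _ /(_ s y); rewrite ler_norml => /andP[h _]; rewrite -lerBlDr sub0r.
have jFK := joint_boundedD jF (joint_bounded_cst K).
pose G (w : measurableTypeR R * 'rV[R]_n) : \bar R :=
  ((F w.1 w.2 + K) * \1_(`[a, b[ : set R) w.1)%:E.
have E : (fun y => \int[leb]_(s in `[a, b[) F s y) =
   fun y => fine (\int[leb]_s G (s, y))%E - \int[leb]_(s in `[a, b[) K.
  apply/funext => y.
  have -> : fine (\int[leb]_s G (s, y))%E = \int[leb]_(s in `[a, b[) (F s y + K).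
    rewrite Rintegral_mkcond /Rintegral; congr fine; apply: eq_integral => s _.
    by rewrite /G patchE indicE; case: ifPn => _; rewrite ?mulr1 ?mulr0.
  rewrite RintegralD// ?addrK//; first exact: integrable_joint jF.
  exact: (integrable_joint a b y (joint_bounded_cst K)).
rewrite E; apply: measurable_funB => //.
apply: measurableT_comp; first exact: fine_measurable.
apply: (measurable_fun_fubini_tonelli_G (m1 := leb) G).
  apply/measurable_EFinP; apply: measurable_funM; first by case: jFK.
  apply: (measurableT_comp _ measurable_fst).
  exact: measurable_indic.
by move=> w; rewrite lee_fin mulr_ge0.
Qed.

Lemma heat_convolution_Rintegral_ge0 F K (a b t : R) x : a <= b -> 0 < t -> joint_bounded F K ->
  (forall s y, 0 <= F s y) ->
  heat_convolution t (fun y => \int[leb]_(s in `[a, b[) F s y) x =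
  \int[leb]_(s in `[a, b[) heat_convolution t (F s) x.
Proof.
move=> ab t0 jF F0.
have mI := measurable_Rintegral_joint a b jF.
have I0 y : 0 <= \int[leb]_(s in `[a, b[) F s y by apply: Rintegral_ge0.
have IK y : `|\int[leb]_(s in `[a, b[) F s y| <= K * (b - a).
  exact: Rintegral_joint_bound.
apply: EFin_inj.
pose G (w : measurableTypeR R * 'rV[R]_n) : \bar R :=
  ((heat_kernel t (x - w.2) * F w.1 w.2) * \1_(`[a, b[ : set R) w.1)%:E.
have mG : measurable_fun setT G.
  apply/measurable_EFinP; apply: measurable_funM.
    apply: measurable_funM; last by case: jF.
    exact: (measurableT_comp (measurable_heat_kernel_l t x) measurable_snd).
  by apply: (measurableT_comp _ measurable_fst); exact: measurable_indic.
have G0 w : (0 <= G w)%E.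
  by rewrite lee_fin mulr_ge0// mulr_ge0// heat_kernel_ge0.
have E2 : (\int[mu]_y \int[leb]_s G (s, y) =
   (heat_convolution t (fun y => \int[leb]_(s in `[a, b[) F s y) x)%:E)%E.
  rewrite (heat_convolution_EFin _ t0 mI I0 IK) /heatE.
  apply: eq_integral => y _.
  have -> : (\int[leb]_s G (s, y) =
      \int[leb]_(s in `[a, b[) ((heat_kernel t (x - y)%R)%:E * (F s y)%:E))%E.
    rewrite [RHS]integral_mkcond; apply: eq_integral => s _.
    by rewrite /G patchE indicE; case: ifPn => _; rewrite ?mulr1 ?mulr0 ?EFinM.
  have iF := integrable_joint a b y jF.
  rewrite integralZl//=; congr (_ * _)%E.
  by rewrite /Rintegral fineK//; exact: integrable_fin_num.
have E3 : (\int[leb]_s \int[mu]_y G (s, y) =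
   (heat_convolution t (fun y => \int[leb]_(s in `[a, b[) F s y) x)%:E)%E.
  by rewrite -E2; exact: (fubini_tonelli G mG G0).
rewrite -E3.
rewrite /Rintegral.
have -> : (\int[leb]_(s in `[a, b[) (heat_convolution t (F s) x)%:E =
    \int[leb]_s \int[mu]_y G (s, y))%E.
  rewrite integral_mkcond; apply: eq_integral => s _; rewrite patchE.
  case: ifPn => sab; last first.
    by rewrite integral0_eq// => y _; rewrite /G indicE (negbTE sab) mulr0.
  rewrite (@heat_convolution_EFin _ _ t (F s) K)//; last 2 first.
  - exact: joint_bounded_slice jF.
  - by case: jF.
  by apply: eq_integral => y _; rewrite /G indicE sab mulr1 EFinM.
by rewrite fineK// E3.
Qed.

Lemma heat_convolution_Rintegral F K (a b t : R) x : a <= b -> 0 < t -> joint_bounded F K ->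
  heat_convolution t (fun y => \int[leb]_(s in `[a, b[) F s y) x =
  \int[leb]_(s in `[a, b[) heat_convolution t (F s) x.
Proof.
move=> ab t0 jF; have K0 := joint_bounded_ge0 jF.
have jK := joint_bounded_cst K.
have jFK := joint_boundedD jF jK.
have FK0 s y : 0 <= F s y + K.
  by case: jF => _ /(_ s y); rewrite ler_norml => /andP[h _]; rewrite -lerBlDr sub0r.
have E1 y : \int[leb]_(s in `[a, b[) (F s y + K) =
    \int[leb]_(s in `[a, b[) F s y + K * (b - a).
  rewrite RintegralD//; last 2 first.
  - exact: integrable_joint jF.
  - exact: (integrable_joint a b y jK).
  by rewrite Rintegral_itv_cst.
have := @heat_convolution_Rintegral_ge0 _ _ a b t x ab t0 jFK FK0.
rewrite (_ : (fun y => _) = fun y => \int[leb]_(s in `[a, b[) F s y + K * (b - a)); last first.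
  by apply/funext => y; exact: E1.
have mI := measurable_Rintegral_joint a b jF.
have IK y : `|\int[leb]_(s in `[a, b[) F s y| <= K * (b - a).
  exact: Rintegral_joint_bound.
have KK (z : 'rV[R]_n) : `|K * (b - a)| <= `|K * (b - a)| by [].
rewrite (heat_convolutionD x t0 mI IK (measurable_cst _) KK) heat_convolution_cst//.
under [in X in _ = X -> _]eq_Rintegral => s _.
  rewrite (@heat_convolutionD _ _ t (F s) (fun=> K) K `|K|)//; last 2 first.
  - exact: joint_bounded_slice jF.
  - by case: jF.
  rewrite heat_convolution_cst//; over.
rewrite RintegralD//; last 2 first.
- exact: (integrable_joint a b x (joint_bounded_heat t0 jF)).
- exact: (integrable_joint a b x jK).
by rewrite Rintegral_itv_cst// => /addIr.
Qed.

End duhamel_operator.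

(** * Mild solutions: restart, smoothing and Gronwall *)

Section mild_solutions.
Context {R : realType} {n : nat}.
Implicit Types (v F : R -> 'rV[R]_n -> R) (s t K : R).
Local Notation mu := (@lebesgue_rV R n).
Local Notation leb := (@lebesgue_measure R).

Lemma heat_propag F K b t s x : joint_bounded F K -> 0 < t -> s < b ->
  heat_convolution t (propag b F s) x = propag (b + t) F s x.
Proof.
move=> jF t0 sb; rewrite (propagE jF sb) (@heat_semigroup _ _ _ _ _ K) ?subr_gt0//; last 2 first.
- exact: joint_bounded_slice jF.
- by case: jF.
rewrite (propagE jF); last by rewrite ltr_wpDr// ltW.
by have -> : t + (b - s) = b + t - s by ring.
Qed.

Definition mild v F (t1 t2 : R) : Prop :=
  forall a b x, t1 <= a -> a < b -> b <= t2 ->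
  v b x = heat_convolution (b - a) (v a) x + \int[leb]_(s in `[a, b[) propag b F s x.

Lemma heat_convolution_Rpropag F K a b t x : a <= b -> 0 < t -> joint_bounded F K ->
  heat_convolution t (fun y => \int[leb]_(s in `[a, b[) propag b F s y) x =
  \int[leb]_(s in `[a, b[) propag (b + t) F s x.
Proof.
move=> ab t0 jF.
rewrite (heat_convolution_Rintegral x ab t0 (joint_bounded_propag b jF)).
apply: eq_Rintegral => s; rewrite inE/= in_itv/= => /andP[_ sb].
exact: heat_propag jF t0 sb.
Qed.

Lemma Rintegral_itvco_split F K (a b c : R) y : a <= b -> b <= c -> joint_bounded F K ->
  \int[leb]_(s in `[a, c[) F s y =
  \int[leb]_(s in `[a, b[) F s y + \int[leb]_(s in `[b, c[) F s y.
Proof.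
move=> ab bc jF.
have E : `[a, c[%classic = `[a, b[%classic `|` `[b, c[%classic :> set R.
  apply/seteqP; split => s /=; rewrite in_itv/=.
    move=> /andP[as' sc]; have [sb|sb] := ltP s b; [left|right];
      by rewrite in_itv/= ?as' ?sb ?sc.
  by rewrite !in_itv/= => -[/andP[h1 h2]|/andP[h1 h2]];
    [rewrite h1 (lt_le_trans h2)|rewrite h2 (le_trans ab h1)].
rewrite E Rintegral_setU//.
  by rewrite -E; exact: integrable_joint jF.
apply/disj_setPS => s [/=]; rewrite !in_itv/= => /andP[_ sb] /andP[bs _].
by move: (lt_le_trans sb bs); rewrite ltxx.
Qed.

(** The semigroup law applied to the two terms of v(a) turns the formula started at 0 into the one
    started at a. Positive starting times are required because v(0) need not be v0. *)
Lemma mild_restart v (v0 : 'rV[R]_n -> R) F K K0 (m T : R) : joint_bounded F K ->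
  measurable_fun setT v0 -> (forall z, `|v0 z| <= K0) ->
  (forall b x, 0 < b -> b <= T ->
    v b x = heat_convolution b v0 x + \int[leb]_(s in `[0, b[) propag b F s x) ->
  0 < m -> mild v F m T.
Proof.
move=> jF mv v0K vE m0 a b x ma ab bT.
have a0 : 0 < a by exact: lt_le_trans ma.
have ba : 0 < b - a by rewrite subr_gt0.
have b0 : 0 < b by exact: lt_trans ab.
have va : v a = fun y => heat_convolution a v0 y + \int[leb]_(s in `[0, a[) propag a F s y.
  by apply/funext => y; rewrite vE// (le_trans (ltW ab)).
have jP := joint_bounded_propag a jF.
rewrite va (@heat_convolutionD _ _ _ _ _ K0 (K * (a - 0)))//; last 4 first.
- exact: measurable_heat_convolution v0K.
- by move=> z; exact: heat_convolution_bound.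
- exact: measurable_Rintegral_joint jP.
- by move=> z; apply: Rintegral_joint_bound => //; exact: ltW.
rewrite (@heat_semigroup _ _ _ _ _ K0)// subrK vE// -addrA; congr (_ + _).
rewrite (heat_convolution_Rpropag x (ltW a0) ba jF).
have -> : a + (b - a) = b by ring.
by rewrite (Rintegral_itvco_split x (ltW a0) (ltW ab) (joint_bounded_propag b jF)).
Qed.

Lemma mild_bound v F t1 t2 a b K V x : mild v F t1 t2 -> joint_bounded F K ->
  t1 <= a -> a < b -> b <= t2 ->
  measurable_fun setT (v a) -> (forall y, `|v a y| <= V) ->
  `|v b x| <= heat_convolution (b - a) (fun y => `|v a y|) x +
    \int[leb]_(s in `[a, b[) propag b (fun s y => `|F s y|) s x.
Proof.
move=> mv jF t1a ab bt2 ma va; rewrite (mv a b)//.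
rewrite (le_trans (ler_normD _ _))// lerD//.
  by apply: ler_norm_heat_convolution va; rewrite ?subr_gt0.
have jP := joint_bounded_propag b jF.
apply: (le_trans (le_normr_Rintegral _ (integrable_joint a b x jP))) => //.
apply: le_Rintegral => //.
- exact: (integrable_joint a b x (joint_bounded_norm jP)).
- exact: (integrable_joint a b x (joint_bounded_propag b (joint_bounded_norm jF))).
by move=> s _; exact: ler_norm_propag jF.
Qed.

Lemma mild_sup_bound v F t1 t2 a b K V x : mild v F t1 t2 -> joint_bounded F K ->
  t1 <= a -> a < b -> b <= t2 ->
  measurable_fun setT (v a) -> (forall y, `|v a y| <= V) ->
  `|v b x| <= heat_convolution (b - a) (fun y => `|v a y|) x + K * (b - a).
Proof.
move=> mv jF t1a ab bt2 ma va; apply: (le_trans (mild_bound x mv jF t1a ab bt2 ma va)).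
rewrite lerD2l; apply: (le_trans (ler_norm _)).
apply: Rintegral_joint_bound; first exact: ltW.
exact: joint_bounded_propag (joint_bounded_norm jF).
Qed.

(** By linearity, increments of a mild solution are mild for the increments of the source.
    Derivative bounds follow without differentiating the formula. *)
Lemma mild_shiftB v F t1 t2 K h (V : R -> R) : mild v F t1 t2 -> joint_bounded F K ->
  (forall s, t1 <= s -> s <= t2 -> measurable_fun setT (v s)) ->
  (forall s y, t1 <= s -> s <= t2 -> `|v s y| <= V s) ->
  mild (fun t x => v t (x + h) - v t x) (fun s y => F s (y + h) - F s y) t1 t2.
Proof.
move=> mv jF mvs vV a b x t1a ab bt2; have ba : 0 < b - a by rewrite subr_gt0.
have at2 : a <= t2 by rewrite (le_trans (ltW ab)).
have mva := mvs a t1a at2.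
have vVa y := vV a y t1a at2.
have mvh : measurable_fun setT (fun z : 'rV[R]_n => v a (z + h)).
  have := measurable_comp_affine h 1 mva.
  by under eq_fun do rewrite scale1r addrC.
rewrite (mv a b)// (mv a b x)// heat_convolution_shift//.
rewrite (@heat_convolutionB _ _ (b - a) (fun z => v a (z + h)) (v a) (V a) (V a))//.
rewrite opprD addrACA; congr (_ + _).
have jFh := joint_bounded_shift h jF.
have jN : joint_bounded (fun s y => - F s y) K.
  by case: jF => m h'; split=> [|s y]; [exact: measurable_funN|rewrite normrN].
under [in RHS]eq_Rintegral do rewrite (propagD b _ x jFh jN) (propagN b _ x jF) -propag_shift.
rewrite RintegralB//.
- exact: (integrable_joint a b (x + h) (joint_bounded_propag b jF)).
- exact: (integrable_joint a b x (joint_bounded_propag b jF)).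
Qed.

(** The primitive of (b - s)^{-1/2} is -2 sqrt(b - s). The bound by K serves only to cut off the
    singularity at b. *)
Lemma Rintegral_inv_sqrt_bound (f : R -> R) (a b K M : R) : a < b -> 0 <= M ->
  measurable_fun setT f -> (forall s, `|f s| <= K) ->
  (forall s, a <= s -> s < b -> `|f s| <= M / Num.sqrt (b - s)) ->
  `|\int[leb]_(s in `[a, b[) f s| <= 2 * M * Num.sqrt (b - a).
Proof.
move=> ab M0 mf fK fM.
have K0 : 0 <= K by exact: le_trans (normr_ge0 _) (fK 0).
pose F (s : R) (y : 'rV[R]_n) := f s.
have jF : joint_bounded F K.
  split; last by move=> s y; exact: fK.
  exact: (measurableT_comp mf (@measurable_fst _ _ (measurableTypeR R) 'rV[R]_n)).
apply/ler_addgt0Pr => e e0.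
(* The piece [b - d, b) contributes at most K d <= e; on the rest the majorant is continuous and the
   fundamental theorem of calculus applies. *)
pose d := Num.min (b - a) (e / (K + 1)).
have K1 : 0 < K + 1 by rewrite ltr_wpDl.
have d0 : 0 < d by rewrite lt_min subr_gt0 ab divr_gt0.
have dba : d <= b - a by rewrite ge_min lexx.
have adb : a <= b - d by rewrite lerBrDr -lerBrDl.
have dbb : b - d < b by rewrite ltrBlDr ltrDl.
have Kd : K * d <= e.
  apply: le_trans (_ : (K + 1) * d <= _); first by rewrite ler_wpM2r ?(ltW d0)// lerDl.
  by rewrite mulrC -ler_pdivlMr// ge_min lexx orbT.
rewrite (Rintegral_itvco_split (0 : 'rV[R]_n) adb (ltW dbb) jF).
apply: (le_trans (ler_normD _ _)); apply: lerD; last first.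
  apply: le_trans Kd; have := Rintegral_joint_bound (0 : 'rV[R]_n) (ltW dbb) jF.
  by rewrite opprD opprK addrA subrr add0r.
have [->|adb'] := eqVneq a (b - d).
  rewrite set_itv_ge ?bnd_simp ?ltxx// Rintegral_set0 normr0.
  by rewrite mulr_ge0 ?mulr_ge0// sqrtr_ge0.
have adlt : a < b - d by rewrite lt_neqAle adb' adb.
apply: (le_trans (le_normr_Rintegral _ (integrable_joint a (b - d) (0 : 'rV[R]_n) jF))) => //.
pose g s := M / Num.sqrt (b - s).
pose G s := - (2 * M * Num.sqrt (b - s)).
have bs0 s : s <= b - d -> 0 < b - s by move=> sbd; rewrite subr_gt0 (le_lt_trans sbd).
have dG s : s < b -> is_derive s 1 G (g s).
  move=> sb; have sb0 : 0 < b - s by rewrite subr_gt0.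
  have h1 : is_derive s 1 (fun s => b - s) (-1).
    have := @is_deriveB R R R (cst b) id s 1 0 1 (is_derive_cst _ _ _) (is_derive_id _ _).
    by rewrite sub0r.
  have h2 := @is_derive1_comp _ Num.sqrt (fun s => b - s) s _ _ (is_derive1_sqrt sb0) h1.
  have -> : G = (- (2 * M)) \*: (Num.sqrt \o (fun s => b - s)).
    by apply/funext => z; rewrite /G -mulNr.
  apply: is_derive_eq; rewrite /g /GRing.scale/=; field.
  by rewrite gt_eqF// sqrtr_gt0.
have cg : {within `[a, b - d], continuous g}.
  apply: continuous_in_subspaceT => s; rewrite inE/= in_itv/= => /andP[_ sbd].
  apply: (@continuousM R R (cst M) (fun s => (Num.sqrt (b - s))^-1)).
    exact: cst_continuous.
  apply: (@continuousV R R (fun s => Num.sqrt (b - s))).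
    by rewrite gt_eqF// sqrtr_gt0 bs0.
  apply: (@continuous_comp R R R (fun s => b - s) Num.sqrt); last exact: sqrt_continuous.
  by apply: (@continuousB R R R (cst b) id); [exact: cst_continuous|exact: cvg_id].
have FTC : (\int[leb]_(s in `[a, (b - d)%R]) (g s)%:E = (G (b - d)%R)%:E - (G a)%:E)%E.
  apply: continuous_FTC2 => //.
  - split.
    + by move=> s; rewrite in_itv/= => /andP[_ sbd]; case: (dG s (lt_trans sbd dbb)).
    + by apply: cvg_at_right_filter; apply: differentiable_continuous; apply/derivable1_diffP; case: (dG a ab).
    + by apply: cvg_at_left_filter; apply: differentiable_continuous; apply/derivable1_diffP; case: (dG (b - d) dbb).
  - by move=> s; rewrite in_itv/= => /andP[_ sbd]; rewrite derive1E; have [_ ->] := dG s (lt_trans sbd dbb).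
have ig : leb.-integrable `[a, b - d] (EFin \o g).
  exact: (continuous_compact_integrable (@segment_compact _ _ _) cg).
have igo : leb.-integrable `[a, b - d[ (EFin \o g).
  by apply: integrableS ig => // s /=; rewrite !in_itv/= => /andP[-> /ltW].
apply: le_trans (_ : \int[leb]_(s in `[a, b - d[) g s <= _).
  apply: le_Rintegral => //.
  - exact: (integrable_joint a (b - d) (0 : 'rV[R]_n) (joint_bounded_norm jF)).
  - by move=> s /=; rewrite in_itv/= => /andP[as' sbd]; apply: fM => //; exact: lt_trans dbb.
rewrite Rintegral_itv_bndo_bndc// /Rintegral FTC -EFinB/= /G opprK.
by rewrite addrC lerBlDr lerDl mulr_ge0 ?mulr_ge0// sqrtr_ge0.
Qed.

(** The rate t^{-1/2} of [heat_convolution_lip] is applied to the initial term and, under the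
    integral, to the source, where it is integrable up to s = b. *)
Lemma mild_lip : exists2 C : R, 0 <= C & forall v F K V t1 t2 a b i k x,
  mild v F t1 t2 -> joint_bounded F K -> t1 <= a -> a < b -> b <= t2 ->
  measurable_fun setT (v a) -> (forall y, `|v a y| <= V) ->
  `|v b (x + k *: unit_vec i) - v b x| <=
  C * `|k| * (V / Num.sqrt (b - a) + K * Num.sqrt (b - a)).
Proof.
have [C C0 CP] := @heat_convolution_lip R n.
exists (2 * C); first by rewrite mulr_ge0.
move=> v F K V t1 t2 a b i k x mv jF t1a ab bt2 ma va.
have K0 := joint_bounded_ge0 jF.
have V0 : 0 <= V by exact: le_trans (normr_ge0 _) (va 0).
have ba : 0 < b - a by rewrite subr_gt0.
have s0 : 0 < Num.sqrt (b - a) by rewrite sqrtr_gt0.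
have jP := joint_bounded_propag b jF.
rewrite (mv a b)// (mv a b x)// opprD addrACA (le_trans (ler_normD _ _))// mulrDr lerD//.
  apply: (le_trans (CP _ _ _ i k x ba ma va)).
  rewrite (_ : 2 * C * `|k| * _ = 2 * (C * (`|k| / Num.sqrt (b - a)) * V)); last by ring.
  rewrite mulr_natl mulr2n lerDl.
  by repeat first [exact: C0 | exact: V0 | exact: normr_ge0 | exact: sqrtr_ge0
    | apply: mulr_ge0 | rewrite invr_ge0].
rewrite -RintegralB//; last 2 first.
- exact: (integrable_joint a b (x + k *: unit_vec i) jP).
- exact: (integrable_joint a b x jP).
have mP y : measurable_fun setT (fun s => propag b F s y).
  case: jP => mP _.
  exact: (measurableT_comp mP (@pair2_measurable _ _ (measurableTypeR R) _ y)).
rewrite (_ : _ * (K * _) = 2 * (C * `|k| * K) * Num.sqrt (b - a)); last by ring.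
apply: (@Rintegral_inv_sqrt_bound (fun s => propag b F s (x + k *: unit_vec i) - propag b F s x) a b (K + K)) => //.
- by rewrite !mulr_ge0.
- exact: measurable_funB.
- by move=> s; rewrite (le_trans (ler_normB _ _))// lerD//; exact: propag_bound.
- move=> s as' sb; rewrite (propagE jF sb).
  have bs : 0 < b - s by rewrite subr_gt0.
  have mFs := joint_bounded_slice s jF.
  have FsK z : `|F s z| <= K by case: jF.
  apply: (le_trans (CP _ _ _ i k x bs mFs FsK)).
  by rewrite le_eqVlt; apply/orP; left; apply/eqP; ring.
Qed.

(* Short-time Gronwall: iterating the Duhamel inequality for s |-> P_(b-s)|v s| halves the error. *)
Lemma mild_gronwall v F K V a b x (L : R) : mild v F a b -> joint_bounded F K ->
  joint_bounded v V -> a < b -> 0 <= L -> L * (b - a) <= 2^-1 ->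
  (forall s y, a <= s -> s <= b -> `|F s y| <= L * `|v s y|) ->
  `|v b x| <= 2 * heat_convolution (b - a) (fun y => `|v a y|) x.
Proof.
move=> mv jF jv ab L0 Lab FL.
have V0 := joint_bounded_ge0 jv.
have jv' := joint_bounded_norm jv; have jF' := joint_bounded_norm jF.
have mva := joint_bounded_slice a jv.
have vaV y : `|v a y| <= V by case: jv.
pose g := heat_convolution (b - a) (fun y => `|v a y|) x.
have g0 : 0 <= g by apply: heat_convolution_ge0.
have phi_b : propag b (fun s y => `|v s y|) b x = `|v b x|.
  rewrite /propag subrr sqrtr0 -[RHS](@gexp_cst R n).
  by apply: eq_gexp => z; rewrite scale0r addr0.
have step (M : R) : 0 <= M ->
    (forall s, a <= s -> s <= b -> propag b (fun s y => `|v s y|) s x <= M) ->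
    forall s, a <= s -> s <= b -> propag b (fun s y => `|v s y|) s x <= g + M / 2.
  move=> M0 hM s as' sb.
  have bound : \int[leb]_(r in `[a, s[) propag b (fun r y => `|F r y|) r x <= M / 2.
    apply: le_trans (_ : \int[leb]_(r in `[a, s[) (L * M) <= _).
      apply: le_Rintegral => //.
      - exact: (integrable_joint a s x (joint_bounded_propag b jF')).
      - exact: (integrable_joint a s x (joint_bounded_cst (L * M))).
      - move=> r; rewrite /= in_itv/= => /andP[ar rs].
        have rb : r <= b by rewrite (le_trans (ltW rs)).
        apply: le_trans (_ : propag b (fun r y => L * `|v r y|) r x <= _).
          apply: (ler_propag b x jF' (L := L * V)).
            split; last by move=> ? ?; rewrite normrM normr_id (ger0_norm L0) ler_wpM2l//; case: jv.
            by apply: measurable_funM => //; case: jv'.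
          by move=> z; exact: FL.
        rewrite /propag gexpZ; last exact: (propag_tame b r x jv').
        by rewrite ler_wpM2l//; exact: hM.
    rewrite Rintegral_itv_cst// mulrAC [M / 2]mulrC ler_wpM2r//.
    by apply: le_trans Lab; rewrite ler_wpM2l// lerD2r.
  have [sa|sa] := eqVneq s a.
    rewrite sa (propagE jv' ab) lerDl//; rewrite divr_ge0//.
  have {}sa : a < s by rewrite lt_neqAle eq_sym sa as'.
  have key y := mild_bound y mv jF (lexx a) sa sb mva vaV.
  have [sb'|sb'] := eqVneq s b.
    move: key bound; rewrite sb' phi_b => key bound; apply: (le_trans (key x)).
    by rewrite lerD2l.
  have {}sb : s < b by rewrite lt_neqAle sb' sb.
  have bs0 : 0 < b - s by rewrite subr_gt0.
  have sa0 : 0 < s - a by rewrite subr_gt0.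
  have jPs := joint_bounded_propag s jF'.
  have mn : measurable_fun setT (fun y => `|v a y|) by exact: measurableT_comp.
  have nV y : `| `|v a y| | <= V by rewrite normr_id.
  rewrite (propagE jv' sb).
  apply: le_trans (_ : heat_convolution (b - s) (fun y =>
     heat_convolution (s - a) (fun y => `|v a y|) y +
     \int[leb]_(r in `[a, s[) propag s (fun s y => `|F s y|) r y) x <= _).
    apply: (@ler_heat_convolution _ _ _ _ _ V (V + K * (s - a))) => //.
    - exact: joint_bounded_slice jv'.
    - by case: jv'.
    - apply: measurable_funD.
        exact: measurable_heat_convolution nV.
      exact: measurable_Rintegral_joint jPs.
    - move=> z; rewrite (le_trans (ler_normD _ _))// lerD//.
        exact: heat_convolution_bound.
      by apply: Rintegral_joint_bound => //; exact: ltW.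
  rewrite (@heat_convolutionD _ _ _ _ _ V (K * (s - a)))//; last 4 first.
  - exact: measurable_heat_convolution nV.
  - by move=> z; exact: heat_convolution_bound.
  - exact: measurable_Rintegral_joint jPs.
  - by move=> z; apply: Rintegral_joint_bound => //; exact: ltW.
  rewrite (@heat_semigroup _ _ _ _ _ V)// lerD//.
    by rewrite /g (_ : b - s + (s - a) = b - a)//; ring.
  rewrite (heat_convolution_Rpropag x (ltW sa) bs0 jF').
  by rewrite (_ : s + (b - s) = b)//; ring.
(* The map M -> g + M / 2 of [step] has the fixed point 2 g, and starting from V the distance to it
   is halved each time. *)
have iter k s : a <= s -> s <= b ->
    propag b (fun s y => `|v s y|) s x <= 2 * g + V / 2 ^+ k.
  elim: k s => [|k IH] s as' sb.
    rewrite expr0 divr1 (@le_trans _ _ V)//; last by rewrite lerDr mulr_ge0.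
    by rewrite (le_trans (ler_norm _))//; exact: (propag_bound b s x jv').
  have M0 : 0 <= 2 * g + V / 2 ^+ k by rewrite addr_ge0 ?mulr_ge0// divr_ge0// exprn_ge0.
  apply: (le_trans (step _ M0 IH s as' sb)).
  rewrite le_eqVlt; apply/orP; left; apply/eqP; rewrite exprS; field.
  by rewrite expf_neq0.
rewrite -phi_b; apply/ler_addgt0Pr => e e0.
have [k Vk] : exists k : nat, V / 2 ^+ k <= e.
  have : V * (2^-1 : R) ^+ k @[k --> \oo] --> V * 0.
    by apply: cvgM; [exact: cvg_cst|apply: cvg_expr; rewrite ger0_norm// invf_lt1// ltr1n].
  rewrite mulr0 => /cvgrPdist_le/(_ _ e0)[N _ /(_ N (leqnn N))].
  rewrite sub0r normrN => h; exists N; rewrite -exprVn.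
  exact: le_trans (ler_norm _) h.
apply: (le_trans (iter k b (ltW ab) (lexx b))).
by rewrite lerD2l.
Qed.

End mild_solutions.

(** * Gaussian energy of the rescaled flow *)

Section real_calculus.
Context {R : realType}.

(** Derivatives are tested along sequences, the form in which dominated convergence is available. *)
Lemma is_derive_seq (f : R -> R) (s l : R) :
  (forall u : nat -> R, (forall m, u m != 0) -> u m @[m --> \oo] --> 0 ->
    (f (u m + s) - f s) / u m @[m --> \oo] --> l) ->
  is_derive s 1 f l.
Proof.
move=> h.
have c : h^-1 *: ((f \o shift s) (h *: (1 : R)) - f s) @[h --> 0^'] --> l.
  apply/cvgr_dnbhsP => u [u0 uc].
  apply: cvg_trans (h u u0 uc); apply: near_eq_cvg; apply: nearW => m.
  by rewrite /= [u m *: 1]mulr1 mulrC.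
apply: DeriveDef; first by apply/cvg_ex; exists l.
exact: cvg_lim c.
Qed.

Lemma seq_is_derive (f : R -> R) (s l : R) (u : nat -> R) : is_derive s 1 f l ->
  (forall m, u m != 0) -> u m @[m --> \oo] --> 0 ->
  (f (u m + s) - f s) / u m @[m --> \oo] --> l.
Proof.
move=> [/cvg_ex[l' c] <-] u0 uc.
have -> : 'D_1 f s = l' by exact: cvg_lim c.
move/cvgr_dnbhsP : c => /(_ u (conj u0 uc)).
apply: cvg_trans; apply: near_eq_cvg; apply: nearW => m.
by rewrite /= [u m *: 1]mulr1 mulrC.
Qed.

Lemma is_derive_continuous (f : R -> R) (s l : R) : is_derive s 1 f l -> {for s, continuous f}.
Proof. by case=> d _; apply: differentiable_continuous; exact/derivable1_diffP. Qed.

Lemma MVT_between (f df : R -> R) (a b : R) :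
  (forall x, Num.min a b <= x <= Num.max a b -> is_derive x 1 f (df x)) ->
  exists2 c, Num.min a b <= c <= Num.max a b & f b - f a = df c * (b - a).
Proof.
wlog ab : a b / a <= b.
  move=> wl h; have [ab|ba] := orP (le_total a b); first exact: wl.
  have [|c hc E] := wl b a ba; first by rewrite minC maxC.
  exists c; first by rewrite minC maxC.
  by rewrite -opprB E; ring.
rewrite (min_idPl ab) (max_idPr ab) => h.
have h1 x : x \in `]a, b[ -> is_derive x 1 f (df x).
  by rewrite in_itv/= => /andP[ax xb]; apply: h; rewrite !ltW.
have h2 : {within `[a, b], continuous f}.
  apply: derivable_within_continuous => x; rewrite in_itv/= => hx.
  by case: (h x hx).
have [c hc E] := MVT_segment ab h1 h2.
by exists c => //; move: hc; rewrite in_itv.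
Qed.

Lemma is_derive_line n (F : 'rV[R]_n -> R) (z e : 'rV[R]_n) (r : R) :
  derivable F (z + r *: e) e ->
  is_derive r 1 (fun r => F (z + r *: e)) ('D_e F (z + r *: e)).
Proof.
move=> dF.
have E : (fun h : R => h^-1 *: (((fun r => F (z + r *: e)) \o shift r) (h *: (1 : R)) - F (z + r *: e))) =
   (fun h : R => h^-1 *: ((F \o shift (z + r *: e)) (h *: e) - F (z + r *: e))).
  apply/funext => h /=; congr (_ *: (F _ - _)).
  by rewrite [h *: 1]mulr1 scalerDl addrCA.
apply: DeriveDef.
  by rewrite /derivable E.
by rewrite /derive E.
Qed.

End real_calculus.

Section gaussian_calculus.
Context {R : realType} {n : nat}.
Implicit Types (z : 'rV[R]_n) (s t K : R).
Local Notation mu := (@lebesgue_rV R n).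

(** From 2 r z_i >= - |z|^2 / 2 - 2 r^2 follows |z + r e_i|^2 >= |z|^2 / 2 - r^2. Doubling the time
    pays for the half, the condition r^2 <= t gives e^{1/4}, and 2^{n/2} is the ratio of the
    prefactors. *)
Lemma heat_kernel_shift_le : exists2 C : R, 0 <= C & forall t i r z, 0 < t -> r ^+ 2 <= t ->
  heat_kernel t (z + r *: unit_vec i) <= C * heat_kernel (2 * t) z.
Proof.
exists (2 `^ (n%:R / 2) * expR (4^-1)); first by rewrite mulr_ge0 ?powR_ge0 ?expR_ge0.
move=> t i r z t0 rt.
have t2 : 0 < 2 * t by rewrite mulr_gt0.
have p4 : 0 <= 4 * pi * t :> R by rewrite !mulr_ge0 ?pi_ge0// ltW.
rewrite /heat_kernel.
have -> : 4 * pi * (2 * t) = 2 * (4 * pi * t) by ring.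
rewrite [in leRHS]powRM//; set A := (4 * pi * t) `^ _; set B := 2 `^ (- _).
have AB : 2 `^ (n%:R / 2) * B = 1 :> R.
  by rewrite -powRD ?subrr ?powRr0//; apply/implyP => _; rewrite gt_eqF.
rewrite [leRHS](_ : _ = (2 `^ (n%:R / 2) * B) * (A * (expR 4^-1 *
  expR (- (enorm z ^+ 2 / (4 * (2 * t))))))); last by ring.
rewrite AB mul1r ler_wpM2l ?powR_ge0// -expRD ler_expR enorm_shift.
have zi := coord_le_enorm z i.
have h : 2 * r * z 0 i >= - (enorm z ^+ 2 / 2 + 2 * r ^+ 2).
  have h1 : z 0 i ^+ 2 <= enorm z ^+ 2.
    by rewrite -[leLHS]real_normK ?num_real// lerXn2r ?nnegrE ?enorm_ge0.
  by have := sqr_ge0 (z 0 i + 2 * r); nra.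
rewrite -subr_ge0.
have -> : 4^-1 + - (enorm z ^+ 2 / (4 * (2 * t))) - - ((enorm z ^+ 2 + 2 * r * z 0 i + r ^+ 2) / (4 * t)) =
  (2 * t + (enorm z ^+ 2 + 2 * (2 * r * z 0 i) + 2 * r ^+ 2)) / (8 * t).
  by field; rewrite gt_eqF.
apply: divr_ge0; last by rewrite mulr_ge0// ltW.
by lra.
Qed.

Lemma cvg_inv_succ : (m.+1%:R^-1 : R) @[m --> \oo] --> (0 : R).
Proof. exact: cvg_harmonic. Qed.

(** Gaussian integration by parts, the weight having logarithmic derivative - z_i / 2. By
    translation invariance the difference quotients of F = kernel times phi have integral 0; they
    converge under a Gaussian majorant to the derivative [D] of F, whose integral is therefore 0. *)
Lemma gexp_ibp (phi psi : 'rV[R]_n -> R) i :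
  tame phi -> tame psi ->
  (forall z, derivable phi z (unit_vec i) /\ 'D_(unit_vec i) phi z = psi z) ->
  gexp psi = gexp (fun z => z 0 i / 2 * phi z).
Proof.
move=> tphi tpsi dphi.
pose e := @unit_vec R n i.
pose F z := heat_kernel 1 z * phi z.
pose D z := heat_kernel 1 z * (psi z - z 0 i / 2 * phi z).
have tD : tame (fun z => psi z - z 0 i / 2 * phi z).
  apply: tameB => //; apply: tameM => //.
  by have := tameZ 2^-1 (tame_coord i); under eq_fun do rewrite mulrC.
have [mD0 /poly_bounded_ge0[K [k [K0 hK]]]] := tD.
have [C1 C10 C1P] := @heat_kernel1_poly R n k.
have [C2 C20 C2P] := heat_kernel_shift_le.
have dF (z : 'rV[R]_n) (r : R) : is_derive r 1 (fun r => F (z + r *: e)) (D (z + r *: e)).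
  have d1 := is_derive_line (proj1 (dphi (z + r *: e))).
  rewrite (proj2 (dphi (z + r *: e))) in d1.
  have d2 : is_derive r 1 (fun r => heat_kernel 1 (z + r *: e))
      (- ((z 0 i + r) / 2) * heat_kernel 1 (z + r *: e)).
    have -> : (fun r => heat_kernel 1 (z + r *: e)) =
       (fun r => (4 * pi * 1) `^ (- (n%:R / 2)) *
           expR (- ((enorm z ^+ 2 + 2 * r * z 0 i + r ^+ 2) / (4 * 1)))).
      by apply/funext => q; rewrite /heat_kernel enorm_shift.
    apply: is_derive_eq; rewrite /heat_kernel enorm_shift /GRing.scale/=.
    by field.
  have d3 := is_deriveM d2 d1.
  have -> : D (z + r *: e) = heat_kernel 1 (z + r *: e) *: psi (z + r *: e) +
      phi (z + r *: e) *: (- ((z 0 i + r) / 2) * heat_kernel 1 (z + r *: e)).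
    by rewrite /D [in LHS]mxE [in LHS]mxE [in LHS]mxE !eqxx /GRing.scale/=; ring.
  exact: d3.
have Dle (z : 'rV[R]_n) (r : R) : `|r| <= 1 -> `|D (z + r *: e)| <= K * C1 * C2 * heat_kernel (2 * 2) z.
  move=> r1; rewrite /D normrM (ger0_norm (heat_kernel_ge0 _ _)).
  apply: le_trans (ler_wpM2l (heat_kernel_ge0 _ _) (hK _)) _.
  rewrite mulrCA -(mulrA (K * C1)) -(mulrA K) ler_wpM2l//; apply: (le_trans (C1P _)).
  rewrite ler_wpM2l//; apply: C2P => //; apply: le_trans (_ : 1 <= _); last by rewrite ler1n.
  by rewrite -[leLHS]real_normK ?num_real// -[leRHS](expr1n _ 2) lerXn2r ?nnegrE.
pose h m : R := m.+1%:R^-1.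
have h0 m : 0 < h m by rewrite invr_gt0.
have h1 m : h m <= 1 by rewrite invf_le1// ler1n.
have mF : measurable_fun setT F.
  by apply: measurable_funM; [exact: measurable_heat_kernel|case: tphi].
have iF : mu.-integrable setT (EFin \o F) by exact: integrable_tame.
have mFs m : measurable_fun setT (fun z => F (z + h m *: e)).
  have := measurable_comp_affine (h m *: e) 1 mF.
  by under eq_fun do rewrite scale1r addrC.
have EF m : (\int[mu]_z (F (z + h m *: e))%:E = \int[mu]_z (F z)%:E)%E.
  rewrite [RHS](@integral_affine_rV _ _ (h m *: e) 1)//.
  by apply: eq_integral => z _; rewrite expr1n mul1r scale1r addrC.
have iFs m : mu.-integrable setT (EFin \o (fun z => F (z + h m *: e))).
  apply/integrableP; split; first exact/measurable_EFinP.
  have /integrableP[_] := iF.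
  rewrite (_ : (\int[mu]_z `|(EFin \o F) z|)%E = (\int[mu]_z (`|F z|)%:E)%E)//.
  rewrite (@integral_affine_rV _ _ (h m *: e) 1)//; last exact: measurableT_comp.
  apply: le_lt_trans; rewrite le_eqVlt; apply/orP; left; apply/eqP.
  by apply: eq_integral => z _; rewrite expr1n mul1r scale1r addrC.
pose q m z := (F (z + h m *: e) - F z) / h m.
have iq m : mu.-integrable setT (EFin \o q m).
  have := integrableZl measurableT (h m)^-1 (integrableB measurableT (iFs m) iF).
  by apply: eq_integrable => // z _; rewrite /q /= mulrC.
have q0 m : (\int[mu]_z (q m z)%:E = 0)%E.
  transitivity (\int[mu]_z ((h m)^-1%:E * ((F (z + h m *: e))%:E - (F z)%:E)))%E.
    by apply: eq_integral => z _; rewrite /q mulrC EFinM EFinB.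
  rewrite integralZl//; last exact: (integrableB measurableT (iFs m) iF).
  rewrite (integralB measurableT (iFs m) iF) EF subee ?mule0//.
  exact: integrable_fin_num.
have qD z : q m z @[m --> \oo] --> D z.
  have := seq_is_derive (dF z 0) (fun m => lt0r_neq0 (h0 m)) cvg_inv_succ.
  rewrite scale0r addr0; apply: cvg_trans; apply: near_eq_cvg; apply: nearW => m.
  by rewrite /q addr0.
have qle m z : `|q m z| <= K * C1 * C2 * heat_kernel (2 * 2) z.
  have [c hc E] := @MVT_between R (fun r => F (z + r *: e)) (fun r => D (z + r *: e)) 0 (h m)
    (fun x _ => dF z x).
  rewrite scale0r addr0 subr0 in E.
  rewrite /q E mulfK ?gt_eqF//; apply: Dle.
  move: hc; rewrite (min_idPl (ltW (h0 m))) (max_idPr (ltW (h0 m))) => /andP[c0 ch].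
  by rewrite ger0_norm// (le_trans ch).
have iG : mu.-integrable setT (fun z => (K * C1 * C2 * heat_kernel (2 * 2) z)%:E).
  have := integrableZl measurableT (K * C1 * C2)
    (integrable_heat_kernel (0 : 'rV[R]_n) (mulr_gt0 (@ltr0n R 2) (@ltr0n R 2))).
  by apply: eq_integrable => // z _; rewrite /= sub0r heat_kernelN EFinM.
have pw z : setT z -> (q m z)%:E @[m --> \oo] --> (D z)%:E.
  by move=> _; apply: cvg_EFin; [exact: nearW|exact: qD].
have dom z m : setT z -> (`|(q m z)%:E| <= (K * C1 * C2 * heat_kernel (2 * 2) z)%:E)%E.
  by move=> _; rewrite lee_fin.
have [_ _ lim] := @dominated_convergence _ _ _ mu setT measurableT
  (fun m z => (q m z)%:E) (fun z => (D z)%:E)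
  (fun z => (K * C1 * C2 * heat_kernel (2 * 2) z)%:E)
  (fun m => measurable_int _ (iq m)) (measurable_int _ (integrable_tame tD))
  (aeW _ pw) iG (aeW _ dom).
have D0 : (\int[mu]_z (D z)%:E = 0)%E.
  apply: (cvg_unique _ lim) => //.
  have c0 : (fun _ : nat => 0%E : \bar R) @ \oo --> (0%E : \bar R) by exact: cvg_cst.
  by apply: cvg_trans c0; apply: near_eq_cvg; apply: nearW => m; rewrite /= q0.
apply/eqP; rewrite -subr_eq0; apply/eqP.
have tz : tame (fun z => z 0 i / 2 * phi z).
  apply: tameM => //.
  by have := tameZ 2^-1 (tame_coord i); under eq_fun do rewrite mulrC.
by rewrite -gexpB//; apply: EFin_inj; rewrite gexp_EFin.
Qed.

Lemma is_derive_gexp (phi dphi : R -> 'rV[R]_n -> R) (s s0 s1 K : R) k :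
  s0 < s < s1 ->
  (forall r, s0 < r < s1 -> tame (phi r)) ->
  (forall r z, s0 < r < s1 -> is_derive r 1 (phi ^~ z) (dphi r z)) ->
  (forall r z, s0 < r < s1 -> `|dphi r z| <= K * (1 + enorm z ^+ 2) ^+ k) ->
  is_derive s 1 (fun r => gexp (phi r)) (gexp (dphi s)).
Proof.
move=> ss tphi dp hb; apply: is_derive_seq => u u0 uc.
have [N hN] : exists N, forall m, s0 < u (m + N)%N + s < s1.
  have := uc; move/cvgrPdist_lt.
  have e0 : 0 < Num.min (s - s0) (s1 - s).
    by rewrite lt_min !subr_gt0; case/andP: ss => -> ->.
  move=> /(_ _ e0)[N _ hN]; exists N => m.
  have := hN (m + N)%N (leq_addl _ _); rewrite /= sub0r normrN lt_min => /andP[h1 h2].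
  have := ler_norm (u (m + N)%N); have := ler_norm (- u (m + N)%N); rewrite normrN.
  by move=> h3 h4; apply/andP; split; lra.
rewrite -(cvg_shiftn N).
apply: (cvg_trans (G := gexp (fun z => (phi (u (m + N)%N + s) z - phi s z) / u (m + N)%N) @[m --> \oo])).
  apply: near_eq_cvg; apply: nearW => m.
  have tp := tphi _ (hN m); have ts := tphi _ ss.
  rewrite -[RHS]/((gexp (phi (u (m + N)%N + s)) - gexp (phi s)) / u (m + N)%N).
  rewrite -gexpB// mulrC -gexpZ; last exact: tameB.
  by apply: eq_gexp => z; rewrite mulrC.
apply: (cvg_gexp (K := K) (k := k)).
- move=> m; apply: measurable_funM => //.
  by apply: measurable_funB; [case: (tphi _ (hN m))|case: (tphi _ ss)].
- move=> m z.
  have [|c hc E] := @MVT_between R (phi ^~ z) (dphi ^~ z) s (u (m + N)%N + s).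
    move=> x hx; apply: dp; move: hx ss (hN m).
    by rewrite ge_min le_max => /andP[/orP[h1|h1] /orP[h2|h2]] /andP[? ?] /andP[? ?]; apply/andP; split; lra.
  rewrite E addrK mulfK//; apply: hb.
  move: hc ss (hN m).
  by rewrite ge_min le_max => /andP[/orP[h1|h1] /orP[h2|h2]] /andP[? ?] /andP[? ?]; apply/andP; split; lra.
- move=> z; rewrite (cvg_shiftn N (fun m => (phi (u m + s) z - phi s z) / u m)).
  exact: seq_is_derive (dp s z ss) u0 uc.
Qed.

End gaussian_calculus.
Section nonlinearity.
Context {R : realType} (p : R).
Local Notation f := (power_nonlinearity p).

Lemma measurable_power : measurable_fun setT f.
Proof.
apply: measurable_funM => //.
exact: (measurableT_comp (measurable_powR _) (@normr_measurable _ _)).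
Qed.

Lemma norm_power v : `|f v| = `|v| `^ (p - 1) * `|v|.
Proof. by rewrite normrM norm_powR ?normr_id. Qed.

Lemma norm_powerE v : 1 < p -> `|f v| = `|v| `^ p.
Proof.
move=> p1; rewrite norm_power; have [->|v0] := eqVneq v 0.
  by rewrite normr0 mulr0 powR0// gt_eqF// (lt_trans ltr01).
rewrite -[X in _ * X]powRr1// -powRD ?subrK//.
by rewrite normr_eq0 v0 implybT.
Qed.

Lemma power_bound v K : 1 < p -> `|v| <= K -> `|f v| <= K `^ p.
Proof.
move=> p1 vK; rewrite norm_powerE//; apply: ge0_ler_powR => //; rewrite ?nnegrE//.
  by rewrite ltW// (lt_trans ltr01).
exact: le_trans vK.
Qed.

Lemma powR_sqr_half (v a : R) : `|v| `^ a = (v ^+ 2) `^ (a / 2).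
Proof.
rewrite -(real_normK (num_real v)) -powR_mulrn// -powRrM.
by congr (_ `^ _); field.
Qed.

(** Away from 0 the function is the power (p + 1) / 2 of v^2; at 0 the difference quotient is |h|^p
    in absolute value. *)
Lemma is_derive_abs_powR (v : R) : 1 < p ->
  is_derive v 1 (fun v => `|v| `^ (p + 1)) ((p + 1) * f v).
Proof.
move=> p1; have p0 : 0 < p by rewrite (lt_trans ltr01).
have [->|v0] := eqVneq v 0.
  apply: is_derive_seq => u u0 uc.
  rewrite /power_nonlinearity mulr0 mulr0.
  have c : `|u m| `^ p @[m --> \oo] --> 0.
    have e (e0 : R) : 0 < e0 -> \forall m \near \oo, `|u m| `^ p <= e0.
      move=> e00; have ee : 0 < e0 `^ p^-1 by rewrite powR_gt0.
      move/cvgr0_norm_le: uc => /(_ _ ee); apply: filterS => m hm.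
      rewrite -[leRHS]powRr1 ?(ltW e00)// -(mulVf (lt0r_neq0 p0)) powRrM.
      by apply: ge0_ler_powR; rewrite ?nnegrE ?powR_ge0// ltW.
    apply/cvgr0Pnorm_le => e0 e00; have := e e0 e00; apply: filterS => m.
    by rewrite (ger0_norm (powR_ge0 _ _)).
  apply/cvgr0Pnorm_le => e0 e00; move/cvgr0Pnorm_le : c => /(_ _ e00).
  apply: filterS => m; rewrite addr0 normr0 powR0 ?subr0; last by rewrite gt_eqF// addr_gt0.
  move=> hm; rewrite normrM normfV norm_powR// normr_id powRD; last first.
    by rewrite normr_eq0 u0 implybT.
  rewrite powRr1// mulfK ?normr_eq0//.
  by rewrite norm_powR// normr_id in hm.
have v2 : 0 < v ^+ 2 by rewrite lt_neqAle eq_sym sqrf_eq0 v0 sqr_ge0.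
have -> : (fun v => `|v| `^ (p + 1)) = (fun x => x `^ ((p + 1) / 2)) \o (fun v => v ^+ 2).
  by apply/funext => z /=; exact: powR_sqr_half.
have d2 : is_derive v 1 (fun v : R => v ^+ 2) (2 * v).
  apply: is_derive_eq; rewrite /GRing.scale/=; ring.
have := @is_derive1_comp _ (fun x => x `^ ((p + 1) / 2)) (fun v => v ^+ 2) v _ _
  (is_derive1_powR ((p + 1) / 2) v2) d2.
have -> : (p + 1) / 2 * (v ^+ 2) `^ ((p + 1) / 2 - 1) * (2 * v) = (p + 1) * f v; last by [].
rewrite /power_nonlinearity powR_sqr_half.
have -> : (p + 1) / 2 - 1 = (p - 1) / 2 by field.
by field.
Qed.

(** The mean value theorem is used on the positive half-line only. Oddness gives the negative one,
    and arguments of opposite signs are joined through 0. *)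
Lemma power_lip (K a b : R) : 1 < p -> `|a| <= K -> `|b| <= K ->
  `|f a - f b| <= p * K `^ (p - 1) * `|a - b|.
Proof.
move=> p1 aK bK.
have K0 : 0 <= K by exact: le_trans aK.
have p10 : 0 < p - 1 by rewrite subr_gt0.
have pK : 0 <= K `^ (p - 1) by exact: powR_ge0.
have mon (x : R) : `|x| <= K -> `|x| `^ (p - 1) <= K `^ (p - 1).
  by move=> xK; apply: ge0_ler_powR; rewrite ?nnegrE// ltW.
have pos (x y : R) : 0 <= x -> x <= y -> y <= K -> `|f y - f x| <= p * K `^ (p - 1) * (y - x).
  rewrite le_eqVlt => /predU1P[<- y0 yK|x0 xy yK].
    rewrite /power_nonlinearity mulr0 !subr0 normrM norm_powR// normr_id (ger0_norm y0).
    rewrite ler_wpM2r//; apply: (le_trans (_ : _ <= K `^ (p - 1))).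
      by have := mon y; rewrite ger0_norm//; apply.
    by rewrite ler_peMl// ltW.
  have fE z : x <= z -> f z = z `^ p.
    move=> xz; have z0 : 0 < z by rewrite (lt_le_trans x0).
    rewrite /power_nonlinearity ger0_norm ?ltW// -[X in _ * X]powRr1 ?ltW// -powRD ?subrK//.
    by rewrite (gt_eqF z0) implybT.
  rewrite !fE//.
  have [|c] := @MVT_between R (fun z => z `^ p) (fun z => p * z `^ (p - 1)) x y.
    by move=> z; rewrite (min_idPl xy) => /andP[xz _]; apply: is_derive1_powR; exact: lt_le_trans xz.
  rewrite (min_idPl xy) (max_idPr xy) => /andP[xc cy] ->.
  have c0 : 0 <= c by rewrite (le_trans (ltW x0)).
  rewrite normrM (ger0_norm (_ : 0 <= y - x)) ?subr_ge0// ler_wpM2r ?subr_ge0//.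
  rewrite ger0_norm; last by rewrite mulr_ge0 ?powR_ge0// ltW// (lt_trans ltr01).
  rewrite ler_wpM2l//; first by rewrite ltW// (lt_trans ltr01).
  by have := mon c; rewrite ger0_norm//; apply; exact: le_trans yK.
have fN x : f (- x) = - f x by rewrite /power_nonlinearity normrN mulrN.
have neg (x y : R) : - K <= x -> x <= y -> y <= 0 -> `|f y - f x| <= p * K `^ (p - 1) * (y - x).
  move=> Kx xy y0; have := pos (- y) (- x); rewrite !fN => h.
  have -> : f y - f x = - f x - - f y by ring.
  by rewrite (_ : y - x = - x - - y); [apply: h; rewrite ?oppr_ge0 ?lerN2// lerNl|ring].
wlog ab : a b aK bK / b <= a.
  move=> wl; have [ba|ab] := orP (le_total b a); first exact: wl.
  by rewrite distrC (distrC a); exact: wl.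
rewrite (ger0_norm (_ : 0 <= a - b)) ?subr_ge0//.
have /andP[_ aK'] : - K <= a <= K by rewrite -ler_norml.
have /andP[bK' _] : - K <= b <= K by rewrite -ler_norml.

have [b0|b0] := leP 0 b; first exact: pos.
have [a0|a0] := leP a 0; first exact: neg.
have h1 := pos 0 a (lexx 0) (ltW a0) aK'.
have h2 := neg b 0 bK' (ltW b0) (lexx 0).
have f0 : f 0 = 0 by rewrite /power_nonlinearity mulr0.
rewrite f0 subr0 in h1; rewrite f0 sub0r in h2.
apply: (le_trans (ler_normD _ _)).
rewrite (_ : a - b = (a - 0) + (0 - b)); last by ring.
by rewrite mulrDr lerD.
Qed.

End nonlinearity.

(** * Energy and mass in similarity variables *)

Section energy.
Context {R : realType} {n : nat} (p : R).
Local Notation f := (power_nonlinearity p).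
Local Notation beta := ((p - 1)^-1).

(** Exactly what the energy argument uses: a bounded solution of w_s = Delta w - (y/2).grad w - beta
    w + f(w) on the whole half-line s > sigma, with bounded first and pure second derivatives that
    are continuous in s. No mixed derivative in s and y is asked for. *)
Record rescaled_flow (sigma K : R) (w ws : R -> 'rV[R]_n -> R)
    (wi wii : 'I_n -> R -> 'rV[R]_n -> R) : Prop := RescaledFlow {
  flow_dt : forall s y, sigma < s -> is_derive s 1 (w ^~ y) (ws s y) ;
  flow_dx : forall i s y, sigma < s ->
    derivable (w s) y (unit_vec i) /\ 'D_(unit_vec i) (w s) y = wi i s y ;
  flow_dxx : forall i s y, sigma < s ->
    derivable (wi i s) y (unit_vec i) /\ 'D_(unit_vec i) (wi i s) y = wii i s y ;
  flow_eq : forall s y, sigma < s -> ws s y =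
    \sum_(i < n) (wii i s y - y 0 i / 2 * wi i s y) - beta * w s y + f (w s y) ;
  flow_w : forall s y, sigma < s -> `|w s y| <= K ;
  flow_wi : forall i s y, sigma < s -> `|wi i s y| <= K ;
  flow_wii : forall i s y, sigma < s -> `|wii i s y| <= K ;
  flow_mw : forall s, sigma < s -> measurable_fun setT (w s) ;
  flow_mwi : forall i s, sigma < s -> measurable_fun setT (wi i s) ;
  flow_mwii : forall i s, sigma < s -> measurable_fun setT (wii i s) ;
  flow_cwi : forall i s y, sigma < s -> wi i r y @[r --> s] --> wi i s y ;
  flow_cwii : forall i s y, sigma < s -> wii i r y @[r --> s] --> wii i s y }.

Variables (sigma K : R) (w ws : R -> 'rV[R]_n -> R) (wi wii : 'I_n -> R -> 'rV[R]_n -> R).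
Hypothesis p1 : 1 < p.
Hypothesis flow : rescaled_flow sigma K w ws wi wii.

Let Lw i s y := wii i s y - y 0 i / 2 * wi i s y.
Let L s y := \sum_(i < n) Lw i s y.

Let tw s : sigma < s -> tame (w s).
Proof. by move=> ss; apply: (tame_bounded (flow_mw flow ss)) => z; exact: (flow_w flow). Qed.
Let twi i s : sigma < s -> tame (wi i s).
Proof. by move=> ss; apply: (tame_bounded (flow_mwi flow i ss)) => z; exact: (flow_wi flow). Qed.
Let twii i s : sigma < s -> tame (wii i s).
Proof. by move=> ss; apply: (tame_bounded (flow_mwii flow i ss)) => z; exact: (flow_wii flow). Qed.
Let thalf i : tame (fun y : 'rV[R]_n => y 0 i / 2).
Proof. by have := tameZ 2^-1 (tame_coord i); under eq_fun do rewrite mulrC. Qed.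
Let tL i s : sigma < s -> tame (Lw i s).
Proof. by move=> ss; apply: tameB; [exact: twii|apply: tameM; [exact: thalf|exact: twi]]. Qed.
Let tLs s : sigma < s -> tame (L s).
Proof. by move=> ss; apply: tame_sum => i; exact: tL. Qed.
Let K0 : 0 <= K.
Proof. by apply: le_trans (normr_ge0 (w (sigma + 1) 0)) _; apply: (flow_w flow); rewrite ltrDl. Qed.
Let tf s : sigma < s -> tame (fun y => f (w s y)).
Proof.
move=> ss; apply: (@tame_bounded _ _ _ (K `^ p)).
  by apply: (measurableT_comp (measurable_power p)); exact: (flow_mw flow).
by move=> z; apply: power_bound => //; exact: (flow_w flow).
Qed.
Let tws s : sigma < s -> tame (ws s).
Proof.
move=> ss; have -> : ws s = fun y => L s y - beta * w s y + f (w s y).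
  by apply/funext => y; rewrite (flow_eq flow).
apply: tameD; last exact: tf.
by apply: tameB; [exact: tLs|apply: tameZ; exact: tw].
Qed.

Let Kl := n%:R * (K + K).

Let L_bound s y : sigma < s -> `|L s y| <= Kl * (1 + enorm y ^+ 2).
Proof.
move=> ss; apply: (le_trans (ler_norm_sum _ _ _)).
apply: le_trans (_ : \sum_(i < n) (K + K) * (1 + enorm y ^+ 2) <= _); last first.
  by rewrite sumr_const card_ord -mulr_natl mulrA.
apply: ler_sum => i _; rewrite (le_trans (ler_normB _ _))// mulrDl lerD//.
  apply: le_trans (flow_wii flow i y ss) _.
  by rewrite ler_peMr// ge1_bracket.
rewrite mulrC normrM; apply: ler_pM => //; first exact: (flow_wi flow).
rewrite normrM [X in _ * X]gtr0_norm ?invr_gt0//; apply: le_trans (coord_le_bracket y i).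
by rewrite ler_piMr// invf_le1// ler1n.
Qed.

Let Kb := Kl + `|beta| * K + K `^ p.

Let ws_bound s y : sigma < s -> `|ws s y| <= Kb * (1 + enorm y ^+ 2).
Proof.
move=> ss; rewrite (flow_eq flow)// -/(L s y) (le_trans (ler_normD _ _))// !mulrDl lerD//.
  rewrite (le_trans (ler_normB _ _))// lerD//; first exact: L_bound.
  rewrite normrM; apply: le_trans (_ : `|beta| * K <= _).
    by rewrite ler_wpM2l//; exact: (flow_w flow).
  by rewrite ler_peMr ?mulr_ge0// ge1_bracket.
apply: le_trans (_ : K `^ p <= _); last by rewrite ler_peMr ?powR_ge0// ge1_bracket.
by apply: power_bound => //; exact: (flow_w flow).
Qed.

Let Kl0 : 0 <= Kl. Proof. by rewrite mulr_ge0// addr_ge0. Qed.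
Let Kb0 : 0 <= Kb.
Proof. by rewrite !addr_ge0 ?mulr_ge0 ?powR_ge0// addr_ge0. Qed.

Let near_bounds s : sigma < s -> sigma < s < s + 1.
Proof. by move=> ->; rewrite ltrDl/=. Qed.

Lemma is_derive_mass s : sigma < s ->
  is_derive s 1 (fun s => gexp (fun y => w s y ^+ 2)) (gexp (fun y => 2 * w s y * ws s y)).
Proof.
move=> ss; apply: (@is_derive_gexp _ _ (fun s y => w s y ^+ 2) (fun s y => 2 * w s y * ws s y)
  s sigma (s + 1) (2 * K * Kb) 1); first exact: near_bounds.
- by move=> r /andP[sr _]; under eq_fun do rewrite expr2; apply: tameM; exact: tw.
- move=> r z /andP[sr _]; have d := flow_dt flow z sr.
  apply: is_derive_eq; rewrite /GRing.scale/=; ring.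
- move=> r z /andP[sr _]; rewrite expr1 normrM -mulrA; apply: ler_pM => //.
    by rewrite normrM ger0_norm// ler_wpM2l//; exact: (flow_w flow).
  exact: ws_bound.
Qed.

Lemma is_derive_potential s : sigma < s ->
  is_derive s 1 (fun s => gexp (fun y => `|w s y| `^ (p + 1)))
    (gexp (fun y => (p + 1) * f (w s y) * ws s y)).
Proof.
move=> ss; have pp : 0 <= p + 1 by rewrite addr_ge0// ltW// (lt_trans ltr01).
apply: (@is_derive_gexp _ _ (fun s y => `|w s y| `^ (p + 1))
  (fun s y => (p + 1) * f (w s y) * ws s y)
  s sigma (s + 1) ((p + 1) * K `^ p * Kb) 1); first exact: near_bounds.
- move=> r /andP[sr _]; apply: (@tame_bounded _ _ _ (K `^ (p + 1))).
    apply: (measurableT_comp (measurable_powR _)).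
    by apply: measurableT_comp => //; exact: (flow_mw flow).
  move=> z; rewrite ger0_norm ?powR_ge0//; apply: ge0_ler_powR; rewrite ?nnegrE//.
  exact: (flow_w flow).
- move=> r z /andP[sr _].
  exact: (is_derive1_comp (is_derive_abs_powR (w r z) p1) (flow_dt flow z sr)).
- move=> r z /andP[sr _]; rewrite expr1 normrM -mulrA; apply: ler_pM => //.
    rewrite normrM ger0_norm// ler_wpM2l//; apply: power_bound => //; exact: (flow_w flow).
  exact: ws_bound.
Qed.

Definition gradient_energy s := \sum_(i < n) gexp (fun y => wi i s y ^+ 2).

(** Since a^2 - b^2 = (a - b)(a + b), integration by parts moves the derivative off the increment
    w_r - w_s. The quotient in s then converges through w_s alone, and the derivative of grad w in s
    is never formed. *)
Lemma gradient_energyB r s : sigma < r -> sigma < s ->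
  gradient_energy r - gradient_energy s =
  - gexp (fun y => (w r y - w s y) * (L r y + L s y)).
Proof.
move=> sr ss; rewrite -sumrB.
have td : tame (fun y => w r y - w s y) by apply: tameB; exact: tw.
transitivity (\sum_(i < n) - gexp (fun y => (w r y - w s y) * (Lw i r y + Lw i s y))).
  apply: eq_bigr => i _.
  have tS : tame (fun y => wi i r y + wi i s y) by apply: tameD; exact: twi.
  have tD : tame (fun y => wi i r y - wi i s y) by apply: tameB; exact: twi.
  have tS2 : tame (fun y => wii i r y + wii i s y) by apply: tameD; exact: twii.
  pose phi y := (w r y - w s y) * (wi i r y + wi i s y).
  pose psi y := (wi i r y - wi i s y) * (wi i r y + wi i s y) +
    (w r y - w s y) * (wii i r y + wii i s y).
  have tphi : tame phi by exact: tameM.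
  have tpsi : tame psi by apply: tameD; exact: tameM.
  have dphi z : derivable phi z (unit_vec i) /\ 'D_(unit_vec i) phi z = psi z.
    have [a1 b1] := flow_dx flow i z sr; have [a2 b2] := flow_dx flow i z ss.
    have [a3 b3] := flow_dxx flow i z sr; have [a4 b4] := flow_dxx flow i z ss.
    have d1 := is_deriveB (DeriveDef a1 b1) (DeriveDef a2 b2).
    have d2 := is_deriveD (DeriveDef a3 b3) (DeriveDef a4 b4).
    have [h1 h2] := is_deriveM d1 d2; split=> //.
    by rewrite h2 /psi /GRing.scale/= addrC mulrC; congr (_ + _); rewrite mulrC.
  have ibp := gexp_ibp tphi tpsi dphi.
  have e1 : gexp psi = gexp (fun y => wi i r y ^+ 2) - gexp (fun y => wi i s y ^+ 2) +
      gexp (fun y => (w r y - w s y) * (wii i r y + wii i s y)).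
    rewrite gexpD; [|exact: tameM|exact: tameM]; congr (_ + _).
    rewrite -gexpB.
    - by apply: eq_gexp => y; ring.
    - by under eq_fun do rewrite expr2; apply: tameM; exact: twi.
    - by under eq_fun do rewrite expr2; apply: tameM; exact: twi.
  have e2 : gexp (fun y => (w r y - w s y) * (Lw i r y + Lw i s y)) =
     gexp (fun y => (w r y - w s y) * (wii i r y + wii i s y)) - gexp (fun z => z 0 i / 2 * phi z).
    rewrite -gexpB; [|exact: tameM|apply: tameM => //; exact: thalf].
    by apply: eq_gexp => y; rewrite /phi /Lw; ring.
  rewrite e2 -ibp e1; ring.
rewrite sumrN -gexp_sum; last first.
  by move=> i; apply: tameM => //; apply: tameD; exact: tL.
congr (- _); apply: eq_gexp => y.
by rewrite -mulr_sumr big_split.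
Qed.

Lemma is_derive_gradient_energy s : sigma < s ->
  is_derive s 1 gradient_energy (- gexp (fun y => ws s y * (2 * L s y))).
Proof.
move=> ss; apply: is_derive_seq => u u0 uc.
have [N hN] : exists N, forall m, sigma < u (m + N)%N + s.
  have e0 : 0 < s - sigma by rewrite subr_gt0.
  move/cvgrPdist_lt : (uc) => /(_ _ e0)[N _ hN]; exists N => m.
  have := hN (m + N)%N (leq_addl _ _); rewrite /= sub0r normrN => h.
  have := ler_norm (- u (m + N)%N); rewrite normrN; lra.
rewrite -(cvg_shiftn N).
have tq m : tame (fun y => (w (u (m + N)%N + s) y - w s y) / u (m + N)%N).
  under eq_fun do rewrite mulrC; apply: tameZ.
  by apply: tameB; exact: tw.
apply: (cvg_trans (G := - gexp (fun y => (w (u (m + N)%N + s) y - w s y) / u (m + N)%N *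
    (L (u (m + N)%N + s) y + L s y)) @[m --> \oo])).
  apply: near_eq_cvg; apply: nearW => m.
  rewrite -[RHS]/((gradient_energy (u (m + N)%N + s) - gradient_energy s) / u (m + N)%N).
  rewrite gradient_energyB// mulNr; congr (- _); rewrite mulrC -gexpZ.
    by apply: eq_gexp => y; rewrite mulrA [X in X * _]mulrC.
  by apply: tameM; [apply: tameB; exact: tw|apply: tameD; exact: tLs].
apply: cvgN.
apply: (cvg_gexp (K := Kb * (Kl + Kl)) (k := 2)).
- move=> m; apply: measurable_funM; first by case: (tq m).
  by apply: measurable_funD; [case: (tLs (hN m))|case: (tLs ss)].
- move=> m z; rewrite normrM expr2 mulrACA; apply: ler_pM => //.
    have seg x : Num.min s (u (m + N)%N + s) <= x <= Num.max s (u (m + N)%N + s) -> sigma < x.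
      by move=> /andP[+ _]; apply: lt_le_trans; rewrite lt_min ss hN.
    have [c hc ->] := @MVT_between R (w ^~ z) (ws ^~ z) s (u (m + N)%N + s)
      (fun x hx => flow_dt flow z (seg x hx)).
    by rewrite addrK mulfK//; apply: ws_bound; exact: seg hc.
  by rewrite (le_trans (ler_normD _ _))// mulrDl lerD//; exact: L_bound.
- move=> z; have -> : 2 * L s z = L s z + L s z by ring.
  rewrite (cvg_shiftn N (fun m => (w (u m + s) z - w s z) / u m * (L (u m + s) z + L s z))).
  apply: cvgM; first exact: (seq_is_derive (flow_dt flow z ss) u0 uc).
  apply: cvgD; last exact: cvg_cst.
  have us : u m + s @[m --> \oo] --> s.
    by rewrite -[X in _ --> X]add0r; apply: cvgD => //; exact: cvg_cst.
  apply: cvg_bigsum => i; apply: cvgB.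
    have cc := @flow_cwii _ _ _ _ _ _ flow i s z ss.
    exact: (cvg_comp _ _ us cc).
  apply: cvgM; first exact: cvg_cst.
  have cc := @flow_cwi _ _ _ _ _ _ flow i s z ss.
  exact: (cvg_comp _ _ us cc).
Qed.

Definition flow_energy s := gradient_energy s / 2 + beta / 2 * gexp (fun y => w s y ^+ 2) -
  gexp (fun y => `|w s y| `^ (p + 1)) / (p + 1).

Lemma is_derive_flow_energy s : sigma < s ->
  is_derive s 1 flow_energy (- gexp (fun y => ws s y ^+ 2)).
Proof.
move=> ss.
have d1 := is_derive_gradient_energy ss.
have d2 := is_derive_mass ss.
have d3 := is_derive_potential ss.
have pp : p + 1 != 0 by rewrite gt_eqF// addr_gt0// (lt_trans ltr01).
have -> : flow_energy = (2^-1 \*: gradient_energy) + ((beta / 2) \*: (fun s => gexp (fun y => w s y ^+ 2)))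
    - ((p + 1)^-1 \*: (fun s => gexp (fun y => `|w s y| `^ (p + 1)))).
  apply/funext => r; rewrite /flow_energy.
  rewrite -[RHS]/(2^-1 * gradient_energy r + beta / 2 * gexp (fun y => w r y ^+ 2) -
    (p + 1)^-1 * gexp (fun y => `|w r y| `^ (p + 1))).
  by rewrite [gradient_energy r / 2]mulrC [X in _ - X]mulrC.
apply: is_derive_eq; rewrite /GRing.scale/=.
rewrite -gexpN; last by apply: tameM; [exact: tws|apply: tameZ; exact: tLs].
have t1 : tame (fun y => ws s y * (2 * L s y)) by apply: tameM; [exact: tws|apply: tameZ; exact: tLs].
have t2 : tame (fun y => 2 * w s y * ws s y) by apply: tameM; [apply: tameZ; exact: tw|exact: tws].
have t3 : tame (fun y => (p + 1) * f (w s y) * ws s y) by apply: tameM; [apply: tameZ; exact: tf|exact: tws].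
rewrite -!gexpZ//; last exact: tameN.
rewrite -gexpD; [|by apply: tameZ; exact: tameN|exact: tameZ].
rewrite -gexpB; [|by apply: tameD; [apply: tameZ; exact: tameN|exact: tameZ]|exact: tameZ].
rewrite -gexpN; last by under eq_fun do rewrite expr2; apply: tameM; exact: tws.
apply: eq_gexp => y; have := flow_eq flow y ss; rewrite -/(L s y) => E.
have {}E : L s y = ws s y + beta * w s y - f (w s y) by rewrite E; ring.
have pm : p - 1 != 0 by rewrite gt_eqF// subr_gt0.
by rewrite E; field; rewrite pp pm.
Qed.

(** The equation is tested with w, and the quadratic terms are eliminated through the energy. What
    remains besides the energy is positive, so the mass is forced to grow when the energy is small
    and the potential term is not. *)
Lemma mass_derivE s : sigma < s ->
  gexp (fun y => 2 * w s y * ws s y) = - 4 * flow_energy s +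
    2 * (p - 1) / (p + 1) * gexp (fun y => `|w s y| `^ (p + 1)).
Proof.
move=> ss.
have pp : p + 1 != 0 by rewrite gt_eqF// addr_gt0// (lt_trans ltr01).
have pm : p - 1 != 0 by rewrite gt_eqF// subr_gt0.
have tp : tame (fun y => `|w s y| `^ (p + 1)).
  have -> : (fun y => `|w s y| `^ (p + 1)) = (fun y => f (w s y) * w s y).
    apply/funext => y; rewrite /power_nonlinearity -mulrA -expr2.
    have [->|w0] := eqVneq (w s y) 0.
      by rewrite normr0 expr0n/= mulr0 powR0// addrC.
    rewrite -(real_normK (num_real (w s y))) -powR_mulrn// -powRD; last first.
      by rewrite normr_eq0 w0 implybT.
    by congr (_ `^ _); ring.
  by apply: tameM; [exact: tf|exact: tw].
have tww : tame (fun y => w s y ^+ 2) by under eq_fun do rewrite expr2; apply: tameM; exact: tw.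
have eL : gexp (fun y => w s y * L s y) = - gradient_energy s.
  rewrite /gradient_energy -sumrN.
  transitivity (gexp (fun y => \sum_(i < n) w s y * Lw i s y)).
    by apply: eq_gexp => y; rewrite mulr_sumr.
  rewrite gexp_sum; last by move=> i; apply: tameM; [exact: tw|exact: tL].
  apply: eq_bigr => i _.
  pose phi y := w s y * wi i s y.
  pose psi y := w s y * wii i s y + wi i s y ^+ 2.
  have ti2 : tame (fun y => wi i s y ^+ 2) by under eq_fun do rewrite expr2; apply: tameM; exact: twi.
  have t4 : tame (fun y => w s y * wii i s y) by apply: tameM; [exact: tw|exact: twii].
  have tphi : tame phi by apply: tameM; [exact: tw|exact: twi].
  have tpsi : tame psi by exact: tameD.
  have dphi z : derivable phi z (unit_vec i) /\ 'D_(unit_vec i) phi z = psi z.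
    have [a1 b1] := flow_dx flow i z ss; have [a3 b3] := flow_dxx flow i z ss.
    by have [h1 h2] := is_deriveM (DeriveDef a1 b1) (DeriveDef a3 b3).
  have ibp := gexp_ibp tphi tpsi dphi.
  have e1 : gexp psi = gexp (fun y => w s y * wii i s y) + gexp (fun y => wi i s y ^+ 2) by exact: gexpD.
  have -> : gexp (fun y => w s y * Lw i s y) = gexp (fun y => w s y * wii i s y) - gexp (fun z => z 0 i / 2 * phi z).
    rewrite -gexpB//; last by apply: tameM => //; exact: thalf.
    by apply: eq_gexp => y; rewrite /phi /Lw; ring.
  by rewrite -ibp e1; ring.
have -> : gexp (fun y => 2 * w s y * ws s y) =
    2 * gexp (fun y => w s y * L s y) - 2 * beta * gexp (fun y => w s y ^+ 2) + 2 * gexp (fun y => `|w s y| `^ (p + 1)).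
  have t5 : tame (fun y => w s y * L s y) by apply: tameM; [exact: tw|exact: tLs].
  rewrite -!gexpZ// -gexpB; [|exact: tameZ|exact: tameZ].
  rewrite -gexpD; [|by apply: tameB; exact: tameZ|exact: tameZ].
  apply: eq_gexp => y; rewrite (flow_eq flow)// -/(L s y).
  have -> : `|w s y| `^ (p + 1) = f (w s y) * w s y.
    rewrite /power_nonlinearity -mulrA -expr2.
    have [->|w0] := eqVneq (w s y) 0.
      by rewrite normr0 expr0n/= mulr0 powR0// addrC.
    rewrite -(real_normK (num_real (w s y))) -powR_mulrn// -powRD; last first.
      by rewrite normr_eq0 w0 implybT.
    by congr (_ `^ _); ring.
  by field.
rewrite eL /flow_energy; field.
by rewrite pp pm.
Qed.

Let tpow s : sigma < s -> tame (fun y => `|w s y| `^ (p + 1)).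
Proof.
move=> ss; have pp : 0 <= p + 1 by rewrite addr_ge0// ltW// (lt_trans ltr01).
apply: (@tame_bounded _ _ _ (K `^ (p + 1))).
  by apply: (measurableT_comp (measurable_powR _)); apply: measurableT_comp => //; exact: (flow_mw flow).
move=> z; rewrite ger0_norm ?powR_ge0//; apply: ge0_ler_powR; rewrite ?nnegrE//.
exact: (flow_w flow).
Qed.

Let tsqr s : sigma < s -> tame (fun y => w s y ^+ 2).
Proof. by move=> ss; under eq_fun do rewrite expr2; apply: tameM; exact: tw. Qed.

Lemma flow_energy_le r s : sigma < r -> r <= s -> flow_energy s <= flow_energy r.
Proof.
move=> sr rs.
have [|c] := @MVT_between R flow_energy (fun s => - gexp (fun y => ws s y ^+ 2)) r s.
  by move=> x; rewrite (min_idPl rs) => /andP[rx _]; apply: is_derive_flow_energy; exact: lt_le_trans rx.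
rewrite (min_idPl rs) => /andP[rc _] E.
have sc := lt_le_trans sr rc.
rewrite -subr_le0 E mulNr oppr_le0 mulr_ge0 ?subr_ge0//.
by apply: gexp_ge0 => z; rewrite sqr_ge0.
Qed.

Lemma flow_energy_le_mass s : sigma < s ->
  flow_energy s <= gradient_energy s / 2 + beta / 2 * gexp (fun y => w s y ^+ 2).
Proof.
move=> ss; rewrite /flow_energy lerBlDr lerDl mulr_ge0//.
  by apply: gexp_ge0 => z; rewrite powR_ge0.
by rewrite invr_ge0 addr_ge0// ltW// (lt_trans ltr01).
Qed.

(** An affine lower bound in v^2. It bounds the energy density from above and, in [mass_le],
    replaces Jensen's inequality in bounding the potential from below by the mass. *)
Lemma pow_ge_sqr (v lam : R) : 0 < lam ->
  lam `^ (p - 1) * (v ^+ 2 - lam ^+ 2) <= `|v| `^ (p + 1).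
Proof.
move=> l0; have p10 : 0 <= p - 1 by rewrite ltW// subr_gt0.
have [lv|vl] := leP lam `|v|.
  have v0 : 0 < `|v| by rewrite (lt_le_trans l0).
  have -> : `|v| `^ (p + 1) = `|v| `^ (p - 1) * v ^+ 2.
    rewrite -(real_normK (num_real v)) -powR_mulrn// -powRD ?(gt_eqF v0) ?implybT//.
    by congr (_ `^ _); ring.
  apply: le_trans (_ : lam `^ (p - 1) * v ^+ 2 <= _).
    by rewrite ler_wpM2l ?powR_ge0// lerBlDr lerDl sqr_ge0.
  by rewrite ler_wpM2r ?sqr_ge0//; apply: ge0_ler_powR; rewrite ?nnegrE// ltW.
apply: le_trans (powR_ge0 _ _); rewrite mulr_ge0_le0 ?powR_ge0// subr_le0.
by rewrite -(real_normK (num_real v)) lerXn2r ?nnegrE// ltW.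
Qed.

(** An upper bound for beta v^2 / 2 - |v|^{p+1} / (p+1), obtained from [pow_ge_sqr] with the lam for
    which lam^{p-1} = (p+1) beta / 2: the two terms in v^2 then cancel. *)
Definition potential_max : R :=
  beta / 2 * (((p + 1) * (beta / 2)) `^ beta) ^+ 2.

Lemma flow_energy_le_max s : sigma < s ->
  flow_energy s <= gradient_energy s / 2 + potential_max.
Proof.
move=> ss; rewrite /flow_energy -addrA lerD2l.
have p0 : 0 < p + 1 by rewrite addr_gt0// (lt_trans ltr01).
have p10 : 0 < p - 1 by rewrite subr_gt0.
have b0 : 0 < beta by rewrite invr_gt0.
rewrite [X in _ - X]mulrC -!gexpZ; [|exact: tpow|exact: tsqr].
rewrite -gexpB; [|by apply: tameZ; exact: tsqr|by apply: tameZ; exact: tpow].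
rewrite -[leRHS](@gexp_cst R n); apply: ler_gexp.
- by apply: tameB; apply: tameZ; [exact: tsqr|exact: tpow].
- exact: tame_cst.
move=> y; set A := (p + 1) * (beta / 2).
have A0 : 0 < A by rewrite mulr_gt0// divr_gt0.
have lam0 : 0 < A `^ beta by rewrite powR_gt0.
have := pow_ge_sqr (w s y) lam0; rewrite -powRrM mulVf ?(gt_eqF p10)// powRr1 ?(ltW A0)//.
rewrite -(ler_pM2l (_ : 0 < (p + 1)^-1)) ?invr_gt0// /potential_max -/A.
have -> : (p + 1)^-1 * (A * (w s y ^+ 2 - A `^ beta ^+ 2)) =
  beta / 2 * w s y ^+ 2 - beta / 2 * A `^ beta ^+ 2.
  by rewrite /A; field; rewrite (gt_eqF p10) (gt_eqF p0).
by move=> h; lra.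
Qed.

(** At a maximum c of the mass on [s1, S] the mass exceeds 2 lam^2, so by [pow_ge_sqr] the potential
    is at least lam^{p+1}. With the energy still at most eps, the mass increases strictly at c. But
    S is chosen with mass below 2 lam^2, so c lies before S, where a maximum forbids growth. *)
Lemma mass_le (eps lam s0 s1 : R) : sigma < s0 -> s0 <= s1 -> flow_energy s0 <= eps ->
  0 < lam -> 4 * eps < 2 * (p - 1) / (p + 1) * lam `^ (p + 1) ->
  (forall S, exists2 S', S <= S' & gexp (fun y => w S' y ^+ 2) < 2 * lam ^+ 2) ->
  gexp (fun y => w s1 y ^+ 2) <= 2 * lam ^+ 2.
Proof.
move=> ss0 s01 E0 l0 el small; rewrite leNgt; apply/negP => W1.
have [S s1S WS] := small s1.
pose W s := gexp (fun y => w s y ^+ 2).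
have ss1 := lt_le_trans ss0 s01.
have dW s : sigma < s -> is_derive s 1 W (gexp (fun y => 2 * w s y * ws s y)).
  exact: is_derive_mass.
have cW : {within `[s1, S], continuous W}.
  apply: continuous_in_subspaceT => x; rewrite inE/= in_itv/= => /andP[sx _].
  by apply: is_derive_continuous; apply: dW; exact: lt_le_trans sx.
have [c cin cmax] := EVT_max s1S cW.
have {cin} /andP[s1c cS] : s1 <= c <= S by move: cin; rewrite inE.
have Wc : 2 * lam ^+ 2 < W c.
  by apply: lt_le_trans W1 _; apply: cmax; rewrite in_itv/= lexx.
have {}cS : c < S.
  rewrite lt_neqAle cS andbT; apply/eqP => cE.
  by have := lt_trans Wc; rewrite cE => /(_ _ WS); rewrite ltxx.
have sc := lt_le_trans ss1 s1c.
have p0 : 0 < p + 1 by rewrite addr_gt0// (lt_trans ltr01).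
have p10 : 0 < p - 1 by rewrite subr_gt0.
have dpos : 0 < gexp (fun y => 2 * w c y * ws c y).
  rewrite mass_derivE//.
  have k0 : 0 < 2 * (p - 1) / (p + 1) by rewrite divr_gt0// mulr_gt0.
  have Ec : flow_energy c <= eps.
    by apply: le_trans E0; apply: flow_energy_le => //; exact: le_trans s1c.
  have P : lam `^ (p + 1) <= gexp (fun y => `|w c y| `^ (p + 1)).
    have -> : lam `^ (p + 1) = lam `^ (p - 1) * lam ^+ 2.
      rewrite -powR_mulrn ?ltW// -powRD ?(gt_eqF l0) ?implybT//.
      by congr (_ `^ _); ring.
    apply: le_trans (_ : lam `^ (p - 1) * (W c - lam ^+ 2) <= _).
      by rewrite ler_wpM2l ?powR_ge0// lerBrDr -mulr2n -mulr_natl ltW.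
    have ts2 := tsqr sc.
    rewrite -[X in W c - X](@gexp_cst R n) -gexpB//; last exact: tame_cst.
    rewrite -gexpZ; last by apply: tameB => //; exact: tame_cst.
    apply: ler_gexp; last by move=> y; exact: pow_ge_sqr.
      by apply: tameZ; apply: tameB => //; exact: tame_cst.
    exact: tpow.
  rewrite -(ler_pM2l k0) in P.
  rewrite mulNr addrC subr_gt0; apply: (lt_le_trans _ P); apply: le_lt_trans el.
  by rewrite ler_pM2l.
(* Only positive increments are used, since c may be the left endpoint s1. *)
have := seq_is_derive (dW c sc)
  (fun m => lt0r_neq0 (divr_gt0 (_ : 0 < S - c) (ltr0Sn R m))).
rewrite subr_gt0 => /(_ cS) h.
have u0 : (S - c) / m.+1%:R @[m --> \oo] --> 0.
  by rewrite -(mulr0 (S - c)); apply: cvgM; [exact: cvg_cst|exact: cvg_inv_succ].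
suff : gexp (fun y => 2 * w c y * ws c y) <= 0 by rewrite leNgt dpos.
apply: (cvg_le_cst (h u0)); apply: nearW => m.
have q0 : 0 < (S - c) / m.+1%:R by rewrite divr_gt0 ?subr_gt0.
have q1 : (S - c) / m.+1%:R <= S - c by rewrite ler_pdivrMr// ler_peMr ?ler1n// subr_ge0 ltW.
rewrite pmulr_lle0 ?invr_gt0// subr_le0; apply: cmax.
rewrite in_itv/=; apply/andP; split; last by rewrite -lerBrDr.
by rewrite (le_trans s1c)// lerDr ltW.
Qed.

End energy.

(** * Regularity of the solution and the rescaled mass *)

Section Linfty.
Context {R : realType} {n : nat}.
Implicit Types (f : 'rV[R]_n -> R) (x : 'rV[R]_n) (c e : R).
Local Notation mu := (@lebesgue_rV R n).

Lemma lebesgue_rV_ball_gt0 x e : 0 < e ->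
  (0 < mu [set y | forall i, ball (x 0%R i) e (y 0%R i)])%E.
Proof.
move=> e0; rewrite (@lebesgue_rV_box R n (fun i => ball (x 0 i) e)); last first.
  by move=> i; exact: measurable_ball.
have -> : (\prod_(i < n) lebesgue_measure (ball (x 0%R i) e) = (\prod_(i < n) (e *+ 2)%:E))%E.
  by apply: eq_bigr => i _; rewrite lebesgue_measure_ball// ltW.
by rewrite prodEFin lte_fin prodr_gt0// => i _; rewrite mulrn_wgt0.
Qed.

Lemma measurable_rV_ball x e :
  measurable [set y : 'rV[R]_n | forall i, ball (x 0 i) e (y 0 i)].
Proof.
rewrite (_ : mkset _ = \big[setI/setT]_(i < n)
    ((fun y : 'rV[R]_n => y 0 i) @^-1` (ball (x 0 i) e))).
  apply: bigsetI_measurable => i _; rewrite -[X in measurable X]setTI.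
  by apply: measurable_coord => //; exact: measurable_ball.
rewrite -bigcap_seq; apply/seteqP; split => y /= h i; first by move=> _; apply: h.
by apply: (h i); rewrite /= mem_index_enum.
Qed.

(** If |f| exceeded c at x it would do so on a box around x, and boxes have positive measure. *)
Lemma ae_continuous_le f c x : {for x, continuous f} ->
  (\forall x \ae mu, `|f x| <= c) -> `|f x| <= c.
Proof.
move=> cf [N [mN N0 fN]]; rewrite leNgt; apply/negP => cx.
have : \forall y \near x, c < `|f y|.
  have cf' : f y @[y --> x] --> f x by exact: cf.
  exact: (@cvgr_gt _ _ _ _ _ _ (cvg_norm cf') c cx).
move=> /nbhs_ballP[e e0 he].
have := lebesgue_rV_ball_gt0 x e0; rewrite ltNge => /negP; apply.
rewrite -N0; apply: le_measure; rewrite ?inE//.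
  exact: measurable_rV_ball.
move=> y /= hy; apply: fN => /= yc; have := he y; rewrite /= ltNge yc => /(_ _)/notF; apply.
by split=> // i j; rewrite (ord1 i); exact: hy.
Qed.

(** The L^oo norm unfolds to an essential supremum only when the whole space has positive
    measure. *)
Lemma lebesgue_rV_setT_gt0 : (0 < mu setT)%E.
Proof.
apply: lt_le_trans (lebesgue_rV_ball_gt0 (0 : 'rV[R]_n) (@ltr01 R)) _.
by apply: le_measure; rewrite ?inE//; exact: measurable_rV_ball.
Qed.

Lemma Linfty_norm_ae f c : (Linfty_norm f <= c%:E)%E -> \forall x \ae mu, `|f x| <= c.
Proof.
rewrite /Linfty_norm unlock lebesgue_rV_setT_gt0 => /ess_sup_inf.ess_supP.
by apply: filterS => x /=; rewrite lee_fin.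
Qed.

Lemma Linfty_norm_le f c : 0 <= c -> (forall x, `|f x| <= c) -> (Linfty_norm f <= c%:E)%E.
Proof.
move=> c0 h; rewrite /Linfty_norm unlock; case: ifPn => // _.
by apply/ess_sup_inf.ess_supP; apply: aeW => x; rewrite /= lee_fin h.
Qed.

End Linfty.

Section cut.
Context {R : realType} {n : nat}.
Implicit Types (g : R -> 'rV[R]_n -> R) (s t T K : R) (x : 'rV[R]_n).

(* Truncated in time, the solution and its source are bounded and jointly measurable on the whole of
   R x R^n, as required by [joint_bounded]. *)
Definition time_cut T g s (y : 'rV[R]_n) : R := if (0 < s) && (s <= T) then g s y else 0.

Lemma time_cutE T g s : 0 < s -> s <= T -> time_cut T g s = g s.
Proof. by move=> s0 sT; apply/funext => y; rewrite /time_cut s0 sT. Qed.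

Lemma joint_bounded_cut T g K : 0 <= K ->
  (forall t x, 0 < t -> {for (t, x), continuous (fun z : R * 'rV[R]_n => g z.1 z.2)}) ->
  (forall t x, 0 < t -> t <= T -> `|g t x| <= K) -> joint_bounded (time_cut T g) K.
Proof.
move=> K0 cg gK; split; last first.
  by move=> s y; rewrite /time_cut; case: ifPn; [case/andP; exact: gK|rewrite normr0].
pose A := [set z : measurableTypeR R * 'rV[R]_n | 0 < z.1].
pose B := [set z : measurableTypeR R * 'rV[R]_n | z.1 <= T].
have mA : measurable A.
  rewrite -[A]setTI; have -> : A = fst @^-1` `]0, +oo[.
    by apply/seteqP; split=> z /=; rewrite in_itv/= andbT.
  by apply: measurable_fst => //; exact: measurable_itv.
have mB : measurable B.
  rewrite -[B]setTI; have -> : B = fst @^-1` `]-oo, T].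
    by apply/seteqP; split=> z /=; rewrite in_itv/=.
  by apply: measurable_fst => //; exact: measurable_itv.
have mg : measurable_fun (A `&` B) (fun z : measurableTypeR R * 'rV[R]_n => g z.1 z.2).
  apply: (measurable_funS mA); first exact: subIsetl.
  exact: (@continuous_measurable_prod R n (fun z => g z.1 z.2)).
have := (measurable_restrictT (fun z : measurableTypeR R * 'rV[R]_n => g z.1 z.2) (measurableI _ _ mA mB)).1 mg.
congr measurable_fun; apply/funext => z; rewrite patchE /time_cut.
have -> : (z \in A `&` B) = (0 < z.1 <= T).
  by apply/idP/idP; [rewrite inE => -[/= -> ->]|move=> /andP[? ?]; rewrite inE].
by case: ifP.
Qed.

End cut.

(** * Chain rules from partial derivatives *)

Section several_variables.
Context {R : realType} {n : nat}.
Implicit Types (g : 'rV[R]_n -> R) (x y z : 'rV[R]_n) (r s t : R).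

Lemma is_derive_lip (phi : R -> R) (l M r : R) : is_derive r 1 phi l ->
  (forall k, `|phi (k + r) - phi r| <= M * `|k|) -> `|l| <= M.
Proof.
move=> d h; have i0 m : 0 < m.+1%:R^-1 :> R by rewrite invr_gt0.
have c := seq_is_derive d (fun m => lt0r_neq0 (i0 m)) cvg_inv_succ.
apply: (cvg_le_cst (cvg_norm c)).
apply: nearW => m; rewrite normrM normfV ler_pdivrMr ?normr_gt0 ?invr_eq0 ?pnatr_eq0//.
Qed.

(** The coordinates of y are switched on one at a time; each step is a one-variable mean value
    theorem, and the intermediate points converge to z, where the partial derivatives are
    continuous. *)
Lemma cvg_directional g z y (e : nat -> R) :
  (forall i x, derivable g x (unit_vec i)) ->
  (forall i, {for z, continuous (fun x => 'D_(unit_vec i) g x)}) ->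
  (forall m, e m != 0) -> e m @[m --> \oo] --> 0 ->
  (g (z + e m *: y) - g z) / e m @[m --> \oo] --> \sum_(i < n) y 0 i * 'D_(unit_vec i) g z.
Proof.
move=> dg cg e0 ec.
suff H (s : seq 'I_n) :
    (g (z + e m *: (\sum_(i <- s) y 0 i *: unit_vec i)) - g z) / e m @[m --> \oo] -->
    \sum_(i <- s) y 0 i * 'D_(unit_vec i) g z.
  have := H (index_enum 'I_n); suff -> : \sum_(i < n) y 0 i *: unit_vec i = y by [].
  by rewrite [RHS]matrix_sum_delta big_ord1; apply: eq_bigr.
elim: s => [|i s IH].
  rewrite !big_nil; under eq_fun do rewrite scaler0 addr0 subrr mul0r.
  exact: cvg_cst.
rewrite big_cons.
pose q m := z + e m *: (\sum_(j <- s) y 0 j *: unit_vec j).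
have /boolp.choice[c hc] : forall m : nat, exists c : R, `|c| <= `|e m * y 0 i| /\
    g (q m + (e m * y 0 i) *: unit_vec i) - g (q m) =
    'D_(unit_vec i) g (q m + c *: unit_vec i) * (e m * y 0 i).
  move=> m.
  have [c hc E] := @MVT_between R (fun r => g (q m + r *: unit_vec i))
    (fun r => 'D_(unit_vec i) g (q m + r *: unit_vec i)) 0 (e m * y 0 i)
    (fun r _ => is_derive_line (dg _ _)).
  exists c; rewrite scale0r addr0 subr0 in E; split=> //.
  move: hc; have [le0|le0] := leP 0 (e m * y 0 i).
    by move=> /andP[c0 cE]; rewrite !ger0_norm.
  by move=> /andP[cE c0]; rewrite (ler0_norm c0) (ltr0_norm le0) lerN2.
have c0 : c m @[m --> \oo] --> 0.
  apply/cvgr0Pnorm_le => d d0.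
  have : e m * y 0 i @[m --> \oo] --> 0.
    by rewrite -(mul0r (y 0 i)); apply: cvgM => //; exact: cvg_cst.
  move/cvgr0Pnorm_le => /(_ d d0); apply: filterS => m; apply: le_trans.
  by case: (hc m).
have qz : q m + c m *: unit_vec i @[m --> \oo] --> z.
  apply: cvg_rV => j; set v := \sum_(j <- s) y 0 j *: unit_vec j.
  rewrite -[X in _ --> X]addr0 -[X in _ --> X + _]addr0.
  rewrite -[X in _ --> _ + X](mul0r (unit_vec i 0 j)) -[X in _ --> _ + X + _](mul0r (v 0 j)).
  under eq_fun do rewrite 4!mxE.
  apply: cvgD; [apply: cvgD; first exact: cvg_cst|]; apply: cvgM => //; exact: cvg_cst.
apply: (cvg_trans (G := y 0 i * 'D_(unit_vec i) g (q m + c m *: unit_vec i) +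
   (g (q m) - g z) / e m @[m --> \oo])).
  apply: near_eq_cvg; apply: nearW => m.
  rewrite -[LHS]/(y 0 i * 'D_(unit_vec i) g (q m + c m *: unit_vec i) + (g (q m) - g z) / e m).
  have -> : z + e m *: (y 0 i *: unit_vec i + \sum_(j <- s) y 0 j *: unit_vec j) =
      q m + (e m * y 0 i) *: unit_vec i.
    by rewrite scalerDr scalerA addrA addrAC.
  have [_ E] := hc m.
  set D := 'D_(unit_vec i) g _ in E *.
  have -> : y 0 i * D = D * (e m * y 0 i) / e m by field.
  by rewrite -mulrDl -E; congr (_ / _); exact: subrKA.
rewrite big_cons; apply: cvgD; last exact: IH.
apply: cvgM; first exact: cvg_cst.
exact: (cvg_comp _ _ qz (cg i)).
Qed.

Lemma is_derive_directional g z y r :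
  (forall i x, derivable g x (unit_vec i)) ->
  (forall i, {for z + r *: y, continuous (fun x => 'D_(unit_vec i) g x)}) ->
  is_derive r 1 (fun r => g (z + r *: y)) (\sum_(i < n) y 0 i * 'D_(unit_vec i) g (z + r *: y)).
Proof.
move=> dg cg; apply: is_derive_seq => e e0 ec.
have := cvg_directional dg cg e0 ec (y := y).
apply: cvg_trans; apply: near_eq_cvg; apply: nearW => m.
by rewrite scalerDl [e m *: y + _]addrC addrA.
Qed.

(** Chain rule along a curve on which time and space move together. The increment is split at a
    fixed time: the time part uses the mean value theorem and the joint continuity of [ut], the
    space part is [is_derive_directional]. *)
Lemma is_derive_time_space (u ut : R -> 'rV[R]_n -> R) (tau rho : R -> R) z y (s dtau drho : R) :
  (\forall r \near (tau s : R), forall x, is_derive (r : R) 1 (u ^~ x) (ut r x)) ->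
  {for (tau s, z + rho s *: y), continuous (fun q : R * 'rV[R]_n => ut q.1 q.2)} ->
  (forall i x, derivable (u (tau s)) x (unit_vec i)) ->
  (forall i, {for z + rho s *: y, continuous (fun x => 'D_(unit_vec i) (u (tau s)) x)}) ->
  is_derive s 1 tau dtau -> is_derive s 1 rho drho ->
  is_derive s 1 (fun s => u (tau s) (z + rho s *: y))
    (ut (tau s) (z + rho s *: y) * dtau +
     drho * \sum_(i < n) y 0 i * 'D_(unit_vec i) (u (tau s)) (z + rho s *: y)).
Proof.
move=> dt cut dx cdx dtau' drho'; apply: is_derive_seq => e e0 ec.
have [d d0 hd] : exists2 d : R, 0 < d & forall r, `|r - tau s| < d -> forall x, is_derive r 1 (u ^~ x) (ut r x).
  move/nbhs_ballP : dt => [d d0 hd]; exists d => // r rd; apply: hd.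
  by rewrite /= /ball/= distrC.
have es : e m + s @[m --> \oo] --> s.
  by rewrite -[X in _ --> X]add0r; apply: cvgD => //; exact: cvg_cst.
have taus : tau (e m + s) @[m --> \oo] --> tau s.
  exact: (cvg_comp _ _ es (is_derive_continuous dtau')).
have rhos : rho (e m + s) @[m --> \oo] --> rho s.
  exact: (cvg_comp _ _ es (is_derive_continuous drho')).
have [N hN] : exists N, forall m, `|tau (e (m + N)%N + s) - tau s| < d.
  move/cvgrPdist_lt : (taus) => /(_ _ d0)[N _ hN]; exists N => m.
  by rewrite distrC; apply: hN; exact: leq_addl.
pose xi m := z + rho (e m + s) *: y.
have /boolp.choice[c hc] : forall m : nat, exists c : R, `|c - tau s| <= `|tau (e (m + N)%N + s) - tau s| /\
    u (tau (e (m + N)%N + s)) (xi (m + N)%N) - u (tau s) (xi (m + N)%N) =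
    ut c (xi (m + N)%N) * (tau (e (m + N)%N + s) - tau s).
  move=> m; set b := tau (e _ + s).
  have seg (r : R) : Num.min (tau s) b <= r <= Num.max (tau s) b -> `|r - tau s| <= `|b - tau s|.
    have [le0|le0] := leP (tau s) b => /andP[c0 cE].
      by rewrite !ger0_norm ?subr_ge0// lerB.
    by rewrite !ler0_norm ?subr_le0 ?lerN2 ?lerB// ltW.
  have [|r hr E] := @MVT_between R (u ^~ (xi (m + N)%N)) (ut ^~ (xi (m + N)%N)) (tau s) b.
    by move=> r /seg rb; apply: hd; exact: le_lt_trans rb (hN m).
  by exists r; split=> //; exact: seg.
have tauN : tau (e (m + N)%N + s) @[m --> \oo] --> tau s.
  by rewrite (cvg_shiftn N (fun m => tau (e m + s))).
have cs : c m @[m --> \oo] --> tau s.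
  apply/cvgrPdist_le => d1 d10.
  move/cvgrPdist_le : tauN => /(_ _ d10); apply: filterS => m; rewrite distrC => h.
  by rewrite distrC; apply: le_trans h; case: (hc m).
have xis : xi (m + N)%N @[m --> \oo] --> z + rho s *: y.
  rewrite (cvg_shiftn N xi); apply: cvg_rV => j; under eq_fun do rewrite 2!mxE.
  rewrite 2!mxE; apply: cvgD; first exact: cvg_cst.
  by apply: cvgM => //; exact: cvg_cst.
rewrite -(cvg_shiftn N).
apply: (cvg_trans (G := ut (c m) (xi (m + N)%N) *
    ((tau (e (m + N)%N + s) - tau s) / e (m + N)%N) +
    (u (tau s) (z + rho (e (m + N)%N + s) *: y) - u (tau s) (z + rho s *: y)) / e (m + N)%N @[m --> \oo])).
  apply: near_eq_cvg; apply: nearW => m.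
  rewrite -[RHS]/((u (tau (e (m + N)%N + s)) (xi (m + N)%N) - u (tau s) (z + rho s *: y)) / e (m + N)%N).
  have [_ E] := hc m.
  by rewrite mulrA -mulrDl -E; congr (_ / _); exact: subrKA.
apply: cvgD.
  apply: cvgM; first exact: (cvg_comp _ _ (cvg_pair cs xis) cut).
  rewrite (cvg_shiftn N (fun m => (tau (e m + s) - tau s) / e m)).
  exact: (seq_is_derive dtau' e0 ec).
rewrite (cvg_shiftn N (fun m => (u (tau s) (z + rho (e m + s) *: y) - u (tau s) (z + rho s *: y)) / e m)).
have d2 := @is_derive1_comp _ (fun r => u (tau s) (z + r *: y)) rho s _ _
  (is_derive_directional dx cdx) drho'.
have := seq_is_derive d2 e0 ec; rewrite mulrC; exact.
Qed.

Lemma line_is_derive g z e l :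
  is_derive (0 : R) 1 (fun r => g (z + r *: e)) l -> is_derive z e g l.
Proof.
have E : (fun h : R => h^-1 *: (((fun r => g (z + r *: e)) \o shift 0) (h *: (1 : R)) - g (z + 0 *: e))) =
   (fun h : R => h^-1 *: ((g \o shift z) (h *: e) - g z)).
  apply/funext => h /=; rewrite scale0r !addr0; congr (_ *: (g _ - _)).
  by rewrite [h%:A]mulr1 addrC.
by case; rewrite /derivable /derive E => dg <-; exact: DeriveDef.
Qed.

Lemma is_derive_affine g a c y e : derivable g (a + c *: y) e ->
  is_derive y e (fun y => g (a + c *: y)) (c * 'D_e g (a + c *: y)).
Proof.
move=> dg; apply: line_is_derive.
have -> : (fun r => g (a + c *: (y + r *: e))) =
    (fun r => g ((a + c *: y) + r *: e)) \o (fun r => c * r).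
  by apply/funext => r /=; rewrite scalerDr scalerA addrA.
have d1 := @is_derive_line R n g (a + c *: y) e (c * 0).
rewrite mulr0 scale0r addr0 in d1.
have d2 : is_derive (0 : R) 1 (fun r => c * r) c.
  by apply: is_derive_eq; rewrite /GRing.scale/=; ring.
rewrite mulrC; have := @is_derive1_comp _ (fun r => g ((a + c *: y) + r *: e)) (fun r => c * r) 0 _ _ _ d2.
by apply; rewrite mulr0; exact: d1.
Qed.

End several_variables.

(** * Bounds on the solution and passage to similarity variables *)

Section solution.
Context {R : realType} {n : nat}.
Variables (p : R) (u0 : 'rV[R]_n -> R) (u : R -> 'rV[R]_n -> R).
Hypothesis p1 : 1 < p.
Hypothesis hu0 : u0 \in Lfun (lebesgue_rV n) +oo%E.
Hypothesis hu : classical_solution p u0 +oo%E u.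
Local Notation mu := (@lebesgue_rV R n).
Local Notation leb := (@lebesgue_measure R).
Local Notation f := (power_nonlinearity p).
Implicit Types (s t T B : R) (x y : 'rV[R]_n).

(** u0 is only essentially bounded. Setting it to 0 on the exceptional null set gives an everywhere
    bounded function with the same integrals against every measurable kernel. *)
Lemma initial_truncation : exists (v0 : 'rV[R]_n -> R) (K : R), [/\ measurable_fun setT v0,
  forall z, `|v0 z| <= K & forall k : 'rV[R]_n -> R, measurable_fun setT k ->
    \int[mu]_y (k y * u0 y) = \int[mu]_y (k y * v0 y)].
Proof.
move: hu0; rewrite inE => /andP[/=]; rewrite inE/= => mu0; rewrite inE/= => /= fin.
have [M0 M1] : (0 <= Linfty_norm u0 /\ Linfty_norm u0 < +oo)%E by split => //; exact: Lnorm_ge0.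
pose M := fine (Linfty_norm u0).
have ME : Linfty_norm u0 = M%:E by rewrite fineK// ge0_fin_numE.
have ae : \forall x \ae mu, `|u0 x| <= M by apply: Linfty_norm_ae; rewrite ME.
pose v0 z := if `|u0 z| <= M then u0 z else 0.
have mv : measurable_fun setT v0.
  apply: measurable_fun_ifT => //.
  by apply: measurable_fun_ler => //; exact: measurableT_comp.
have MM : 0 <= M by rewrite fine_ge0.
exists v0, M; split => //.
  by move=> z; rewrite /v0; case: ifPn => //; rewrite normr0.
move=> k mk; rewrite /Rintegral; congr fine.
apply: ae_eq_integral => //.
- by apply/measurable_EFinP; exact: measurable_funM.
- by apply/measurable_EFinP; exact: measurable_funM.
by apply: filterS ae => y h _; rewrite /= /v0 h.
Qed.

Lemma solution_continuous t x : 0 < t ->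
  {for (t, x), continuous (fun z : R * 'rV[R]_n => u z.1 z.2)}.
Proof.
by case: hu => _ _ h _ _ t0; case: (h t x t0 (ltry _)).
Qed.

Lemma continuous_slice (g : R -> 'rV[R]_n -> R) t x :
  {for (t, x), continuous (fun z : R * 'rV[R]_n => g z.1 z.2)} -> {for x, continuous (g t)}.
Proof.
move=> cg; have h1 : (fun _ : 'rV[R]_n => t) @ nbhs x --> t by exact: cvg_cst.
have h2 : (fun y : 'rV[R]_n => y) @ nbhs x --> x by exact: cvg_id.
exact: (cvg_comp _ _ (cvg_pair h1 h2) cg).
Qed.

(** The definition of a solution bounds essential suprema; continuity at positive times makes the
    bound pointwise. *)
Lemma solution_bounded T : exists2 B, 0 <= B &
  forall t x, 0 < t -> t <= T -> `|u t x| <= B.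
Proof.
case: hu => _ _ _ hb _.
have := hb (Num.max T 0) (ltry _); set S := ereal_sup _ => Sfin.
have S0 : (0 <= S)%E.
  apply: le_trans (_ : Linfty_norm (u 0) <= _)%E; first exact: Lnorm_ge0.
  by apply: ereal_sup_ubound; exists 0 => //=; rewrite in_itv/= lexx le_max lexx orbT.
exists (fine S); first by rewrite fine_ge0.
move=> t x t0 tT; apply: ae_continuous_le.
  exact: (@continuous_slice u t x (@solution_continuous t x t0)).
apply: Linfty_norm_ae; rewrite fineK ?ge0_fin_numE//.
by apply: ereal_sup_ubound; exists t => //=; rewrite in_itv/= ltW//= le_max tT.
Qed.

Definition source T s y := f (time_cut T u s y).

Lemma joint_bounded_solution T B : 0 <= B -> (forall t x, 0 < t -> t <= T -> `|u t x| <= B) ->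
  joint_bounded (time_cut T u) B.
Proof. by move=> B0 uB; apply: joint_bounded_cut => // t x t0; exact: solution_continuous. Qed.

Lemma joint_bounded_source T B : joint_bounded (time_cut T u) B ->
  joint_bounded (source T) (B `^ p).
Proof.
move=> [mU UB]; split; last by move=> s y; exact: power_bound.
exact: (measurableT_comp (measurable_power p) mU).
Qed.

Lemma Rintegral_itvcc_co (g : R -> R) (b : R) : measurable_fun `]0, b[ g ->
  \int[leb]_(s in `[0, b]) g s = \int[leb]_(s in `]0, b[) g s.
Proof.
move=> mg; rewrite /Rintegral; congr fine.
rewrite -integral_itv_bndo_bndc; last first.
  by apply/measurable_EFinP; rewrite -measurable_fun_itv_obnd_cbndP.
by rewrite -integral_itv_obnd_cbnd//; exact/measurable_EFinP.
Qed.

Lemma solution_duhamel T v0 b x :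
  (forall k : 'rV[R]_n -> R, measurable_fun setT k -> \int[mu]_y (k y * u0 y) = \int[mu]_y (k y * v0 y)) ->
  0 < b -> b <= T ->
  time_cut T u b x = heat_convolution b v0 x + \int[leb]_(s in `[0, b[) propag b (source T) s x.
Proof.
move=> v0E b0 bT; have [B B0 uB] := solution_bounded T.
have jU := joint_bounded_solution B0 uB; have jF := joint_bounded_source jU.
rewrite time_cutE//; case: hu => _ _ _ _ /(_ b x b0 (ltry _)) ->.
rewrite /heat_convolution v0E; last exact: measurable_heat_kernel_l.
congr (_ + _).
(* The integrands are compared on the open interval: at s = 0 the cut source vanishes, and at s = b
   the kernel degenerates. *)
have E s : `]0, b[%classic s ->
    heat_convolution (b - s) (fun y => f (u s y)) x = propag b (source T) s x.
  rewrite /= in_itv/= => /andP[s0 sb]; rewrite (propagE jF sb).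
  by congr heat_convolution; apply/funext => y; rewrite /source time_cutE// (le_trans (ltW sb)).
have mp : measurable_fun setT (fun s : R => propag b (source T) s x).
  by apply: (measurable_joint_comp (joint_bounded_propag b jF).1) => //; exact: measurable_cst.
rewrite Rintegral_itvcc_co; last first.
  apply: (eq_measurable_fun (fun s => propag b (source T) s x)); last exact: measurable_funTS.
  by move=> s; rewrite inE => /E.
transitivity (\int[leb]_(s in `]0, b[) propag b (source T) s x).
  by apply: eq_Rintegral => s; rewrite inE => /E.
rewrite /Rintegral; congr fine; rewrite -integral_itv_obnd_cbnd//.
by apply/measurable_EFinP; exact: measurable_funTS.
Qed.

Lemma solution_mild T m : 0 < m -> mild (time_cut T u) (source T) m T.
Proof.
move=> m0; have [B B0 uB] := solution_bounded T.
have jF := joint_bounded_source (joint_bounded_solution B0 uB).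
have [v0 [K [mv0 v0K v0E]]] := initial_truncation.
apply: (mild_restart jF mv0 v0K _ m0) => b x b0 bT.
exact: solution_duhamel.
Qed.

Lemma mild_eq_source (v F F' : R -> 'rV[R]_n -> R) (t1 t2 : R) : mild v F t1 t2 ->
  (forall s y, t1 <= s -> s < t2 -> F s y = F' s y) -> mild v F' t1 t2.
Proof.
move=> mv FF a b x t1a ab bt2; rewrite (mv a b x t1a ab bt2); congr (_ + _).
apply: eq_Rintegral => s; rewrite inE/= in_itv/= => /andP[as' sb].
apply: eq_gexp => z; apply: FF; first exact: le_trans as'.
exact: lt_le_trans bt2.
Qed.

Lemma solution_derivable i t x : 0 < t -> derivable (u t) x (unit_vec i).
Proof. by case: hu => _ _ h _ _ t0; case: (h t x t0 (ltry _)) => _ _ /(_ i)[]. Qed.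

Lemma solution_derivable2 i t x : 0 < t ->
  derivable ('D_(unit_vec i) (u t)) x (unit_vec i).
Proof. by case: hu => _ _ h _ _ t0; case: (h t x t0 (ltry _)) => _ _ _ /(_ i i)[]. Qed.

Lemma sqrt_scale_le (a b m T K V : R) : 0 < m -> m <= b - a -> b - a <= T -> 0 <= K -> 0 <= V ->
  V / Num.sqrt (b - a) + K * Num.sqrt (b - a) <= V / Num.sqrt m + K * Num.sqrt T.
Proof.
move=> m0 mb bT K0 V0; have b0 := lt_le_trans m0 mb.
apply: lerD; apply: ler_wpM2l => //; last by rewrite ler_wsqrtr.
by rewrite lef_pV2 ?posrE ?sqrtr_gt0// ler_wsqrtr.
Qed.

Lemma solution_lip m T : 0 < m -> exists2 K, 0 <= K &
  forall i t x k, m <= t -> t <= T -> `|u t (x + k *: unit_vec i) - u t x| <= K * `|k|.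
Proof.
move=> m0; have [B B0 uB] := solution_bounded T.
have jU := joint_bounded_solution B0 uB; have jF := joint_bounded_source jU.
have [C C0 hC] := @mild_lip R n.
have m20 : 0 < m / 2 by rewrite divr_gt0.
have sm : mild (time_cut T u) (source T) (m / 2) T by exact: solution_mild.
exists (C * (B / Num.sqrt (m / 2) + B `^ p * Num.sqrt T)).
  by rewrite mulr_ge0// addr_ge0// mulr_ge0 ?powR_ge0.
move=> i t x k mt tT; have t0 : 0 < t by exact: lt_le_trans mt.
have mt2 : m / 2 < t by lra.
have h := @hC _ _ _ B (m / 2) T (m / 2) t i k x sm jF (lexx (m / 2)) mt2 tT
  (joint_bounded_slice (m / 2) jU) (jU.2 (m / 2)).
rewrite !time_cutE// in h; apply: (le_trans h).
rewrite mulrAC ler_wpM2r// ler_wpM2l//; apply: sqrt_scale_le => //; [lra|lra|exact: powR_ge0].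
Qed.

Lemma solution_grad_bound m T : 0 < m -> exists2 K, 0 <= K &
  forall i t x, m <= t -> t <= T -> `|'D_(unit_vec i) (u t) x| <= K.
Proof.
move=> m0; have [K K0 h] := solution_lip T m0; exists K => // i t x mt tT.
have t0 : 0 < t by exact: lt_le_trans mt.
have d := @is_derive_line R n (u t) x (unit_vec i) 0.
rewrite scale0r addr0 in d; apply: (is_derive_lip (d (@solution_derivable i t x t0))) => k.
by rewrite addr0 scale0r addr0; exact: h.
Qed.

(** The increment of u by h e_i is mild, and by the Lipschitz bound its size and that of its source
    are O(|h|). Applying [mild_lip] to it bounds second differences by K |h| |k|; dividing by k and
    then by h gives the claim. *)
Lemma solution_hess_bound m T : 0 < m -> exists2 K, 0 <= K &
  forall i t x, m <= t -> t <= T -> `|'D_(unit_vec i) ('D_(unit_vec i) (u t)) x| <= K.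
Proof.
move=> m0; have [B B0 uB] := solution_bounded T.
have jU := joint_bounded_solution B0 uB; have jF := joint_bounded_source jU.
have m20 : 0 < m / 2 by rewrite divr_gt0.
have sm : mild (time_cut T u) (source T) (m / 2) T by exact: solution_mild.
have [M M0 lipM] := solution_lip T m20.
have [C C0 hC] := @mild_lip R n.
pose L := p * B `^ (p - 1).
have L0 : 0 <= L by rewrite mulr_ge0 ?powR_ge0// ltW// (lt_trans ltr01).
pose K := C * (M / Num.sqrt (m / 2) + L * M * Num.sqrt T).
have K0 : 0 <= K.
  apply: mulr_ge0 => //; apply: addr_ge0; first by rewrite divr_ge0 ?sqrtr_ge0.
  by apply: mulr_ge0; [exact: mulr_ge0|exact: sqrtr_ge0].
exists K => // i t x mt tT; have t0 : 0 < t by exact: lt_le_trans mt.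
pose e := @unit_vec R n i.
have ULip s y h : m / 2 <= s -> `|time_cut T u s (y + h *: e) - time_cut T u s y| <= M * `|h|.
  move=> ms; have [sT|Ts] := leP s T; first by rewrite time_cutE ?lipM// (lt_le_trans m20).
  by rewrite /time_cut (leNgt s) Ts andbF subrr normr0 mulr_ge0.
have ULip2 (h k : R) (z : 'rV[R]_n) :
    `|(u t (z + k *: e + h *: e) - u t (z + k *: e)) - (u t (z + h *: e) - u t z)| <=
    (K * `|h|) * `|k|.
  pose v s y := time_cut T u s (y + h *: e) - time_cut T u s y.
  pose F s y := source T s (y + h *: e) - source T s y.
  (* No Lipschitz bound holds before m / 2, so the source is frozen there. The formula on [m / 2, T]
     does not see the change, and F' is bounded for all times. *)
  pose F' s y := F (Num.max (m / 2) s) y.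
  have mv : mild v F' (m / 2) T.
    apply: (mild_eq_source (F := F)); last first.
      by move=> s y ms _; rewrite /F' (max_idPr ms).
    apply: (mild_shiftB (V := fun=> B) (h *: e) sm jF).
      by move=> s _ _; exact: joint_bounded_slice jU.
    by move=> s y _ _; case: jU => _; apply.
  have jF' : joint_bounded F' (L * M * `|h|).
    split; last first.
      move=> s y; apply: le_trans (power_lip p1 (jU.2 _ _) (jU.2 _ _)) _.
      by rewrite -(mulrA L) ler_wpM2l// ULip// le_max lexx.
    have mmax : measurable_fun setT (fun z : measurableTypeR R * 'rV[R]_n => Num.max (m / 2) z.1).
      by apply: measurable_maxr => //; exact: measurable_fst.
    apply: measurable_funB; last exact: (measurable_joint_comp jF.1 mmax measurable_snd).
    exact: (measurable_joint_comp (joint_bounded_shift (h *: e) jF).1 mmax measurable_snd).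
  have mt2 : m / 2 < t by lra.
  have mv2 : measurable_fun setT (v (m / 2)).
    apply: measurable_funB; last exact: joint_bounded_slice jU.
    have := measurable_comp_affine (h *: e) 1 (joint_bounded_slice (m / 2) jU).
    by under eq_fun do rewrite scale1r addrC.
  have hh := @hC v F' _ (M * `|h|) (m / 2) T (m / 2) t i k z mv jF' (lexx (m / 2)) mt2 tT mv2
    (fun y => ULip (m / 2) y h (lexx (m / 2))).
  rewrite /v !time_cutE// in hh; apply: (le_trans hh).
  rewrite (_ : _ * (_ + _) = C * (M / Num.sqrt (t - m / 2) + L * M * Num.sqrt (t - m / 2)) * `|h| * `|k|); last by ring.
  rewrite ler_wpM2r// ler_wpM2r// ler_wpM2l//.
  by apply: sqrt_scale_le => //; [lra|lra|exact: mulr_ge0].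
have d z := @is_derive_line R n (u t) z e 0.
have lipD h z : `|'D_e (u t) (z + h *: e) - 'D_e (u t) z| <= K * `|h|.
  have d1 := d (z + h *: e); have d2 := d z.
  rewrite scale0r addr0 in d1; rewrite scale0r addr0 in d2.
  have d3 := is_deriveB (d1 (@solution_derivable i t _ t0)) (d2 (@solution_derivable i t _ t0)).
  apply: (is_derive_lip d3) => k; rewrite addr0 !fctE scale0r !addr0.
  have -> : z + h *: e + k *: e = z + k *: e + h *: e by rewrite addrAC.
  exact: ULip2.
have d2 := @is_derive_line R n ('D_e (u t)) x e 0.
rewrite scale0r addr0 in d2; apply: (is_derive_lip (d2 (@solution_derivable2 i t x t0))) => k.
by rewrite addr0 scale0r addr0; exact: lipD.
Qed.
Local Notation beta := ((p - 1)^-1).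
Implicit Types (a : 'rV[R]_n).

Lemma solution_spec t x : 0 < t ->
  [/\ {for (t, x), continuous (fun z : R * 'rV[R]_n => u z.1 z.2)},
      derivable (u ^~ x) t 1 /\
      {for (t, x), continuous (fun z : R * 'rV[R]_n => derive1 (u ^~ z.2) z.1)},
      forall i, derivable (u t) x (delta_mx 0 i) /\
      {for (t, x), continuous (fun z : R * 'rV[R]_n => partial i (u z.1) z.2)},
      forall i j, derivable (partial i (u t)) x (delta_mx 0 j) /\
      {for (t, x), continuous
         (fun z : R * 'rV[R]_n => partial j (partial i (u z.1)) z.2)} &
      derive1 (u ^~ x) t - laplacian (u t) x = f (u t x)].
Proof. by case: hu => _ _ h _ _ t0; exact: h (ltry _). Qed.

Definition rescaled T a s y := expR (- (beta * s)) * u (T - expR (- s)) (a + expR (- (s / 2)) *: y).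
Definition rescaled_x T a i s y := expR (- ((beta + 2^-1) * s)) *
  'D_(unit_vec i) (u (T - expR (- s))) (a + expR (- (s / 2)) *: y).
Definition rescaled_xx T a i s y := expR (- ((beta + 1) * s)) *
  'D_(unit_vec i) ('D_(unit_vec i) (u (T - expR (- s)))) (a + expR (- (s / 2)) *: y).
(** Defined as the right-hand side of the rescaled equation. That equation is thus immediate, and
    what has to be proved is that this is the derivative of [rescaled] in s. *)
Definition rescaled_t T a s y :=
  \sum_(i < n) (rescaled_xx T a i s y - y 0 i / 2 * rescaled_x T a i s y) -
  beta * rescaled T a s y + f (rescaled T a s y).

Let expR_scale_le (c s sg v B : R) : 0 <= c -> sg < s -> `|v| <= B ->
  `|expR (- (c * s)) * v| <= expR (- (c * sg)) * B.
Proof.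
move=> c0 ss vB; rewrite normrM (ger0_norm (expR_ge0 _)); apply: ler_pM => //.
by rewrite ler_expR lerN2 ler_wpM2l// ltW.
Qed.

Let cvg_scale (k : R -> R) s a y : k r @[r --> s] --> k s ->
  a + k r *: y @[r --> s] --> a + k s *: y.
Proof.
move=> kc; apply: cvg_rV => j; rewrite 2!mxE; under eq_fun do rewrite 2!mxE.
by apply: cvgD; [exact: cvg_cst|apply: cvgM => //; exact: cvg_cst].
Qed.

Let dexp (c s : R) : is_derive s 1 (fun s => expR (- (c * s))) (- c * expR (- (c * s))).
Proof.
have d2 : is_derive s 1 (fun s => - (c * s)) (- c).
  by apply: is_derive_eq; rewrite /GRing.scale/=; ring.
rewrite mulrC.
exact: (@is_derive1_comp _ expR (fun s => - (c * s)) s _ _ (is_derive_expR _) d2).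
Qed.

Let dtau T s : is_derive s 1 (fun s => T - expR (- s)) (expR (- s)).
Proof.
have := is_deriveB (is_derive_cst T s 1) (dexp 1 s).
rewrite !mul1r sub0r mulN1r opprK => h.
have -> : (fun s => T - expR (- s)) = (fun=> T) - (fun s => expR (- (1 * s))).
  apply/funext => r; rewrite -[RHS]/(T - expR (- (1 * r))); by rewrite mul1r.
exact: h.
Qed.

Let drho s : is_derive s 1 (fun s => expR (- (s / 2))) (- 2^-1 * expR (- (s / 2))).
Proof.
have := dexp 2^-1 s; rewrite (mulrC _ s).
by have -> : (fun s => expR (- (2^-1 * s))) = (fun s => expR (- (s / 2))) by apply/funext => r; rewrite mulrC.
Qed.

Lemma powerZ c v : 0 < c -> f (c * v) = c `^ p * f v.
Proof.
move=> c0; rewrite /power_nonlinearity normrM (gtr0_norm c0) powRM// ?ltW//.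
have -> : c `^ p = c `^ (p - 1) * c.
  rewrite -[X in _ = _ * X]powRr1 ?ltW// -powRD ?subrK//.
  by rewrite (gt_eqF c0) implybT.
ring.
Qed.

Let powR_expR (c d : R) : expR c `^ d = expR (d * c).
Proof. by rewrite mulrC expRM. Qed.

Let continuous_scaled (g : R -> 'rV[R]_n -> R) c T a s y :
  {for (T - expR (- s), a + expR (- (s / 2)) *: y), continuous (fun z : R * 'rV[R]_n => g z.1 z.2)} ->
  expR (- (c * r)) * g (T - expR (- r)) (a + expR (- (r / 2)) *: y) @[r --> s] -->
  expR (- (c * s)) * g (T - expR (- s)) (a + expR (- (s / 2)) *: y).
Proof.
move=> cg; apply: cvgM; first exact: (is_derive_continuous (dexp c s)).
have h1 : T - expR (- r) @[r --> s] --> T - expR (- s) by exact: (is_derive_continuous (dtau T s)).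
have h2 : a + expR (- (r / 2)) *: y @[r --> s] --> a + expR (- (s / 2)) *: y.
  exact: (@cvg_scale (fun r => expR (- (r / 2))) s a y (is_derive_continuous (drho s))).
exact: (cvg_comp _ _ (cvg_pair h1 h2) cg).
Qed.

(** The similarity time s > - ln (T - t0) corresponds to t = T - e^{-s} in (t0, T), where u and its
    derivatives are bounded; the rescaling factors are largest at the left end. *)
Lemma solution_flow T a t0 : 0 < t0 -> t0 < T ->
  exists K, rescaled_flow p (- ln (T - t0)) K (rescaled T a) (rescaled_t T a)
    (rescaled_x T a) (rescaled_xx T a).
Proof.
move=> t00 t0T; set sg := - ln (T - t0).
have p10 : 0 < p - 1 by rewrite subr_gt0.
have b0 : 0 <= beta by rewrite invr_ge0 ltW.
have [B B0 uB] := solution_bounded T.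
have [K1 K10 h1] := solution_grad_bound T t00.
have [K2 K20 h2] := solution_hess_bound T t00.
pose KK := expR (- (beta * sg)) * B + expR (- ((beta + 2^-1) * sg)) * K1 +
  expR (- ((beta + 1) * sg)) * K2.
have tt s : sg < s -> t0 < T - expR (- s) < T.
  move=> ss; rewrite ltrBlDr ltrDl expR_gt0 andbT ltrBrDr -ltrBrDl.
  by rewrite -[ltRHS]lnK ?posrE ?subr_gt0// ltr_expR ltrNl.
have tp s : sg < s -> 0 < T - expR (- s).
  by move=> /tt/andP[t1 _]; exact: lt_trans t1.
have mslice (g : R -> 'rV[R]_n -> R) c s : sg < s ->
    (forall x, {for (T - expR (- s), x), continuous (fun z : R * 'rV[R]_n => g z.1 z.2)}) ->
    measurable_fun setT (fun y => expR (- (c * s)) * g (T - expR (- s)) (a + expR (- (s / 2)) *: y)).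
  move=> ss cg; apply: measurable_funM => //; apply: measurable_comp_affine.
  by apply: continuous_measurable_rV => x; exact: (continuous_slice (cg x)).
exists KK; split.
- move=> s y ss; set x := a + expR (- (s / 2)) *: y.
  have [_ [dt cdt] dx dxx eqn] := solution_spec x (tp s ss).
  have dnear : \forall r \near (T - expR (- s) : R), forall z, is_derive (r : R) 1 (u ^~ z) (derive1 (u ^~ z) r).
    apply: filterS (@cvgr_gt _ _ _ _ id _ cvg_id 0 (tp s ss)) => r r0 z.
    have [_ [dr _] _ _ _] := solution_spec z r0.
    by rewrite derive1E; exact: DeriveDef.
  have cx i : {for x, continuous (fun x => 'D_(unit_vec i) (u (T - expR (- s))) x)}.
    by apply: (@continuous_slice (fun t => 'D_(unit_vec i) (u t))); have [] := dx i.
  have d2 := @is_derive_time_space R n u (fun r z => derive1 (u ^~ z) r) (fun s => T - expR (- s))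
    (fun s => expR (- (s / 2))) a y s _ _ dnear cdt
    (fun i x => @solution_derivable i _ x (tp s ss)) cx (dtau T s) (drho s).
  have d1 := is_deriveM (dexp beta s) d2.
  apply: (is_derive_eq d1).
  rewrite /GRing.scale/= /rescaled_t /rescaled powerZ ?expR_gt0// powR_expR -/x.
  have {}eqn : derive1 (u ^~ x) (T - expR (- s)) =
      f (u (T - expR (- s)) x) + \sum_(i < n) 'D_(unit_vec i) ('D_(unit_vec i) (u (T - expR (- s)))) x.
    by rewrite -eqn /laplacian subrK.
  rewrite eqn sumrB.
  (* This is p beta = beta + 1: the nonlinearity scales like the time derivative. *)
  have e1 : expR (p * - (beta * s)) = expR (- (beta * s)) * expR (- s).
    by rewrite -expRD; congr expR; field; rewrite gt_eqF.
  have -> : \sum_(i < n) rescaled_xx T a i s y = expR (- (beta * s)) * expR (- s) *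
     \sum_(i < n) 'D_(unit_vec i) ('D_(unit_vec i) (u (T - expR (- s)))) x.
    rewrite mulr_sumr; apply: eq_bigr => i _; rewrite -expRD /rescaled_xx.
    by congr (expR _ * _); ring.
  have -> : \sum_(i < n) y 0 i / 2 * rescaled_x T a i s y =
     2^-1 * expR (- (beta * s)) * expR (- (s / 2)) *
     \sum_(i < n) y 0 i * 'D_(unit_vec i) (u (T - expR (- s))) x.
    rewrite mulr_sumr; apply: eq_bigr => i _; rewrite -(mulrA 2^-1) -expRD /rescaled_x -/x.
    have -> : - (beta * s) + - (s / 2) = - ((beta + 2^-1) * s) by ring.
    ring.
  by rewrite e1; ring.
- move=> i s y ss; have d := is_derive_affine (@solution_derivable i _ (a + expR (- (s / 2)) *: y) (tp s ss)).
  have [q1 q2] := is_deriveZ (expR (- (beta * s))) d; split; first exact: q1.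
  rewrite (_ : rescaled T a s = expR (- (beta * s)) \*: (fun y => u (T - expR (- s)) (a + expR (- (s / 2)) *: y)))//.
  rewrite q2 /GRing.scale/= mulrA -expRD /rescaled_x; congr (expR _ * _); ring.
- move=> i s y ss; have d := is_derive_affine (@solution_derivable2 i _ (a + expR (- (s / 2)) *: y) (tp s ss)).
  have [q1 q2] := is_deriveZ (expR (- ((beta + 2^-1) * s))) d; split; first exact: q1.
  rewrite (_ : rescaled_x T a i s = expR (- ((beta + 2^-1) * s)) \*:
    (fun y => 'D_(unit_vec i) (u (T - expR (- s))) (a + expR (- (s / 2)) *: y)))//.
  rewrite q2 /GRing.scale/= mulrA -expRD /rescaled_xx; congr (expR _ * _); field.
  by rewrite gt_eqF.
- by [].
- move=> s y ss; have /andP[t1 t2] := tt s ss.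
  apply: le_trans (expR_scale_le b0 ss (uB _ _ (tp s ss) (ltW t2))) _.
  by rewrite /KK -addrA lerDl addr_ge0// mulr_ge0// expR_ge0.
- move=> i s y ss; have /andP[t1 t2] := tt s ss.
  apply: le_trans (expR_scale_le (addr_ge0 b0 _) ss (h1 i _ _ (ltW t1) (ltW t2))) _ => //.
  by rewrite /KK addrAC lerDr addr_ge0// mulr_ge0// expR_ge0.
- move=> i s y ss; have /andP[t1 t2] := tt s ss.
  apply: le_trans (expR_scale_le (addr_ge0 b0 _) ss (h2 i _ _ (ltW t1) (ltW t2))) _ => //.
  by rewrite /KK lerDr addr_ge0// mulr_ge0// expR_ge0.
- move=> s ss; apply: mslice => // x; exact: solution_continuous (tp s ss).
- move=> i s ss; apply: (mslice (fun t => 'D_(unit_vec i) (u t))) => // x.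
  by have [_ _ /(_ i)[]] := solution_spec x (tp s ss).
- move=> i s ss; apply: (mslice (fun t => 'D_(unit_vec i) ('D_(unit_vec i) (u t)))) => // x.
  by have [_ _ _ /(_ i i)[]] := solution_spec x (tp s ss).
- move=> i s y ss; apply: (@continuous_scaled (fun t => 'D_(unit_vec i) (u t))).
  by have [_ _ /(_ i)[]] := solution_spec (a + expR (- (s / 2)) *: y) (tp s ss).
- move=> i s y ss; apply: (@continuous_scaled (fun t => 'D_(unit_vec i) ('D_(unit_vec i) (u t)))).
  by have [_ _ _ /(_ i i)[]] := solution_spec (a + expR (- (s / 2)) *: y) (tp s ss).
Qed.

(* P_tau(g^2)(a), the heat semigroup applied to g^2. *)
Definition heat_square (g : 'rV[R]_n -> R) (tau : R) a := gexp (fun z => g (a + Num.sqrt tau *: z) ^+ 2).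

Definition heat_square_grad (g : 'rV[R]_n -> R) (tau : R) a :=
  \sum_(i < n) heat_square ('D_(unit_vec i) g) tau a.

Let gexp_scale_sqr c (g : 'rV[R]_n -> R) : tame (fun z => g z ^+ 2) ->
  gexp (fun z => (c * g z) ^+ 2) = c ^+ 2 * gexp (fun z => g z ^+ 2).
Proof. by move=> tg; rewrite -gexpZ//; apply: eq_gexp => z; rewrite exprMn. Qed.

Let tame_sqr_slice (g : R -> 'rV[R]_n -> R) t c a K : (forall x, `|g t x| <= K) ->
  (forall x, {for (t, x), continuous (fun z : R * 'rV[R]_n => g z.1 z.2)}) ->
  tame (fun z => g t (a + c *: z) ^+ 2).
Proof.
move=> gK cg.
have tg : tame (fun z => g t (a + c *: z)).
  apply: (@tame_bounded _ _ _ K) => //; apply: measurable_comp_affine.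
  by apply: continuous_measurable_rV => x; exact: (continuous_slice (cg x)).
by under eq_fun do rewrite expr2; exact: tameM.
Qed.

(** [mass_le] in the original variables. The minimum offers two upper bounds for the energy at t0:
    one needs the gradient alone, the other also a bound on the mass. *)
Lemma rescaled_mass_le T t0 t1 a (eps lam : R) : 0 < t0 -> t0 <= t1 -> t1 < T ->
  (T - t0) `^ (2 * beta + 1) * heat_square_grad (u t0) (T - t0) a / 2 +
  Num.min (potential_max p) (beta / 2 * ((T - t0) `^ (2 * beta) * heat_square (u t0) (T - t0) a)) <= eps ->
  0 < lam -> 4 * eps < 2 * (p - 1) / (p + 1) * lam `^ (p + 1) ->
  (T - t1) `^ (2 * beta) * heat_square (u t1) (T - t1) a <= 2 * lam ^+ 2.
Proof.
move=> t00 t01 t1T hE l0 el.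
(* The flow is started at t0 / 2, so that t0 lies strictly inside its interval. *)
have t20 : 0 < t0 / 2 by rewrite divr_gt0.
have t2T : t0 / 2 < T by lra.
have [K flow] := solution_flow a t20 t2T.
have [B B0 uB] := solution_bounded T.
have [K1 K10 h1] := solution_grad_bound T t00.
have p10 : 0 < p - 1 by rewrite subr_gt0.
have b0 : 0 < beta by rewrite invr_gt0.
pose s_ t : R := - ln (T - t).
have sE t : t < T -> expR (- s_ t) = T - t.
  by move=> tT; rewrite opprK lnK// posrE subr_gt0.
have sE2 t : t < T -> expR (- (s_ t / 2)) = Num.sqrt (T - t).
  move=> tT; rewrite -powR12_sqrt ?subr_ge0 ?ltW// -sE// powR_expR; congr expR; ring.
have sEp t c : t < T -> expR (- (c * s_ t)) = (T - t) `^ c.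
  by move=> tT; rewrite -sE// powR_expR; congr expR; ring.
have smono t t' : t < t' -> t' < T -> s_ t < s_ t'.
  by move=> tt tT; rewrite ltrN2 ltr_ln ?posrE ?subr_gt0//; lra.
have t0T : t0 < T by lra.
have massE t : 0 < t -> t < T -> gexp (fun y => rescaled T a (s_ t) y ^+ 2) =
    (T - t) `^ (2 * beta) * heat_square (u t) (T - t) a.
  move=> tp tT; rewrite /rescaled sEp// sE// sE2// subKr gexp_scale_sqr; last first.
    by apply: (@tame_sqr_slice u t _ a B) => x; [exact: uB (ltW tT)|exact: solution_continuous].
  congr (_ * _).
  by rewrite -powR_mulrn ?powR_ge0// -powRrM; congr (_ `^ _); ring.
have gradE : gradient_energy (rescaled_x T a) (s_ t0) =
    (T - t0) `^ (2 * beta + 1) * heat_square_grad (u t0) (T - t0) a.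
  rewrite /gradient_energy /heat_square_grad mulr_sumr; apply: eq_bigr => i _.
  rewrite /rescaled_x sEp// sE// sE2// subKr gexp_scale_sqr; last first.
    apply: (@tame_sqr_slice (fun t => 'D_(unit_vec i) (u t)) t0 _ a K1) => x; first exact: h1 (ltW t0T).
    by have [_ _ /(_ i)[]] := solution_spec x t00.
  congr (_ * _).
  by rewrite -powR_mulrn ?powR_ge0// -powRrM; congr (_ `^ _); field; rewrite gt_eqF.
have s0 : s_ (t0 / 2) < s_ t0 by apply: smono => //; lra.
rewrite -massE//; last lra.
apply: (mass_le p1 flow s0 _ _ l0 el).
- move: t01; rewrite le_eqVlt => /predU1P[->//|t01].
  by apply: ltW; exact: smono.
- apply: le_trans hE; rewrite -gradE -massE// minEle.
  by case: ifP => _; [exact: (flow_energy_le_max p1 flow s0)|exact: (flow_energy_le_mass _ _ p1 s0)].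
- move=> S.
  (* Late enough for e^{-beta S'} B < lam, with B a bound of u up to T. This is where continuation
     of u through time T is used. *)
  pose S' := Num.max S (Num.max (s_ (t0 / 2) + 1) (ln ((B + 1) / lam) / beta)).
  exists S'; first by rewrite le_max lexx.
  have sS' : s_ (t0 / 2) < S'.
    by rewrite /S' !lt_max ltrDl ltr01 orbT.
  have e1 : expR (- (beta * S')) <= lam / (B + 1).
    have h : ln ((B + 1) / lam) <= beta * S'.
      by rewrite [beta * S']mulrC -(ler_pdivrMr _ _ b0) /S' !le_max lexx !orbT.
    have q0 : 0 < (B + 1) / lam by rewrite divr_gt0// ltr_wpDl.
    have -> : lam / (B + 1) = expR (- ln ((B + 1) / lam)) by rewrite expRN lnK ?posrE// invf_div.
    by rewrite ler_expR lerN2.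
  have wS y : `|rescaled T a S' y| <= lam.
    rewrite normrM (ger0_norm (expR_ge0 _)).
    apply: le_trans (_ : lam / (B + 1) * B <= _).
      apply: ler_pM => //.
      have eS : expR (- S') < T - t0 / 2.
        by rewrite -sE// ltr_expR ltrN2.
      by apply: uB; have := expR_gt0 (- S'); lra.
    by rewrite mulrAC ler_pdivrMr ?ltr_wpDl// ler_pM2l// lerDl.
  apply: le_lt_trans (_ : gexp (fun=> lam ^+ 2) < _); last first.
    by rewrite gexp_cst mulr_natl mulr2n ltrDl exprn_gt0.
  apply: ler_gexp; last by move=> y; rewrite -(real_normK (num_real (rescaled _ _ _ _))) lerXn2r ?nnegrE// ltW.
    have tw : tame (rescaled T a S').
      by apply: (tame_bounded (flow_mw flow sS')) => y; exact: (flow_w flow).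
    by under eq_fun do rewrite expr2; exact: tameM.
  exact: tame_cst.
Qed.

End solution.

(** * Distributional gradients and the heat semigroup *)

Section elementary_functions.
Context {R : realType}.
Implicit Types (f g : R -> R) (x : R).

(** The derivative of [flat k] is [flat (k+2)] minus k times [flat (k+1)], also at 0, so the family
    is closed under differentiation up to linear combinations. *)
Definition flat k x := if 0 < x then x^-1 ^+ k * expR (- x^-1) else 0.

(* A class of smooth functions containing compactly supported ones. *)
Inductive elementary : (R -> R) -> Prop :=
| elementary_cst c : elementary (fun=> c)
| elementary_id : elementary id
| elementary_exp : elementary expR
| elementary_flat k : elementary (flat k)
| elementary_add f g : elementary f -> elementary g -> elementary (fun x => f x + g x)
| elementary_mul f g : elementary f -> elementary g -> elementary (fun x => f x * g x)
| elementary_comp f g : elementary f -> elementary g -> elementary (fun x => f (g x)).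

(** From e^v >= v^{k+2} / (k+2)! at v = 1/x. The quadratic bound yields differentiability at 0 with
    derivative 0. *)
Lemma flat_le k x : 0 < x -> `|flat k x| <= k.+2`!%:R * x ^+ 2.
Proof.
move=> x0; have v0 : 0 < x^-1 by rewrite invr_gt0.
rewrite /flat x0 normrM (ger0_norm (expR_ge0 _)) (ger0_norm (exprn_ge0 k (ltW v0))).
have h : x^-1 ^+ k.+2 / (k.+2)`!%:R <= expR x^-1.
  by apply: le_trans (expR_ge1Dxn k.+1 (ltW v0)); rewrite lerDr.
rewrite expRN ler_pdivrMr ?expR_gt0//.
rewrite ler_pdivrMr ?ltr0n ?fact_gt0// in h.
have -> : x^-1 ^+ k = x^-1 ^+ k.+2 * x ^+ 2.
  by rewrite -addn2 exprD -mulrA -exprMn mulVf ?gt_eqF// expr1n mulr1.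
by rewrite [leRHS]mulrAC ler_wpM2r ?sqr_ge0// mulrC.
Qed.

Lemma is_derive_flat k x : is_derive x 1 (flat k) (flat k.+2 x - k%:R * flat k.+1 x).
Proof.
have [x0|x0|->] := ltgtP x 0.
- have fl j : flat j x = 0 by rewrite /flat ltNge (ltW x0).
  rewrite !fl mulr0 subr0.
  apply: (near_eq_is_derive (f := fun=> 0)).
  apply: filterS (@cvgr_lt _ _ _ _ id _ cvg_id 0 x0) => r r0.
  by rewrite /flat ltNge (ltW r0).
- apply: (near_eq_is_derive (f := fun x => x^-1 ^+ k * expR (- x^-1))).
    by apply: filterS (@cvgr_gt _ _ _ _ id _ cvg_id 0 x0) => r r0; rewrite /flat r0.
  have xn : x != 0 by rewrite gt_eqF.
  have di : is_derive x 1 (fun x : R => x^-1) (- x ^- 2).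
    have dv := @is_deriveV R (fun x : R => x) x 1 1 xn (is_derive_id _ _).
    by apply: (is_derive_eq dv); rewrite /GRing.scale/= mulr1.
  have de : is_derive x 1 (fun x => expR (- x^-1)) (expR (- x^-1) * x ^- 2).
    have := @is_derive1_comp _ expR (fun x : R => - x^-1) x _ _ (is_derive_expR _) (is_deriveN di).
    by rewrite opprK.
  have dx := is_deriveX k di; rewrite exprfctE in dx.
  apply: (is_derive_eq (is_deriveM dx de)).
  rewrite /flat x0 /GRing.scale/=.
  case: k dx => [|k] _.
    by rewrite !mul0r mulr0 addr0 subr0 mul1r mulrC exprVn.
  rewrite /= !exprSr exprVn; field.
  by rewrite xn expf_neq0.
- have fl j : flat j 0 = 0 by rewrite /flat ltxx.
  rewrite !fl mulr0 subr0; apply: is_derive_seq => u u0 uc.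
  apply/cvgr0Pnorm_le => e e0; have C0 : 0 < (k.+2)`!%:R :> R by rewrite ltr0n fact_gt0.
  have ec : 0 < e / (k.+2)`!%:R by rewrite divr_gt0.
  move/cvgr0Pnorm_le : uc => /(_ _ ec); apply: filterS => m hm.
  rewrite addr0 fl subr0 normrM normfV ler_pdivrMr ?normr_gt0//.
  have [um|um] := leP (u m) 0.
    by rewrite /flat ltNge um normr0 mulr_ge0// ltW.
  apply: le_trans (flat_le k um) _; rewrite (gtr0_norm um) in hm *.
  by rewrite expr2 mulrA ler_pM2r// mulrC -ler_pdivlMr.
Qed.

Lemma elementary_derive f : elementary f ->
  exists2 df, elementary df & forall x, is_derive x 1 f (df x).
Proof.
elim=> {f}.
- by move=> c; exists (fun=> 0); [exact: elementary_cst|move=> x; exact: is_derive_cst].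
- by exists (fun=> 1); [exact: elementary_cst|move=> x; exact: is_derive_id].
- by exists expR; [exact: elementary_exp|move=> x; exact: is_derive_expR].
- move=> k; exists (fun x => flat k.+2 x + (- k%:R) * flat k.+1 x).
    apply: elementary_add; first exact: elementary_flat.
    by apply: elementary_mul; [exact: elementary_cst|exact: elementary_flat].
  by move=> x; rewrite mulNr; exact: is_derive_flat.
- move=> f g _ [df edf dfE] _ [dg edg dgE].
  exists (fun x => df x + dg x); first exact: elementary_add.
  by move=> x; exact: is_deriveD (dfE x) (dgE x).
- move=> f g ef [df edf dfE] eg [dg edg dgE].
  exists (fun x => f x * dg x + g x * df x).
    by apply: elementary_add; exact: elementary_mul.
  by move=> x; exact: (is_deriveM (dfE x) (dgE x)).
- move=> f g ef [df edf dfE] eg [dg edg dgE].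
  exists (fun x => df (g x) * dg x).
    by apply: elementary_mul => //; exact: elementary_comp.
  by move=> x; exact: (is_derive1_comp (dfE (g x)) (dgE x)).
Qed.

Lemma elementary_continuous f : elementary f -> continuous f.
Proof. by move=> /elementary_derive[df _ h] x; exact: is_derive_continuous (h x). Qed.

End elementary_functions.

(** * Smooth cutoffs and test functions *)

Section product_functions.
Context {R : realType} {n : nat}.
Implicit Types (psi : 'I_n -> R -> R) (x y : 'rV[R]_n).

Definition prod_fun psi y := \prod_j psi j (y 0 j).

Lemma is_derive_prod_fun psi i y d : is_derive (y 0 i) 1 (psi i) d ->
  is_derive y (unit_vec i) (prod_fun psi) (d * \prod_(j | j != i) psi j (y 0 j)).
Proof.
move=> h; apply: line_is_derive.
have -> : (fun r => prod_fun psi (y + r *: unit_vec i)) =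
    (fun r => psi i (y 0 i + r)) * (fun=> \prod_(j | j != i) psi j (y 0 j)).
  apply/funext => r; rewrite fctE /prod_fun (bigD1 i)//=; congr (psi i _ * _).
    by rewrite !mxE !eqxx mulr1.
  by apply: eq_bigr => j ji; rewrite !mxE (negbTE ji) andbF mulr0 addr0.
have d1 : is_derive (0 : R) 1 (fun r => psi i (y 0 i + r)) d.
  have dd : is_derive (0 : R) 1 (fun r => y 0 i + r) 1.
    by have := is_deriveD (is_derive_cst (y 0 i) (0 : R) 1) (is_derive_id (0 : R) 1); rewrite add0r.
  have h' : is_derive (y 0 i + 0) 1 (psi i) d by rewrite addr0.
  have := is_derive1_comp h' dd; rewrite mulr1; exact.
have dm := is_deriveM d1 (is_derive_cst (\prod_(j | j != i) psi j (y 0 j)) (0 : R) 1).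
by apply: (is_derive_eq dm); rewrite scaler0 add0r /GRing.scale/= mulrC.
Qed.

Lemma continuous_prod_fun psi : (forall j, continuous (psi j)) -> continuous (prod_fun psi).
Proof.
move=> cp y0.
suff H (y : 'rV[R]_n) (s : seq 'I_n) : \prod_(j <- s) psi j ((z : 'rV[R]_n) 0 j) @[z --> nbhs y] --> \prod_(j <- s) psi j (y 0 j) by exact: H.
elim: s => [|j s IH].
  have -> : (fun z : 'rV[R]_n => \prod_(j <- [::]) psi j (z 0 j)) = fun=> 1.
    by apply/funext => z; rewrite big_nil.
  by rewrite big_nil; exact: cvg_cst.
rewrite big_cons; under eq_fun do rewrite big_cons; apply: cvgM => //.
exact: (cvg_comp _ _ (@continuous_coord _ _ j y) (cp j (y 0 j))).
Qed.

(** A partial derivative changes one factor into its derivative, again elementary. Smoothness of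
    every order thus follows by induction on the list of directions. *)
Lemma partial_prod_fun psi s : (forall j, elementary (psi j)) ->
  exists2 phi, (forall j, elementary (phi j)) & foldr partial (prod_fun psi) s = prod_fun phi.
Proof.
move=> ep; elim: s => [|i s [phi ephi E]]; first by exists psi.
have [dphi edphi dE] := elementary_derive (ephi i).
exists (fun j => if j == i then dphi else phi j).
  by move=> j; case: ifP.
apply/funext => y; rewrite /= E /partial.
have [_ ->] := is_derive_prod_fun (dE (y 0 i)).
rewrite [RHS](bigD1 i)//= eqxx; congr (_ * _).
by apply: eq_bigr => j /negbTE ->.
Qed.

Lemma test_function_prod_fun psi r : (forall j, elementary (psi j)) ->
  (forall j z, r < `|z| -> psi j z = 0) -> test_function (prod_fun psi).
Proof.
move=> ep p0; split.
  move=> s; have [phi ephi ->] := partial_prod_fun s ep; split.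
    by apply: continuous_prod_fun => j; exact: elementary_continuous.
  move=> i; have [dphi edphi dE] := elementary_derive (ephi i); split.
    by move=> x; have [] := is_derive_prod_fun (dE (x 0 i)).
  have [phi' ephi' /= ->] := partial_prod_fun [:: i] ephi.
  by apply: continuous_prod_fun => j; exact: elementary_continuous.
pose B := [set y : 'rV[R]_n | forall j, `[- r, r]%classic (y 0 j)].
have cB : compact B.
  by apply: (@rV_compact _ n (fun=> `[- r, r]%classic)) => j; exact: segment_compact.
apply: (subclosed_compact (@closed_closure _ _) cB).
rewrite closureE; apply: smallest_sub; first exact: compact_closed cB.
move=> y /= yn j; change (is_true (y 0 j \in `[- r, r])); rewrite in_itv/= -ler_norml leNgt; apply/negP => ry; move/negP: yn; apply.
by apply/eqP; rewrite /prod_fun (bigD1 j)//= p0// mul0r.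
Qed.

End product_functions.

Section bump_function.
Context {R : realType}.
Implicit Types x z : R.

Lemma flat_ge0 k x : 0 <= flat k x.
Proof.
rewrite /flat; case: ifP => // x0.
by rewrite mulr_ge0 ?expR_ge0// exprn_ge0// invr_ge0 ltW.
Qed.

Lemma flat_le_fact k x : flat k x <= k`!%:R.
Proof.
rewrite /flat; case: ifP => // x0; have v0 : 0 < x^-1 by rewrite invr_gt0.
rewrite expRN ler_pdivrMr ?expR_gt0//.
case: k => [|k]; first by rewrite expr0 mul1r -expR0 ler_expR ltW.
rewrite -ler_pdivrMl ?ltr0n ?fact_gt0// mulrC.
by apply: le_trans (expR_ge1Dxn k (ltW v0)); rewrite lerDr.
Qed.

(** The factor e^2 normalizes the value at 0 to 1, so that the dilated cutoffs tend to 1. *)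
Definition bump z : R := expR 2 * (flat 0 (1 - z) * flat 0 (1 + z)).
Definition dbump z : R := expR 2 * (flat 0 (1 - z) * flat 2 (1 + z) - flat 0 (1 + z) * flat 2 (1 - z)).

Lemma elementary_affine a b : elementary (fun x : R => a + b * x).
Proof.
apply: elementary_add; first exact: elementary_cst.
by apply: elementary_mul; [exact: elementary_cst|exact: elementary_id].
Qed.

Lemma elementary_bump : elementary bump.
Proof.
apply: elementary_mul; first exact: elementary_cst.
apply: elementary_mul; apply: (elementary_comp (f := flat 0)); try exact: elementary_flat.
  by have := elementary_affine 1 (-1); under eq_fun do rewrite mulN1r.
by have := elementary_affine 1 1; under eq_fun do rewrite mul1r.
Qed.

Lemma is_derive_bump z : is_derive z 1 bump (dbump z).
Proof.
have d1 : is_derive z 1 (fun z : R => 1 - z) (-1).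
  by have := is_deriveB (is_derive_cst (1 : R) z 1) (is_derive_id z 1); rewrite sub0r.
have d2 : is_derive z 1 (fun z : R => 1 + z) 1.
  by have := is_deriveD (is_derive_cst (1 : R) z 1) (is_derive_id z 1); rewrite add0r.
have e1 := @is_derive1_comp _ (flat 0) (fun z => 1 - z) z _ _ (is_derive_flat 0 (1 - z)) d1.
have e2 := @is_derive1_comp _ (flat 0) (fun z => 1 + z) z _ _ (is_derive_flat 0 (1 + z)) d2.
apply: (is_derive_eq (is_deriveM (is_derive_cst (expR 2 : R) z 1) (is_deriveM e1 e2))).
by rewrite /dbump /GRing.scale/= !mul0r !subr0; ring.
Qed.

Lemma bump_eq0 z : 1 < `|z| -> bump z = 0.
Proof.
rewrite ltr_normr /bump => /orP[z1|z1].
  by rewrite {1}/flat subr_gt0 (ltNge z) (ltW z1) mul0r mulr0.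
by rewrite {2}/flat (_ : 0 < 1 + z = false) ?mulr0//; apply/negbTE; rewrite -leNgt; lra.
Qed.

Lemma bump0 : bump 0 = 1.
Proof.
rewrite /bump /flat subr0 addr0 ltr01 expr0 mul1r invr1 -expRD -expRD -[RHS]expR0.
by congr expR; ring.
Qed.

Lemma bump_le z : `|bump z| <= expR 2.
Proof.
rewrite /bump normrM (ger0_norm (expR_ge0 _)) ler_piMr ?expR_ge0//.
rewrite ger0_norm ?mulr_ge0 ?flat_ge0// mulr_ile1 ?flat_ge0//; exact: (flat_le_fact 0).
Qed.

Lemma dbump_le z : `|dbump z| <= expR 2 * 4.
Proof.
rewrite /dbump normrM (ger0_norm (expR_ge0 _)) ler_wpM2l ?expR_ge0//.
have h (a b : R) : `|flat 0 a * flat 2 b| <= 2.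
  rewrite ger0_norm ?mulr_ge0 ?flat_ge0// -[leRHS]mul1r ler_pM ?flat_ge0//.
    exact: (flat_le_fact 0).
  exact: (flat_le_fact 2).
by apply: le_trans (ler_normB _ _) _; have := h (1 - z) (1 + z); have := h (1 + z) (1 - z); lra.
Qed.

End bump_function.

Section cutoffs.
Context {R : realType} {n : nat}.
Implicit Types (x y : 'rV[R]_n) (t : R).

Let h_ m : R := m.+1%:R^-1.

Definition cutoff m : 'rV[R]_n -> R := prod_fun (fun _ z => bump (h_ m * z)).
Definition dcutoff m (i : 'I_n) y : R :=
  (dbump (h_ m * y 0 i) * h_ m) * \prod_(j | j != i) bump (h_ m * y 0 j).

Lemma is_derive_bump_scale m (z : R) : is_derive z 1 (fun z => bump (h_ m * z)) (dbump (h_ m * z) * h_ m).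
Proof.
have d : is_derive z 1 (fun z => h_ m * z) (h_ m).
  by apply: is_derive_eq; rewrite /GRing.scale/=; ring.
exact: (@is_derive1_comp _ bump (fun z => h_ m * z) z _ _ (is_derive_bump _) d).
Qed.

Lemma is_derive_cutoff m i y : is_derive y (unit_vec i) (cutoff m) (dcutoff m i y).
Proof. exact: (is_derive_prod_fun (psi := fun _ z => bump (h_ m * z)) (is_derive_bump_scale m (y 0 i))). Qed.

Let expR2_ge1 : 1 <= expR 2 :> R.
Proof. by rewrite -expR0 ler_expR. Qed.

Lemma prod_bump_le m y (P : pred 'I_n) :
  `|\prod_(j | P j) bump (h_ m * y 0 j)| <= expR 2 ^+ n.
Proof.
rewrite normr_prod; apply: le_trans (_ : \prod_(j < n | P j) expR 2 <= _).
  by apply: ler_prod => j _; rewrite normr_ge0 bump_le.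
rewrite prodr_const; apply: ler_weXn2l => //.
by rewrite -[leqRHS]card_ord max_card.
Qed.

Lemma cutoff_le m y : `|cutoff m y| <= expR 2 ^+ n.
Proof. exact: (prod_bump_le m y xpredT). Qed.

Lemma dcutoff_le m i y : `|dcutoff m i y| <= h_ m * (expR 2 * 4 * expR 2 ^+ n).
Proof.
have h0 : 0 <= h_ m by rewrite invr_ge0.
have P := prod_bump_le m y (fun j => j != i).
rewrite /dcutoff normrM normrM (ger0_norm h0).
apply: le_trans (ler_wpM2l _ P) _; first exact: mulr_ge0.
rewrite [leRHS]mulrA ler_wpM2r ?exprn_ge0 ?expR_ge0// [leLHS]mulrC.
by apply: ler_wpM2l => //; exact: dbump_le.
Qed.

Lemma cvg_cutoff y : cutoff m y @[m --> \oo] --> (1 : R).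
Proof.
rewrite /cutoff /prod_fun.
elim: (index_enum _) => [|j s IH].
  by rewrite (_ : (fun=> _) = fun=> 1); [exact: cvg_cst|apply/funext => m; rewrite big_nil].
rewrite -[X in _ --> X](mul1r 1); under eq_fun do rewrite big_cons.
apply: cvgM => //.
have c : h_ m * y 0 j @[m --> \oo] --> 0.
  by rewrite -(mul0r (y 0 j)); apply: cvgM; [exact: cvg_inv_succ|exact: cvg_cst].
have := cvg_comp _ _ c (is_derive_continuous (is_derive_bump 0)).
by rewrite bump0.
Qed.

Lemma heat_kernel_prod t x y : 0 < t -> heat_kernel t (x - y) =
  prod_fun (fun j z => (4 * pi * t) `^ (- 2^-1) * expR (- ((x 0 j - z) ^+ 2 / (4 * t)))) y.
Proof.
move=> t0; rewrite /heat_kernel /prod_fun big_split/= prodr_const card_ord; congr (_ * _).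
  rewrite -powR_mulrn ?powR_ge0// -powRrM; congr (_ `^ _); ring.
rewrite -expR_sum enorm_sqr; congr expR; rewrite sumrN mulr_suml; congr (- _).
by apply: eq_bigr => j _; rewrite !mxE.
Qed.

(** The heat kernel is a product of elementary functions of the coordinates, so the cutoff makes it
    a test function. This is the function with which the weak gradient is tested. *)
Lemma test_function_cutoff m t x : 0 < t ->
  test_function (fun y => heat_kernel t (x - y) * cutoff m y).
Proof.
move=> t0.
have -> : (fun y => heat_kernel t (x - y) * cutoff m y) =
    prod_fun (fun j z => (4 * pi * t) `^ (- 2^-1) * expR (- ((x 0 j - z) ^+ 2 / (4 * t))) * bump (h_ m * z)).
  by apply/funext => y; rewrite heat_kernel_prod// /cutoff /prod_fun -big_split.
apply: (test_function_prod_fun (r := m.+1%:R)) => j; last first.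
  move=> z mz; rewrite bump_eq0 ?mulr0// normrM ger0_norm ?invr_ge0// mulrC ltr_pdivlMr ?ltr0n//.
  by rewrite mul1r.
apply: elementary_mul; last first.
  apply: (elementary_comp elementary_bump).
  by have := elementary_affine 0 (h_ m); under eq_fun do rewrite add0r.
apply: elementary_mul; first exact: elementary_cst.
apply: (elementary_comp elementary_exp).
have -> : (fun z => - ((x 0 j - z) ^+ 2 / (4 * t))) =
    (fun z => (- (4 * t)^-1) * ((x 0 j + (-1) * z) * (x 0 j + (-1) * z))).
  by apply/funext => z; rewrite expr2 mulN1r; ring.
apply: elementary_mul; first exact: elementary_cst.
by apply: elementary_mul; exact: elementary_affine.
Qed.

Lemma is_derive_heat_kernel t (z : 'rV[R]_n) i : 0 < t ->
  is_derive z (unit_vec i) (heat_kernel t) (- (z 0 i / (2 * t)) * heat_kernel t z).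
Proof.
move=> t0; apply: line_is_derive.
have -> : (fun r => heat_kernel t (z + r *: unit_vec i)) =
   (fun r => (4 * pi * t) `^ (- (n%:R / 2)) *
       expR (- ((enorm z ^+ 2 + 2 * r * z 0 i + r ^+ 2) / (4 * t)))).
  by apply/funext => q; rewrite /heat_kernel enorm_shift.
apply: is_derive_eq; rewrite /heat_kernel /GRing.scale/=.
have t1 : t != 0 by rewrite gt_eqF.
rewrite !mulr0 !mul0r !addr0 expr0n/= addr0; by field.
Qed.

(** The factor z_i is absorbed by e^{|z|^2 / (8t)}, which is what doubling the time gives back. *)
Lemma heat_kernel_grad_le t : 0 < t -> exists2 C : R, 0 <= C & forall i (z : 'rV[R]_n),
  `|z 0 i / (2 * t) * heat_kernel t z| <= C * heat_kernel (2 * t) z.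
Proof.
move=> t0.
have t2 : 0 < 2 * t by rewrite mulr_gt0.
have p4 : 0 <= 4 * pi * t :> R by rewrite !mulr_ge0 ?pi_ge0// ltW.
exists ((1 + 8 * t) / (2 * t) * 2 `^ (n%:R / 2)).
  by rewrite mulr_ge0 ?powR_ge0// divr_ge0 ?ltW// addr_gt0// mulr_gt0.
move=> i z; rewrite normrM (ger0_norm (heat_kernel_ge0 _ _)).
have zi : `|z 0 i / (2 * t)| <= (1 + 8 * t) / (2 * t) * expR (enorm z ^+ 2 / (8 * t)).
  rewrite normrM [X in _ * X]gtr0_norm ?invr_gt0// mulrAC ler_wpM2r ?invr_ge0 ?(ltW t2)//.
  apply: le_trans (coord_le_bracket z i) _.
  apply: le_trans (_ : (1 + 8 * t) * (1 + enorm z ^+ 2 / (8 * t)) <= _); last first.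
    by rewrite ler_wpM2l ?expR_ge1Dx// addr_ge0// mulr_ge0// (ltW t0).
  have -> : (1 + 8 * t) * (1 + enorm z ^+ 2 / (8 * t)) =
     1 + enorm z ^+ 2 + (8 * t + enorm z ^+ 2 / (8 * t)) by field; rewrite gt_eqF.
  by rewrite lerDl addr_ge0 ?divr_ge0 ?sqr_ge0 ?mulr_ge0 ?(ltW t0).
apply: le_trans (ler_wpM2r (heat_kernel_ge0 _ _) zi) _.
have c0 : 0 <= (1 + 8 * t) / (2 * t).
  by rewrite divr_ge0 ?(ltW t2)// addr_ge0// mulr_ge0// (ltW t0).
rewrite -!(mulrA ((1 + 8 * t) / (2 * t))) ler_wpM2l//.
rewrite /heat_kernel le_eqVlt; apply/orP; left; apply/eqP.
have -> : 4 * pi * (2 * t) = 2 * (4 * pi * t) :> R by ring.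
rewrite (powRM _ (ler0n R 2) p4); set A := (4 * pi * t) `^ _; set B := 2 `^ (- _).
have AB : 2 `^ (n%:R / 2) * B = 1 :> R.
  by rewrite -powRD ?subrr ?powRr0//; apply/implyP => _; rewrite gt_eqF.
rewrite [RHS](_ : _ = (2 `^ (n%:R / 2) * B) * (A * expR (- (enorm z ^+ 2 / (4 * (2 * t)))))); last by ring.
rewrite AB mul1r mulrCA -expRD; congr (_ * expR _); field.
by rewrite gt_eqF.
Qed.

End cutoffs.

(** * Heat convolutions of weakly differentiable functions *)

Section weak_gradients.
Context {R : realType} {n : nat}.
Implicit Types (x y : 'rV[R]_n) (t K : R) (g v : 'rV[R]_n -> R).
Local Notation mu := (@lebesgue_rV R n).

Lemma cvg_Rintegral_dominated (f_ : nat -> 'rV[R]_n -> R) (f G : 'rV[R]_n -> R) :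
  (forall m, measurable_fun setT (f_ m)) ->
  mu.-integrable setT (EFin \o G) ->
  (forall m y, `|f_ m y| <= G y) ->
  (forall y, f_ m y @[m --> \oo] --> f y) ->
  \int[mu]_y f_ m y @[m --> \oo] --> \int[mu]_y f y.
Proof.
move=> mf iG fG ff.
have mlim : measurable_fun setT f by apply: (measurable_fun_cvg (h := f_)).
have pw y : setT y -> (f_ m y)%:E @[m --> \oo] --> (f y)%:E.
  by move=> _; apply: cvg_EFin; [exact: nearW|exact: ff].
have dom y m : setT y -> (`|(f_ m y)%:E| <= (G y)%:E)%E by move=> _; rewrite lee_fin.
have [ilim _ lim] := @dominated_convergence _ _ _ mu setT measurableT
  (fun m y => (f_ m y)%:E) (fun y => (f y)%:E) (fun y => (G y)%:E)
  (fun m => measurableT_comp (@EFin_measurable R setT) (mf m)) (measurableT_comp (@EFin_measurable R setT) mlim)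
  (aeW _ pw) iG (aeW _ dom).
apply: fine_cvg; rewrite fineK; last exact: integrable_fin_num.
exact: lim.
Qed.

(* P_t|g|(x), possibly infinite. *)
Definition heat_abs t g x : \bar R := heatE t (fun y => (`|g y|)%:E) x.

Lemma heat_abs_integrable t g x : measurable_fun setT g -> (heat_abs t g x < +oo)%E ->
  mu.-integrable setT (fun y => (heat_kernel t (x - y) * g y)%:E).
Proof.
move=> mg fin; apply/integrableP; split.
  by apply/measurable_EFinP; apply: measurable_funM => //; exact: measurable_heat_kernel_l.
apply: le_lt_trans fin; rewrite le_eqVlt; apply/orP; left; apply/eqP.
by apply: eq_integral => y _; rewrite /= normrM (ger0_norm (heat_kernel_ge0 _ _)) EFinM.
Qed.

Lemma heat_abs_bound t g x : measurable_fun setT g -> (heat_abs t g x < +oo)%E ->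
  ((`|heat_convolution t g x|)%:E <= heat_abs t g x)%E.
Proof.
move=> mg fin; have ig := heat_abs_integrable mg fin.
rewrite (EFin_normr_Rintegral measurableT ig).
apply: le_trans (le_abse_integral mu measurableT (measurable_int _ ig)) _.
rewrite le_eqVlt; apply/orP; left; apply/eqP; apply: eq_integral => y _.
by rewrite /= normrM (ger0_norm (heat_kernel_ge0 _ _)) EFinM.
Qed.

Lemma heat_abs_fin t g K x : 0 < t -> measurable_fun setT g -> (forall y, `|g y| <= K) ->
  (heat_abs t g x < +oo)%E.
Proof.
move=> t0 mg gK; rewrite /heat_abs -(heat_convolution_EFin (K := K) x t0) ?ltry//.
  exact: measurableT_comp.
by move=> y; rewrite normr_id.
Qed.

Record weak_gradient (v : 'rV[R]_n -> R) (i : 'I_n) (g : 'rV[R]_n -> R) : Prop := WeakGradient {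
  weak_gradient_measurable : measurable_fun setT g ;
  weak_gradient_heat : forall t x, 0 < t -> (heat_abs t g x < +oo)%E ;
  weak_gradient_test : forall phi, test_function phi ->
    \int[mu]_y (partial i phi y * v y) = - \int[mu]_y (phi y * g y) }.

(** Differentiation under the integral over the shifts |r| < sqrt(t). One doubling of time absorbs
    the factor z_i and a second one the shift, so a single Gaussian of time 4t is a majorant. *)
Lemma is_derive_heat_convolution_kernel t v K i x : 0 < t ->
  measurable_fun setT v -> (forall y, `|v y| <= K) ->
  is_derive x (unit_vec i) (heat_convolution t v)
    (\int[mu]_y (- ((x - y) 0 i / (2 * t)) * heat_kernel t (x - y) * v y)).
Proof.
move=> t0 mv vK; pose e := @unit_vec R n i.
have K0 : 0 <= K by exact: le_trans (vK 0).
have [C1 C10 C1P] := @heat_kernel_grad_le R n t t0.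
have [C2 C20 C2P] := @heat_kernel_shift_le R n.
pose f (r : R) y := heat_kernel t ((x - y) + r *: e) * v y.
pose df (r : R) y := - (((x - y) + r *: e) 0 i / (2 * t)) * heat_kernel t ((x - y) + r *: e) * v y.
have t2 : 0 < 2 * t by rewrite mulr_gt0.
have t4 : 0 < 2 * (2 * t) by rewrite mulr_gt0.
have dfE (r : R) y : is_derive r 1 (f^~ y) (df r y).
  have [h1 h2] := is_derive_heat_kernel ((x - y) + r *: e) i t0.
  have := is_derive_line h1; rewrite h2 => d.
  apply: (is_derive_eq (is_deriveM d (is_derive_cst (v y) r 1))).
  by rewrite scaler0 add0r /GRing.scale/= /df mulrC.
pose G y := K * (C1 * (C2 * heat_kernel (2 * (2 * t)) (x - y))).
have iG : mu.-integrable setT (EFin \o G).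
  have := integrableZl measurableT (K * (C1 * C2)) (integrable_heat_kernel x t4).
  by apply: eq_integrable => // y _; rewrite /G /= -EFinM !mulrA.
have sub0 : `]- Num.sqrt t, Num.sqrt t[%classic (0 : R).
  by rewrite /= in_itv/= oppr_lt0 sqrtr_gt0 t0.
have iF (r : R) : `]- Num.sqrt t, Num.sqrt t[%classic r -> mu.-integrable setT (EFin \o f r).
  move=> _; have := heat_abs_integrable mv (heat_abs_fin (x + r *: e) t0 mv vK).
  by apply: eq_integrable => // y _; rewrite /f /= addrAC.
have dF (r : R) y : `]- Num.sqrt t, Num.sqrt t[%classic r -> setT y -> derivable (f^~ y) r 1.
  by move=> _ _; have [] := dfE r y.
have G0 y : 0 <= G y.
  by rewrite /G; apply: mulr_ge0 => //; apply: mulr_ge0 => //; apply: mulr_ge0 => //; exact: heat_kernel_ge0.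
have dG (r : R) y : `]- Num.sqrt t, Num.sqrt t[%classic r -> setT y -> `|partial1of2 f r y| <= G y.
  move=> rt _; rewrite /partial1of2 derive1E; have [_ ->] := dfE r y.
  rewrite /df mulNr mulNr normrN normrM [leLHS]mulrC; apply: ler_pM => //.
  apply: (le_trans (C1P i _)); rewrite ler_wpM2l//; apply: C2P => //.
  move: rt; rewrite /= in_itv/= -ltr_norml => rt.
  have : `|r| ^+ 2 <= Num.sqrt t ^+ 2 by rewrite lerXn2r ?nnegrE ?sqrtr_ge0// ltW.
  by rewrite real_normK ?num_real// sqr_sqrtr ?(ltW t0)//; move=> h; lra.
have lim := @cvg_differentiation_under_integral R _ _ mu f setT measurableT 0 _ _ sub0 iF dF G G0 iG dG.
apply: line_is_derive.
have FE (r : R) : heat_convolution t v (x + r *: e) = \int[mu]_y f r y.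
  by apply: eq_Rintegral => y _; rewrite /f addrAC.
have -> : (fun r => heat_convolution t v (x + r *: unit_vec i)) = (fun r => \int[mu]_y f r y).
  by apply/funext => r; exact: FE.
have -> : \int[mu]_y (- ((x - y) 0 i / (2 * t)) * heat_kernel t (x - y) * v y) =
    \int[mu]_y partial1of2 f 0 y.
  apply: eq_Rintegral => y _; rewrite /partial1of2 derive1E; have [_ ->] := dfE 0 y.
  by rewrite /df scale0r addr0.
have E : (fun h : R => h^-1 *: (((fun r => \int[mu]_y f r y) \o shift 0) (h *: (1 : R)) - \int[mu]_y f 0 y)) =
    (fun h : R => h^-1 *: (\int[mu]_y f (h + 0) y - \int[mu]_y f 0 y)).
  by apply/funext => h /=; rewrite [h%:A]mulr1.
apply: DeriveDef.
  by rewrite /derivable E; apply/cvg_ex; exists (\int[mu]_y partial1of2 f 0 y); exact: lim.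
by rewrite /derive E; apply/cvg_lim => //; exact: lim.
Qed.

(** The derivative is moved from the kernel onto v by testing with kernel times cutoff. The terms in
    which the cutoff is differentiated are O(1/m), and both sides pass to the limit by
    domination. *)
Lemma is_derive_heat_convolution t v K i g x : 0 < t ->
  measurable_fun setT v -> (forall y, `|v y| <= K) -> weak_gradient v i g ->
  is_derive x (unit_vec i) (heat_convolution t v) (heat_convolution t g x).
Proof.
move=> t0 mv vK [mg fin wg].
have K0 : 0 <= K by exact: le_trans (vK 0).
apply: (is_derive_eq (is_derive_heat_convolution_kernel i x t0 mv vK)).
pose E y := heat_kernel t (x - y).
pose dE y := (x - y) 0 i / (2 * t) * heat_kernel t (x - y).
have dEE y : is_derive y (unit_vec i) E (dE y).
  have [h1 h2] := is_derive_heat_kernel (x + (-1) *: y) i t0.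
  have := is_derive_affine h1; rewrite h2 !scaleN1r => d.
  have -> : E = fun y => heat_kernel t (x + (-1) *: y) by apply/funext => z; rewrite scaleN1r.
  by apply: (is_derive_eq d); rewrite /dE; ring.
have [C1 C10 C1P] := @heat_kernel_grad_le R n t t0.
pose phi m y := E y * cutoff m y.
have dphi m y : partial i (phi m) y = dE y * cutoff m y + E y * dcutoff m i y.
  have [_ q] := is_deriveM (dEE y) (is_derive_cutoff m i y).
  by rewrite [LHS]q /GRing.scale/= addrC mulrC.
have mE : measurable_fun setT E by exact: measurable_heat_kernel_l.
have mphi m : measurable_fun setT (phi m).
  apply: continuous_measurable_rV; have [sm _] := test_function_cutoff m x t0.
  by have [] := sm [::].
have mdphi m : measurable_fun setT (partial i (phi m)).
  apply: continuous_measurable_rV; have [sm _] := test_function_cutoff m x t0.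
  by have [_ /(_ i)[]] := sm [::].
set A := expR 2 ^+ n : R; have A0 : 0 <= A by rewrite exprn_ge0 ?expR_ge0.
have c1 : \int[mu]_y (phi m y * g y) @[m --> \oo] --> \int[mu]_y (E y * g y).
  apply: (cvg_Rintegral_dominated (G := fun y => A * `|E y * g y|)).
  - by move=> m; exact: measurable_funM.
  - have := integrableZl measurableT A (integrable_abse (heat_abs_integrable mg (fin t x t0))).
    by apply: eq_integrable.
  - move=> m y; rewrite /phi mulrAC normrM mulrC ler_wpM2r//; exact: cutoff_le.
  - move=> y; rewrite /phi; apply: cvgM; last exact: cvg_cst.
    rewrite -[X in _ --> X]mulr1; apply: cvgM; [exact: cvg_cst|exact: cvg_cutoff].
set B := expR 2 * 4 * A; have B0 : 0 <= B by rewrite !mulr_ge0 ?expR_ge0.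
have t2 : 0 < 2 * t by rewrite mulr_gt0.
have c2 : \int[mu]_y (partial i (phi m) y * v y) @[m --> \oo] --> \int[mu]_y (dE y * v y).
  apply: (cvg_Rintegral_dominated (G := fun y => (C1 * heat_kernel (2 * t) (x - y) * A + E y * B) * K)).
  - by move=> m; exact: measurable_funM.
  - have i1 := integrableZl measurableT (C1 * A * K) (integrable_heat_kernel x t2).
    have i2 := integrableZl measurableT (B * K) (integrable_heat_kernel x t0).
    have := integrableD measurableT i1 i2.
    by apply: eq_integrable => // y _; rewrite /= -!EFinM -EFinD /E; congr (_%:E); ring.
  - move=> m y; rewrite normrM dphi; apply: ler_pM => //.
    apply: le_trans (ler_normD _ _) _; apply: lerD; rewrite normrM.
      by apply: ler_pM => //; [exact: C1P|exact: cutoff_le].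
    rewrite [`|E y|](ger0_norm (heat_kernel_ge0 _ _)); apply: ler_wpM2l; first exact: heat_kernel_ge0.
    apply: le_trans (dcutoff_le m i y) _; by rewrite ler_piMl// invf_le1 ?ler1n ?ltr0n.
  - move=> y; under eq_fun do rewrite dphi.
    apply: cvgM; last exact: cvg_cst.
    rewrite -[X in _ --> X]addr0; apply: cvgD.
      rewrite -[X in _ --> X]mulr1; apply: cvgM; [exact: cvg_cst|exact: cvg_cutoff].
    rewrite -[X in _ --> X](mulr0 (E y)); apply: cvgM; first exact: cvg_cst.
    apply/cvgr0Pnorm_le => d d0.
    have c0 : m.+1%:R^-1 * B @[m --> \oo] --> 0.
      by rewrite -(mul0r B); apply: cvgM; [exact: cvg_inv_succ|exact: cvg_cst].
    move/cvgr0Pnorm_le : c0 => /(_ d d0); apply: filterS => m; apply: le_trans.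
    by apply: le_trans (dcutoff_le m i y) _; exact: ler_norm.
have eq : \int[mu]_y (dE y * v y) = - \int[mu]_y (E y * g y).
  apply: (cvg_unique _ c2) => //.
  have -> : (fun m => \int[mu]_y (partial i (phi m) y * v y)) = (fun m => - \int[mu]_y (phi m y * g y)).
    by apply/funext => m; apply: wg; exact: test_function_cutoff.
  exact: cvgN.
rewrite /heat_convolution -[RHS]opprK -eq.
have idE : mu.-integrable setT (EFin \o (fun y => dE y * v y)).
  have := integrableZl measurableT (C1 * K) (integrable_heat_kernel x t2).
  apply: le_integrable => //.
    apply/measurable_EFinP; apply: measurable_funM => //.
    apply: measurable_funM => //; apply: measurable_funM => //.
    under eq_fun do rewrite !mxE; apply: measurable_funB => //; exact: measurable_coord.
  move=> y _; rewrite /= lee_fin [leRHS]ger0_norm; last first.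
    by apply: mulr_ge0; [exact: mulr_ge0|exact: heat_kernel_ge0].
  by rewrite normrM mulrAC; apply: ler_pM => //; exact: C1P.
rewrite -mulN1r -RintegralZl//; apply: eq_Rintegral => y _.
by rewrite /dE mulN1r mulNr mulNr.
Qed.

End weak_gradients.

(** * Gradient of the solution at a small positive time *)

Section heat_comparison.
Context {R : realType} {n : nat}.
Implicit Types (x y z : 'rV[R]_n) (s t C c d : R) (f g : 'rV[R]_n -> \bar R).
Local Notation mu := (@lebesgue_rV R n).

Lemma ler_normB2 (a b c : R) : `|a| <= c -> `|b| <= c -> `|a - b| <= 2 * c.
Proof. by move=> ac bc; rewrite mulr_natl mulr2n (le_trans (ler_normB _ _))// lerD. Qed.

Lemma le_heatE t f g x : measurable_fun setT f -> measurable_fun setT g ->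
  (forall y, 0 <= f y)%E -> (forall y, f y <= g y)%E -> (heatE t f x <= heatE t g x)%E.
Proof.
move=> mf mg f0 fg.
have mk : measurable_fun setT (fun y => (heat_kernel t (x - y)%R)%:E).
  by apply/measurable_EFinP; exact: measurable_heat_kernel_l.
apply: ge0_le_integral => //.
- by move=> y _; rewrite mule_ge0// lee_fin heat_kernel_ge0.
- exact: emeasurable_funM.
- exact: emeasurable_funM.
- by move=> y _; rewrite lee_wpmul2l// lee_fin heat_kernel_ge0.
Qed.

Lemma heatE_kernel_le s t C f x x' : 0 <= C -> measurable_fun setT f -> (forall y, 0 <= f y)%E ->
  (forall y, heat_kernel s (x - y) <= C * heat_kernel t (x' - y)) ->
  (heatE s f x <= C%:E * heatE t f x')%E.
Proof.
move=> C0 mf f0 h.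
have mk r z : measurable_fun setT (fun y => (heat_kernel r (z - y)%R)%:E * f y)%E.
  by apply: emeasurable_funM => //; apply/measurable_EFinP; exact: measurable_heat_kernel_l.
rewrite /heatE -ge0_integralZl_real//; last first.
  by move=> y; rewrite mule_ge0// lee_fin heat_kernel_ge0.
apply: ge0_le_integral => //.
- by move=> y _; rewrite mule_ge0// lee_fin heat_kernel_ge0.
- by apply: emeasurable_funM => //; exact: measurable_cst.
- by move=> y _; rewrite muleA lee_wpmul2r// -EFinM lee_fin.
Qed.

Lemma heatE_affine t f x c d : 0 < t -> 0 <= c -> 0 <= d ->
  measurable_fun setT f -> (forall y, 0 <= f y)%E ->
  (heatE t (fun y => c%:E * f y + d%:E) x = c%:E * heatE t f x + d%:E)%E.
Proof.
move=> t0 c0 d0 mf f0.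
have mk : measurable_fun setT (fun y => (heat_kernel t (x - y)%R)%:E).
  by apply/measurable_EFinP; exact: measurable_heat_kernel_l.
have k0 y : (0 <= (heat_kernel t (x - y)%R)%:E)%E by rewrite lee_fin heat_kernel_ge0.
have mcf : measurable_fun setT (fun y => c%:E * f y)%E.
  by apply: emeasurable_funM => //; exact: measurable_cst.
have cf0 y : (0 <= c%:E * f y)%E by rewrite mule_ge0.
rewrite /heatE; under eq_integral => y _ do rewrite ge0_muleDr//.
rewrite ge0_integralD//=; last 4 first.
- by move=> y _; rewrite mule_ge0.
- exact: emeasurable_funM.
- by move=> y _; rewrite mule_ge0.
- by apply: emeasurable_funM => //; exact: measurable_cst.
congr (_ + _)%E.
  rewrite -ge0_integralZl_real//; last 2 first.
  - exact: emeasurable_funM.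
  - by move=> y; rewrite mule_ge0.
  by apply: eq_integral => y _; rewrite muleCA.
transitivity (\int[mu]_y (d%:E * (heat_kernel t (y - x)%R)%:E))%E.
  by apply: eq_integral => y _; rewrite muleC -heat_kernelN opprB.
rewrite ge0_integralZl_real//; last 2 first.
- apply/measurable_EFinP; have := measurable_heat_kernel_l t x.
  by apply: eq_measurable_fun => y _; rewrite -heat_kernelN opprB.
- by move=> y; rewrite lee_fin heat_kernel_ge0.
by rewrite integral_heat_kernel// mule1.
Qed.

Lemma heat_kernel_time_le s t z : 0 < s -> s <= t -> t <= 2 * s ->
  heat_kernel s z <= 2 `^ (n%:R / 2) * heat_kernel t z.
Proof.
move=> s0 st ts; have t0 : 0 < t by exact: lt_le_trans st.
have p0 : 0 < 4 * pi :> R by rewrite mulr_gt0// pi_gt0.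
rewrite /heat_kernel mulrA; apply: ler_pM; rewrite ?powR_ge0 ?expR_ge0//.
  have A0 : 0 < 4 * pi * s by rewrite mulr_gt0.
  have B0 : 0 < 4 * pi * t by rewrite mulr_gt0.
  rewrite !powRN ler_pdivlMr ?powR_gt0// mulrC ler_pdivrMr ?powR_gt0// -powRM ?(ltW A0)//.
  apply: ge0_ler_powR; first by rewrite divr_ge0.
  - by rewrite nnegrE ltW.
  - by rewrite nnegrE; exact: mulr_ge0 (ler0n _ 2) (ltW A0).
  - by rewrite mulrCA ler_pM2l.
rewrite ler_expR lerN2 ler_wpM2l ?sqr_ge0// lef_pV2 ?posrE ?mulr_gt0//.
by rewrite ler_pM2l.
Qed.

Lemma heat_abs_ge0 t (g : 'rV[R]_n -> R) x : (0 <= heat_abs t g x)%E.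
Proof. by apply: heatE_ge0 => y; rewrite lee_fin. Qed.

(** What hypotheses (a) and (b) have in common: P_t v is differentiable for t > 0 with derivative
    P_t g. The function v itself need not be differentiable. *)
Record heat_gradient (v : 'rV[R]_n -> R) (i : 'I_n) (g : 'rV[R]_n -> R) : Prop := HeatGradient {
  heat_gradient_measurable : measurable_fun setT g ;
  heat_gradient_fin : forall t x, 0 < t -> (heat_abs t g x < +oo)%E ;
  heat_gradient_derive : forall t x, 0 < t ->
    is_derive x (unit_vec i) (heat_convolution t v) (heat_convolution t g x) }.

(** The mean value theorem evaluates P_t g at a point of the segment, and [heat_kernel_shift_le]
    moves that point back to x at the price of a doubled time. *)
Lemma heat_gradient_lip : exists2 C : R, 0 <= C & forall (v g : 'rV[R]_n -> R) i t h x,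
  heat_gradient v i g -> 0 < t -> h ^+ 2 <= t ->
  ((`|heat_convolution t v (x + h *: unit_vec i) - heat_convolution t v x|)%:E <=
  (`|h| * C)%:E * heat_abs (2 * t) g x)%E.
Proof.
have [C C0 CP] := @heat_kernel_shift_le R n; exists C => // v g i t h x [mg fin dg] t0 ht.
have [c hc E] := @MVT_between R (fun r => heat_convolution t v (x + r *: unit_vec i))
  (fun r => heat_convolution t g (x + r *: unit_vec i)) 0 h
  (fun r _ => let: And := dg t (x + r *: unit_vec i) t0 in
    is_derive_eq (is_derive_line (@ex_derive _ _ _ _ _ _ _ And)) (@derive_val _ _ _ _ _ _ _ And)).
rewrite scale0r addr0 subr0 in E; rewrite E normrM.
have ch : c ^+ 2 <= t.
  apply: le_trans ht; rewrite -(real_normK (num_real c)) -(real_normK (num_real h)).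
  rewrite lerXn2r ?nnegrE//; move: hc; have [h0|h0] := leP 0 h => /andP[c1 c2].
    by rewrite !ger0_norm.
  by rewrite (ler0_norm c2) (ltr0_norm h0) lerN2.
rewrite EFinM muleC EFinM -muleA; apply: lee_wpmul2l; first by rewrite lee_fin.
apply: le_trans (heat_abs_bound mg (fin _ _ t0)) _.
apply: heatE_kernel_le => //.
- by apply/measurable_EFinP; exact: measurableT_comp.
- by move=> y; rewrite addrAC; exact: CP.
Qed.

End heat_comparison.

Section initial_gradient.
Context {R : realType} {n : nat}.
Variables (p : R) (u0 : 'rV[R]_n -> R) (u : R -> 'rV[R]_n -> R).
Hypothesis p1 : 1 < p.
Hypothesis hu0 : u0 \in Lfun (lebesgue_rV n) +oo%E.
Hypothesis hu : classical_solution p u0 +oo%E u.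
Local Notation mu := (@lebesgue_rV R n).
Local Notation leb := (@lebesgue_measure R).
Local Notation f := (power_nonlinearity p).

Definition truncation_of (v0 : 'rV[R]_n -> R) (K : R) := [/\ measurable_fun setT v0,
  forall z, `|v0 z| <= K & forall k : 'rV[R]_n -> R, measurable_fun setT k ->
    \int[mu]_y (k y * u0 y) = \int[mu]_y (k y * v0 y)].

(* The time step is k^3 and the space step k^2, so that k^2 <= sqrt (k^3) and
   k^3 = o(k^2). *)
Lemma solution_grad_le : exists2 t0 : R, 0 < t0 & exists2 C : R, 0 <= C &
  forall v0 K0 i g x, truncation_of v0 K0 -> heat_gradient v0 i g ->
  ((`|'D_(unit_vec i) (u t0) x|)%:E <= C%:E * heat_abs (2 * t0) g x)%E.
Proof.
have [B B0 uB] := solution_bounded hu 1.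
have jU := joint_bounded_solution hu B0 uB; have jF := joint_bounded_source p1 jU.
pose U := time_cut 1 u; pose F := source p u 1.
pose L := p * B `^ (p - 1).
have L0 : 0 <= L by rewrite mulr_ge0 ?powR_ge0// ltW// (lt_trans ltr01).
have Bp0 : 0 <= B `^ p by exact: powR_ge0.
(* With L the Lipschitz constant of the source on [-B, B], this gives L t0 <= 1/2 for Gronwall and
   t0 <= 1. *)
pose t0 : R := (2 * (L + 1))^-1.
have L1 : 0 < 2 * (L + 1) by rewrite mulr_gt0// ltr_wpDl.
have t00 : 0 < t0 by rewrite invr_gt0.
have t01 : t0 <= 1 by rewrite invf_le1//; lra.
have Lt0 : L * t0 <= 2^-1.
  by rewrite /t0 ler_pdivrMr//; lra.
have [C1 C10 C1P] := @heat_gradient_lip R n.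
pose D := 2 `^ (n%:R / 2) : R; have D0 : 0 <= D by exact: powR_ge0.
exists t0 => //; exists (2 * (C1 * D)); first by rewrite !mulr_ge0.
move=> v0 K0 i g x [mv0 v0K v0E] hg; pose e := @unit_vec R n i.
have [mg fin dg] := hg.
have t20 : 0 < 2 * t0 by rewrite mulr_gt0.
have Hfin := fin _ x t20; have H0 := heat_abs_ge0 (2 * t0) g x.
pose H := fine (heat_abs (2 * t0) g x).
have HE : heat_abs (2 * t0) g x = H%:E by rewrite fineK// ge0_fin_numE.
have H00 : 0 <= H by rewrite fine_ge0.
(* Gronwall is started at the time [ep] and not at 0, because increments of v0 itself are not
   controlled by g; those of P_ep v0 are. *)
have step (k : R) : 0 < k -> k <= 1 -> k ^+ 3 < t0 ->
    `|u t0 (x + k ^+ 2 *: e) - u t0 x| <= k ^+ 2 * (2 * (C1 * D) * H + 4 * B `^ p * k).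
  move=> k0 k1 kt; set h := k ^+ 2; set ep := k ^+ 3.
  have h0 : 0 <= h by rewrite sqr_ge0.
  have ep0 : 0 < ep by rewrite exprn_gt0.
  have hep : h ^+ 2 <= ep.
    by rewrite /h /ep -exprM (exprS k 3) ler_piMl ?exprn_ge0// ltW.
  have ep1 : ep <= 1 by exact: le_trans (ltW kt) t01.
  pose v s y := U s (y + h *: e) - U s y.
  pose G s y := F s (y + h *: e) - F s y.
  have jv : joint_bounded v (B + B).
    have j1 := joint_bounded_shift (h *: e) jU.
    split; first by apply: measurable_funB; [exact: j1.1|exact: jU.1].
    by move=> s y; apply: le_trans (ler_normB _ _) _; apply: lerD; [exact: j1.2|exact: jU.2].
  have jG : joint_bounded G (B `^ p + B `^ p).
    have j1 := joint_bounded_shift (h *: e) jF.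
    split; first by apply: measurable_funB; [exact: j1.1|exact: jF.1].
    by move=> s y; apply: le_trans (ler_normB _ _) _; apply: lerD; [exact: j1.2|exact: jF.2].
  have sm : mild U F ep 1 by exact: (solution_mild p1 hu0 hu).
  have mv : mild v G ep t0.
    have q : mild v G ep 1.
      apply: (mild_shiftB (V := fun=> B) (h *: e) sm jF).
        by move=> s _ _; exact: joint_bounded_slice jU.
      by move=> s y _ _; exact: jU.2.
    by move=> a b z epa ab bt; apply: q => //; exact: le_trans bt t01.
  have gron := mild_gronwall x mv jG jv kt L0.
  have {}gron : `|v t0 x| <= 2 * heat_convolution (t0 - ep) (fun y => `|v ep y|) x.
    apply: gron; first by apply: le_trans Lt0; rewrite ler_wpM2l// lerBlDr lerDl ltW.
    by move=> s y _ _; exact: (power_lip p1 (jU.2 _ _) (jU.2 _ _)).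
  (* The heat part gives the main term, linear in h; the Duhamel part over [0, ep] is only known to
     be O(ep), which disappears after division by h. *)
  have vep y : ((`|v ep y|)%:E <= (h * C1)%:E * heat_abs (2 * ep) g y + (2 * B `^ p * ep)%:E)%E.
    have E z : U ep z = heat_convolution ep v0 z + \int[leb]_(s in `[0, ep[) propag ep F s z.
      exact: (solution_duhamel p1 hu z v0E ep0 ep1).
    have jP := joint_bounded_propag ep jF.
    have I z : `|\int[leb]_(s in `[0, ep[) propag ep F s z| <= B `^ p * ep.
      by have := Rintegral_joint_bound z (ltW ep0) jP; rewrite subr0.
    have lip := C1P v0 g i ep h y hg ep0 hep; rewrite (ger0_norm h0) in lip.
    apply: le_trans (leeD lip (lexx _)).
    rewrite -EFinD lee_fin /v !E.
    set a1 := heat_convolution _ _ _; set a2 := heat_convolution _ _ y.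
    have := I (y + h *: e); have := I y.
    set b1 := \int[leb]_(s in _) _; set b2 := \int[leb]_(s in _) _ => I1 I2.
    have -> : a1 + b2 - (a2 + b1) = (a1 - a2) + (b2 - b1) by ring.
    apply: le_trans (ler_normD _ _) _; rewrite lerD2l.
    rewrite -mulrA; exact: (ler_normB2 I2 I1).
  have te : 0 < t0 - ep by rewrite subr_gt0.
  have mvep := joint_bounded_slice ep jv.
  have mabs : measurable_fun setT (fun y => (`|g y|)%:E).
    by apply/measurable_EFinP; exact: measurableT_comp.
  have heat1 : ((heat_convolution (t0 - ep) (fun y => `|v ep y|) x)%:E <=
      (h * C1 * D * H + 2 * B `^ p * ep)%:E)%E.
    rewrite (heat_convolution_EFin (K := B + B))//; last 2 first.
    - exact: measurableT_comp.
    - by move=> z; rewrite normr_id; exact: jv.2.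
    have mh : measurable_fun setT (heat_abs (2 * ep) g) by apply: measurable_heatE.
    have hC : 0 <= h * C1 by exact: mulr_ge0.
    have cB : 0 <= 2 * B `^ p * ep by exact: (mulr_ge0 (mulr_ge0 (ler0n R 2) Bp0) (ltW ep0)).
    apply: le_trans (_ : heatE (t0 - ep) (fun y => (h * C1)%:E * heat_abs (2 * ep) g y + (2 * B `^ p * ep)%:E) x <= _)%E.
      apply: le_heatE.
      - by apply/measurable_EFinP; exact: measurableT_comp.
      - by apply: emeasurable_funD => //; apply: emeasurable_funM => //; exact: measurable_cst.
      - by move=> z; rewrite lee_fin.
      - exact: vep.
    rewrite (heatE_affine x te hC cB mh (heat_abs_ge0 (2 * ep) g)).
    rewrite heatE_semigroup ?mulr_gt0//.
    (* The time t0 + ep is replaced by 2 t0 through [heat_kernel_time_le], so that the bound no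
       longer depends on ep. *)
    have -> : t0 - ep + 2 * ep = t0 + ep by ring.
    rewrite EFinD leeD2r//.
    have -> : ((h * C1 * D * H)%:E = (h * C1)%:E * (D%:E * heat_abs (2 * t0) g x))%E.
      by rewrite HE -!EFinM mulrA.
    apply: lee_wpmul2l; first by rewrite lee_fin.
    apply: heatE_kernel_le => // y; apply: heat_kernel_time_le; first exact: addr_gt0.
      by rewrite mulr_natl mulr2n lerD2l ltW.
    by rewrite mulrDr lerDl mulr_ge0// ltW.
  have <- : v t0 x = u t0 (x + h *: e) - u t0 x by rewrite /v /U time_cutE.
  apply: le_trans gron _.
  rewrite lee_fin in heat1; apply: le_trans (ler_wpM2l _ heat1) _ => //.
  rewrite le_eqVlt; apply/orP; left; apply/eqP; rewrite /h /ep; ring.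
have d := @is_derive_line R n (u t0) x e 0.
rewrite scale0r addr0 in d; have {}d := d (@solution_derivable R n p u0 u hu i t0 x t00).
have i0 m : 0 < (m.+1%:R^-1 : R) by rewrite invr_gt0.
pose k_ m : R := m.+1%:R^-1.
have kc : k_ m @[m --> \oo] --> 0 by exact: cvg_inv_succ.
have k2 m : k_ m ^+ 2 != 0 by rewrite gt_eqF// exprn_gt0// /k_.
have k2c : k_ m ^+ 2 @[m --> \oo] --> 0.
  by under eq_fun do rewrite expr2; rewrite -(mul0r (0 : R)); exact: cvgM.
rewrite HE -EFinM lee_fin; apply/ler_addgt0Pr => dl dl0.
apply: (cvg_le_cst (cvg_norm (seq_is_derive d k2 k2c))).
have c4 : 4 * B `^ p * k_ m @[m --> \oo] --> 0.
  by rewrite -(mulr0 (4 * B `^ p)); apply: cvgM => //; exact: cvg_cst.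
have c3 : k_ m ^+ 3 @[m --> \oo] --> 0.
  by under eq_fun do rewrite exprS; rewrite -(mul0r (0 : R)); exact: cvgM.
have n4 : \forall m \near \oo, 4 * B `^ p * k_ m < dl by exact: (cvgr_lt _ c4).
have n3 : \forall m \near \oo, k_ m ^+ 3 < t0 by exact: (cvgr_lt _ c3).
apply: filterS2 n3 n4 => m kt kd.
have k1 : k_ m <= 1 by rewrite invf_le1// ler1n.
rewrite addr0 scale0r addr0 normrM normfV [`|k_ m ^+ 2|]ger0_norm ?sqr_ge0//.
rewrite ler_pdivrMr ?exprn_gt0 ?i0// mulrC.
apply: le_trans (step _ (i0 m) k1 kt) _; rewrite ler_wpM2l ?sqr_ge0// lerD2l.
exact: ltW.
Qed.

End initial_gradient.

(** * Gaussian averages of the initial gradient *)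

Section heat_squares.
Context {R : realType} {n : nat}.
Implicit Types (x y a : 'rV[R]_n) (t T C K e : R) (g h : 'rV[R]_n -> R).
Local Notation mu := (@lebesgue_rV R n).

(* P_t(g^2)(x), possibly infinite. *)
Definition heat_sqr t g x : \bar R := heatE t (fun y => (g y ^+ 2)%:E) x.

Lemma measurable_EFin_sqr g : measurable_fun setT g -> measurable_fun setT (fun y => (g y ^+ 2)%:E).
Proof. by move=> mg; apply/measurable_EFinP; under eq_fun do rewrite expr2; exact: measurable_funM. Qed.

(** Jensen's inequality, by applying P_t to 2 A |g| <= g^2 + A^2 with A = P_t |g|(x). *)
Lemma heat_abs_sqr t g x : 0 < t -> measurable_fun setT g -> (heat_abs t g x < +oo)%E ->
  ((fine (heat_abs t g x) ^+ 2)%:E <= heat_sqr t g x)%E.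
Proof.
move=> t0 mg fin; have A0 := heat_abs_ge0 t g x.
set A := fine (heat_abs t g x).
have AE : heat_abs t g x = A%:E by rewrite fineK// ge0_fin_numE.
have A00 : 0 <= A by rewrite fine_ge0.
have mabs : measurable_fun setT (fun y => (`|g y|)%:E).
  by apply/measurable_EFinP; exact: measurableT_comp.
have msq := measurable_EFin_sqr mg.
have A20 : 0 <= 2 * A by rewrite mulr_ge0.
have h : (heatE t (fun y => (2 * A)%:E * (`|g y|)%:E + 0%:E) x <=
    heatE t (fun y => 1%:E * (g y ^+ 2)%:E + (A ^+ 2)%:E) x)%E.
  apply: le_heatE.
  - by apply: emeasurable_funD => //; apply: emeasurable_funM.
  - by apply: emeasurable_funD => //; apply: emeasurable_funM.
  - by move=> y; rewrite -EFinM -EFinD lee_fin addr_ge0// mulr_ge0.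
  - move=> y; rewrite -!EFinM -!EFinD lee_fin mul1r addr0 -(real_normK (num_real (g y))).
    by have := sqr_ge0 (`|g y| - A); rewrite sqrrB -mulr_natl; lra.
have abs0 y : (0 <= (`|g y|)%:E)%E by rewrite lee_fin.
have sq0 y : (0 <= (g y ^+ 2)%:E)%E by rewrite lee_fin sqr_ge0.
rewrite (heatE_affine x t0 A20 (lexx 0) mabs abs0) (heatE_affine x t0 ler01 (sqr_ge0 A) msq sq0) mul1e in h.
rewrite -/(heat_abs t g x) -/(heat_sqr t g x) AE -EFinM adde0 in h.
have : (0 <= heat_sqr t g x)%E by apply: heatE_ge0 => y; rewrite lee_fin sqr_ge0.
move: h; case: (heat_sqr t g x) => [r| |]//; rewrite ?leey//.
by rewrite -EFinD !lee_fin expr2; lra.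
Qed.

Lemma heat_squareE g t K a : 0 < t -> measurable_fun setT g -> (forall x, `|g x| <= K) ->
  (heat_square g t a)%:E = heat_sqr t g a.
Proof.
move=> t0 mg gK.
have mg2 : measurable_fun setT (fun z => g z ^+ 2).
  by under eq_fun do rewrite expr2; exact: measurable_funM.
rewrite /heat_square -(heat_convolutionE a t0 mg2).
rewrite (heat_convolution_EFin (K := K ^+ 2))//; first by move=> z; exact: sqr_ge0.
move=> z; rewrite normrX lerXn2r ?nnegrE//; exact: le_trans (gK z).
Qed.

Definition heat_decay (b : R) (g : 'I_n -> 'rV[R]_n -> R) := forall e, 0 < e ->
  exists2 T0, 0 < T0 & forall T i a, T0 <= T -> (heat_sqr T (g i) a <= (e * T `^ (- b))%:E)%E.

Lemma powR_decay (k C e : R) : 0 < k -> 0 <= C -> 0 < e ->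
  exists2 T0, 0 < T0 & forall T, T0 <= T -> C * T `^ (- k) <= e.
Proof.
move=> k0 C0 e0; exists (((C + 1) / e) `^ k^-1).
  by rewrite powR_gt0// divr_gt0// ltr_wpDl.
have q0 : 0 < (C + 1) / e by rewrite divr_gt0// ltr_wpDl.
move=> T T0T; have T0 : 0 < T by apply: lt_le_trans T0T; rewrite powR_gt0.
have h : (C + 1) / e <= T `^ k.
  have -> : (C + 1) / e = (((C + 1) / e) `^ k^-1) `^ k.
    by rewrite -powRrM mulVf ?gt_eqF// powRr1// ltW.
  by apply: ge0_ler_powR; rewrite ?nnegrE ?powR_ge0// ltW.
rewrite powRN ler_pdivrMr ?powR_gt0//; rewrite ler_pdivrMr// in h.
by apply: le_trans (_ : C + 1 <= _); rewrite ?lerDl// mulrC.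
Qed.

Lemma heat_kernel_le_cst t (z : 'rV[R]_n) : 0 < t -> heat_kernel t z <= (4 * pi) `^ (- (n%:R / 2)) * t `^ (- (n%:R / 2)).
Proof.
move=> t0; rewrite -powRM ?(ltW t0) ?mulr_ge0 ?pi_ge0// /heat_kernel ler_piMr ?powR_ge0//.
by rewrite -[leRHS]expR0 ler_expR oppr_le0 divr_ge0 ?sqr_ge0// mulr_ge0// ltW.
Qed.

Lemma heatE_le_integral t (f : 'rV[R]_n -> \bar R) a : 0 < t -> measurable_fun setT f -> (forall y, 0 <= f y)%E ->
  (heatE t f a <= ((4 * pi) `^ (- (n%:R / 2)) * t `^ (- (n%:R / 2)))%:E * \int[mu]_y f y)%E.
Proof.
move=> t0 mf f0.
have c0 : 0 <= (4 * pi) `^ (- (n%:R / 2)) * t `^ (- (n%:R / 2)) :> R by rewrite mulr_ge0 ?powR_ge0.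
rewrite -ge0_integralZl_real//; apply: ge0_le_integral => //.
- by move=> y _; rewrite mule_ge0// lee_fin heat_kernel_ge0.
- by apply: emeasurable_funM => //; apply/measurable_EFinP; exact: measurable_heat_kernel_l.
- by apply: emeasurable_funM => //; exact: measurable_cst.
- by move=> y _; rewrite lee_wpmul2r// lee_fin heat_kernel_le_cst.
Qed.

(** Stands in for Hölder's inequality: below the level lam the square is at most lam^2, above it the
    power q >= 2 wins. The level is chosen later. *)
Lemma sqr_le_interp (v w q lam : R) : 2 <= q -> 0 < lam -> `|v| <= w ->
  v ^+ 2 <= lam `^ (2 - q) * w `^ q + lam ^+ 2.
Proof.
move=> q2 l0 vw; rewrite -(real_normK (num_real v)).
have [vl|lv] := leP `|v| lam.
  apply: le_trans (_ : lam ^+ 2 <= _); first by rewrite lerXn2r ?nnegrE// ltW.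
  by rewrite lerDr mulr_ge0 ?powR_ge0.
have v0 : 0 < `|v| by exact: lt_trans lv.
apply: le_trans (_ : lam `^ (2 - q) * w `^ q <= _); last by rewrite lerDl sqr_ge0.
have -> : `|v| ^+ 2 = `|v| `^ (2 - q) * `|v| `^ q.
  by rewrite -powRD ?subrK ?powR_mulrn// (gt_eqF v0) implybT.
apply: ler_pM; rewrite ?powR_ge0//.
  rewrite -opprB !powRN lef_pV2 ?posrE ?powR_gt0//.
  by apply: ge0_ler_powR; rewrite ?nnegrE ?subr_ge0 ?(ltW l0) ?(ltW v0)// ltW.
have w0 : 0 <= w by exact: le_trans (ltW v0) vw.
by apply: (ge0_ler_powR _ _ _ vw); rewrite ?nnegrE// (le_trans _ q2).
Qed.

Lemma Lq_heat (g : 'rV[R]_n -> 'rV[R]_n) q : 2 <= q ->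
  measurable_fun setT g -> finite_norm mu q%:E (enorm \o g) ->
  exists2 A, 0 <= A & forall i t lam a, 0 < t -> 0 < lam ->
    (heat_sqr t (fun y => g y 0%R i) a <= (lam `^ (2 - q) * (A * t `^ (- (n%:R / 2))) + lam ^+ 2)%:E)%E.
Proof.
move=> q2 mg fin.
have q0 : 0 < q by exact: lt_le_trans q2.
have me : measurable_fun setT (fun y => enorm (g y)).
  have : measurable_fun setT (fun y => Num.sqrt (enorm (g y) ^+ 2)).
    apply: (measurableT_comp (continuous_measurable_fun (@sqrt_continuous R))).
    exact: (measurableT_comp measurable_enorm_sqr mg).
  by apply: eq_measurable_fun => y _; rewrite sqrtr_sqr ger0_norm// enorm_ge0.
pose I := (\int[mu]_y (enorm (g y) `^ q)%:E)%E.
have I0 : (0 <= I)%E by apply: integral_ge0 => y _; rewrite lee_fin powR_ge0.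
have Ifin : (I < +oo)%E.
  have h : ('N[mu]_q%:E[EFin \o (enorm \o g)] `^ q < +oo)%E by apply: poweR_lty.
  rewrite (@powR_Lnorm _ _ R mu (EFin \o (enorm \o g)) q (lt0r_neq0 q0)) in h.
  apply: le_lt_trans h; rewrite le_eqVlt; apply/orP; left; apply/eqP.
  by apply: eq_integral => y _; rewrite /= (ger0_norm (enorm_ge0 _)).
pose c : R := (4 * pi) `^ (- (n%:R / 2)).
exists (c * fine I); first by rewrite mulr_ge0 ?powR_ge0 ?fine_ge0.
move=> i t lam a t0 l0.
have mh : measurable_fun setT (fun y => (enorm (g y) `^ q)%:E).
  by apply/measurable_EFinP; exact: (measurableT_comp (measurable_powR q) me).
have h0 (y : 'rV[R]_n) : (0 <= (enorm (g y) `^ q)%:E)%E by rewrite lee_fin powR_ge0.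
have mgi : measurable_fun setT (fun y => g y 0 i) by exact: (measurableT_comp (measurable_coord i) mg).
apply: (@le_trans _ _ (heatE t (fun y => (lam `^ (2 - q))%:E * (enorm (g y) `^ q)%:E + (lam ^+ 2)%:E)%E a)).
  apply: le_heatE.
  - exact: measurable_EFin_sqr.
  - by apply: emeasurable_funD => //; apply: emeasurable_funM.
  - by move=> y; rewrite lee_fin sqr_ge0.
  - by move=> y; rewrite -EFinM -EFinD lee_fin; apply: sqr_le_interp => //; exact: coord_le_enorm.
rewrite (heatE_affine a t0 (powR_ge0 _ _) (sqr_ge0 lam) mh h0) [leRHS]EFinD leeD2r// [leRHS]EFinM.
apply: lee_wpmul2l; first by rewrite lee_fin powR_ge0.
apply: le_trans (heatE_le_integral a t0 mh h0) _.
by rewrite -/I -[X in (_ * X)%E](fineK (x := I)) ?ge0_fin_numE// -EFinM lee_fin -/c mulrAC.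
Qed.

(** The level lam = T^{-n/(2q)} makes both terms of [Lq_heat] multiples of T^{-n/q}, which is
    o(T^{-b}) because q b < n. *)
Lemma Lq_heat_decay (g : 'rV[R]_n -> 'rV[R]_n) q b : 2 <= q -> 0 < b -> q * b < n%:R ->
  measurable_fun setT g -> finite_norm mu q%:E (enorm \o g) ->
  heat_decay b (fun i y => g y 0 i).
Proof.
move=> q2 b0 qb mg fin e e0.
have q0 : 0 < q by exact: lt_le_trans q2.
have [A A0 hA] := Lq_heat q2 mg fin.
have k0 : 0 < n%:R / q - b by rewrite subr_gt0 ltr_pdivlMr// mulrC.
have [T0 T00 hT] := powR_decay k0 (addr_ge0 A0 ler01) e0.
exists T0 => // T i a T0T; have TT : 0 < T by exact: lt_le_trans T0T.
have lam0 : 0 < T `^ (- (n%:R / (2 * q))) by rewrite powR_gt0.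
apply: le_trans (hA i T _ a TT lam0) _; rewrite lee_fin.
have -> : T `^ (- (n%:R / (2 * q))) ^+ 2 = T `^ (- (n%:R / q)).
  by rewrite -powR_mulrn ?powR_ge0// -powRrM; congr (_ `^ _); field; rewrite gt_eqF.
have -> : T `^ (- (n%:R / (2 * q))) `^ (2 - q) * (A * T `^ (- (n%:R / 2))) = A * T `^ (- (n%:R / q)).
  rewrite -powRrM mulrCA -powRD; last by rewrite (gt_eqF TT) implybT.
  by congr (_ * (_ `^ _)); field; rewrite gt_eqF.
rewrite -[X in _ + X]mul1r -mulrDl.
have -> : T `^ (- (n%:R / q)) = T `^ (- (n%:R / q - b)) * T `^ (- b).
  by rewrite -powRD ?(gt_eqF TT) ?implybT//; congr (_ `^ _); ring.
by rewrite mulrA ler_wpM2r ?powR_ge0// hT.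
Qed.

Definition cube (r : R) : set 'rV[R]_n := [set y | forall i, `]- r, r[%classic (y 0 i)].

Lemma measurable_cube r : measurable (cube r).
Proof.
rewrite (_ : cube r = \big[setI/setT]_(i < n) ((fun y : 'rV[R]_n => y 0 i) @^-1` `]- r, r[%classic)).
  apply: bigsetI_measurable => i _; rewrite -[X in measurable X]setTI.
  by apply: measurable_coord => //; exact: measurable_itv.
rewrite -bigcap_seq; apply/seteqP; split => y /= h i; first by move=> _; exact: h.
by apply: (h i); rewrite /= mem_index_enum.
Qed.

Lemma heatE_cube t r a : 0 < t -> 0 <= r ->
  (heatE t (fun y => (\1_(cube r) y)%:E) a <= ((4 * pi) `^ (- (n%:R / 2)) * t `^ (- (n%:R / 2)) * (2 * r) ^+ n)%:E)%E.
Proof.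
move=> t0 r0.
have m1 : measurable_fun setT (fun y => (\1_(cube r) y : R)%:E).
  by apply/measurable_EFinP; exact: measurable_indic (measurable_cube r).
apply: le_trans (heatE_le_integral a t0 m1 _) _; first by move=> y; rewrite lee_fin.
have E : mu (cube r) = ((2 * r) ^+ n)%:E.
  rewrite /cube (@lebesgue_rV_box R n (fun=> `]- r, r[%classic)); last by move=> i; exact: measurable_itv.
  rewrite (eq_bigr (fun=> (2 * r)%:E)); last first.
    move=> i _; rewrite lebesgue_measure_itv/= lte_fin.
    case: ifPn => [_|]; first by rewrite -EFinB opprK mulr_natl mulr2n.
    rewrite -leNgt => h; have -> : r = 0 by apply/eqP; rewrite eq_le r0 andbT; lra.
    by rewrite mulr0.
  by rewrite prodEFin prodr_const card_ord.
rewrite integral_indic//; last exact: measurable_cube.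
rewrite setIT [leRHS]EFinM; apply: lee_wpmul2l; first by rewrite lee_fin mulr_ge0 ?powR_ge0.
by rewrite -E.
Qed.

(* The complement of the cube of side 2r is split into the shells between the
   cubes of radii 2^k r. *)
Lemma dyadic_majorant (F : 'rV[R]_n -> R) (M e r0 gam : R) (k : nat) : 0 < r0 -> 0 <= M -> 0 <= e ->
  gam < n%:R -> (forall y, F y <= M) ->
  (forall r y, r0 <= r -> ~ cube r y -> F y <= e * r `^ (- gam)) ->
  exists b : 'rV[R]_n -> R, [/\ measurable_fun setT b, forall y, 0 <= b y,
    forall y, F y <= b y + e * (2 ^+ k * r0) `^ (- gam) &
    forall t a, 0 < t -> (heatE t (EFin \o b) a <= ((4 * pi) `^ (- (n%:R / 2)) * t `^ (- (n%:R / 2)) *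
      (M * (2 * r0) ^+ n + e * (4 ^+ n / (2 `^ (n%:R - gam) - 1)) * (2 ^+ k * r0) `^ (n%:R - gam)))%:E)%E].
Proof.
move=> r00 M0 e0 gn FM Fe.
have D1 : 0 < 2 `^ (n%:R - gam) - 1 :> R.
  have one : 1 = 1 `^ (n%:R - gam) :> R by rewrite powR1.
  by rewrite subr_gt0 [ltLHS]one; apply: gt0_ltr_powR; rewrite ?subr_gt0 ?nnegrE// ltr1n.
(* Chosen so that the geometric sum over the shells closes: D r^{n-gam} + 4^n r^{n-gam} = D
   (2r)^{n-gam}. *)
set D := 4 ^+ n / _; have D0 : 0 <= D by rewrite divr_ge0 ?exprn_ge0// ltW.
pose c t : R := (4 * pi) `^ (- (n%:R / 2)) * t `^ (- (n%:R / 2)).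
have c0 t : 0 <= c t by rewrite mulr_ge0 ?powR_ge0.
have step (b : 'rV[R]_n -> R) (m r A B : R) : measurable_fun setT b -> (forall y, 0 <= b y) -> 0 <= m -> 0 <= r ->
    (forall t a, 0 < t -> (heatE t (EFin \o b) a <= (c t * A)%:E)%E) -> A + m * (2 * r) ^+ n <= B ->
    [/\ measurable_fun setT (fun y => b y + m * \1_(cube r) y), forall y, 0 <= b y + m * \1_(cube r) y &
    forall t a, 0 < t -> (heatE t (fun y => (b y + m * \1_(cube r) y)%:E) a <= (c t * B)%:E)%E].
  move=> mb b0 m0 r1 hb AB.
  have m1 : measurable_fun setT (\1_(cube r) : 'rV[R]_n -> R) by exact: measurable_indic (measurable_cube r).
  have mm1 : measurable_fun setT (fun y => m * \1_(cube r) y : R) by exact: measurable_funM.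
  split; [exact: measurable_funD|by move=> y; rewrite addr_ge0// mulr_ge0|].
  move=> t a t0.
  have mk : measurable_fun setT (fun y => (heat_kernel t (a - y)%R)%:E).
    by apply/measurable_EFinP; exact: measurable_heat_kernel_l.
  have -> : (heatE t (fun y => (b y + m * \1_(cube r) y)%:E) a =
      heatE t (EFin \o b) a + heatE t (fun y => m%:E * (\1_(cube r) y)%:E + 0%:E) a)%E.
    rewrite -ge0_integralD//=.
    - apply: eq_integral => y _; rewrite EFinD EFinM adde0 ge0_muleDr// ?lee_fin//.
      by rewrite mulr_ge0.
    - by move=> y _; rewrite mule_ge0// lee_fin// heat_kernel_ge0.
    - by apply: emeasurable_funM => //; exact/measurable_EFinP.
    - move=> y _; apply: mule_ge0; first by rewrite lee_fin heat_kernel_ge0.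
      by rewrite adde0 -EFinM lee_fin mulr_ge0.
    - apply: emeasurable_funM => //; apply: emeasurable_funD => //; apply: emeasurable_funM => //.
      exact/measurable_EFinP.
  rewrite (heatE_affine a t0 m0 (lexx 0)); [|exact/measurable_EFinP|by move=> y; rewrite lee_fin].
  rewrite adde0; apply: le_trans (leeD (hb t a t0) (lee_wpmul2l _ (heatE_cube a t0 r1))) _.
    by rewrite lee_fin.
  rewrite -EFinM -EFinD lee_fin -/(c t).
  have -> : c t * A + m * (c t * (2 * r) ^+ n) = c t * (A + m * (2 * r) ^+ n) by ring.
  by rewrite ler_wpM2l.
have c00 t a : 0 < t -> (heatE t (EFin \o (fun=> 0%R)) a <= (c t * 0)%:E)%E.
  by move=> t0; rewrite mulr0 /heatE integral0_eq// => y _; rewrite mule0.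
elim: k => [|k [b [mb b0 Fb hb]]].
  have [|q1 q2 q3] := step (fun=> 0) M r0 0 (M * (2 * r0) ^+ n + e * D * (2 ^+ 0 * r0) `^ (n%:R - gam))
    (measurable_cst _) (fun=> lexx 0) M0 (ltW r00) c00 _.
    by rewrite add0r lerDl mulr_ge0 ?powR_ge0// mulr_ge0.
  exists (fun y => 0 + M * \1_(cube r0) y); split => // y; rewrite add0r expr0 mul1r.
  have [cy|cy] := pselect (cube r0 y).
    rewrite indicE mem_set// mulr1; apply: le_trans (FM y) _.
    by rewrite lerDl mulr_ge0 ?powR_ge0.
  by rewrite indicE memNset// mulr0 add0r; exact: Fe (lexx r0) cy.
set rk := 2 ^+ k * r0 in Fb hb.
have rk0 : 0 < rk by rewrite mulr_gt0 ?exprn_gt0.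
have rE : 2 ^+ k.+1 * r0 = 2 * rk by rewrite exprS mulrA.
rewrite rE.
have m0 : 0 <= e * rk `^ (- gam) by rewrite mulr_ge0 ?powR_ge0.
have r20 : 0 <= 2 * rk by rewrite mulr_ge0// ltW.
have [|q1 q2 q3] := step b (e * rk `^ (- gam)) (2 * rk) _ (M * (2 * r0) ^+ n + e * D * (2 * rk) `^ (n%:R - gam))
  mb b0 m0 r20 hb.
  rewrite -addrA lerD2l -!mulrA -mulrDr ler_wpM2l// le_eqVlt; apply/orP; left; apply/eqP.
  rewrite (powRM _ (ler0n R 2) (ltW rk0)).
  have -> : rk `^ (- gam) * (2 * (2 * rk)) ^+ n = 4 ^+ n * rk `^ (n%:R - gam).
    have -> : 2 * (2 * rk) = 4 * rk by ring.
    rewrite exprMn mulrCA -(powR_mulrn n (ltW rk0)) -powRD ?(gt_eqF rk0) ?implybT//.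
    by congr (_ * _ `^ _); ring.
  rewrite /D; field; rewrite gt_eqF//.
exists (fun y => b y + e * rk `^ (- gam) * \1_(cube (2 * rk)) y); split => // y.
have [cy|cy] := pselect (cube (2 * rk) y).
  rewrite indicE mem_set// mulr1; apply: le_trans (Fb y) _.
  by rewrite lerDl mulr_ge0 ?powR_ge0.
rewrite indicE memNset// mulr0 addr0; apply: le_trans (_ : e * (2 * rk) `^ (- gam) <= _).
  apply: Fe => //; rewrite /rk mulrA -[leLHS]mul1r ler_wpM2r ?(ltW r00)//.
  by rewrite -exprS exprn_ege1// ler1n.
by rewrite lerDr.
Qed.

End heat_squares.

Section gradient_decays.
Context {R : realType} {n : nat}.
Implicit Types (x y a : 'rV[R]_n) (g : 'rV[R]_n -> R).
Local Notation mu := (@lebesgue_rV R n).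

(** The inner cube contributes O(T^{-n/2}) = o(T^{-b}). The shells up to radius about sqrt(T)
    contribute e T^{-n/2} T^{(n-2b)/2} = e T^{-b} up to a constant, and so does the region beyond;
    both use 2 b < n or the pointwise decay. *)
Lemma pointwise_heat_decay (b M : R) (G : 'I_n -> 'rV[R]_n -> R) : 0 < b -> 2 * b < n%:R -> 0 <= M ->
  (forall i, measurable_fun setT (G i)) -> (forall i y, G i y ^+ 2 <= M) ->
  (forall e : R, 0 < e -> exists2 r0, 0 < r0 & forall i r y, r0 <= r -> ~ cube r y ->
    G i y ^+ 2 <= e * r `^ (- (2 * b))) ->
  heat_decay b G.
Proof.
move=> b0 bn M0 mG GM Ge eta eta0.
pose c : R := (4 * pi) `^ (- (n%:R / 2)); have c0 : 0 <= c by exact: powR_ge0.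
pose D : R := 4 ^+ n / (2 `^ (n%:R - 2 * b) - 1).
have D1 : 0 < 2 `^ (n%:R - 2 * b) - 1 :> R.
  have one : 1 = 1 `^ (n%:R - 2 * b) :> R by rewrite powR1.
  by rewrite subr_gt0 [ltLHS]one; apply: gt0_ltr_powR; rewrite ?subr_gt0 ?nnegrE// ltr1n.
have D0 : 0 <= D by rewrite divr_ge0 ?exprn_ge0// ltW.
pose X := c * D * 2 `^ (n%:R - 2 * b) + 1.
have cD0 : 0 <= c * D * 2 `^ (n%:R - 2 * b) by apply: mulr_ge0; [exact: mulr_ge0|exact: powR_ge0].
have X0 : 0 < X by rewrite /X ltr_wpDl.
pose e := eta / 2 / X; have e0 : 0 < e by rewrite !divr_gt0.
have [r0 r00 Gr] := Ge e e0.
pose A := c * (M * (2 * r0) ^+ n).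
have A0 : 0 <= A by rewrite mulr_ge0// mulr_ge0// exprn_ge0// mulr_ge0// ltW.
have k0 : 0 < n%:R / 2 - b by lra.
have eta20 : 0 < eta / 2 by rewrite divr_gt0.
have [T1 T10 hT1] := powR_decay k0 A0 eta20.
exists (Num.max T1 (r0 ^+ 2)); first by rewrite lt_max T10.
move=> T i a; rewrite ge_max => /andP[T1T r0T]; have T0 : 0 < T by exact: lt_le_trans T1T.
have sT0 : 0 < Num.sqrt T by rewrite sqrtr_gt0.
have sT : r0 <= Num.sqrt T by rewrite -(ger0_norm (ltW r00)) -sqrtr_sqr ler_wsqrtr.
(* The outermost cube is given a radius comparable to the diffusion length sqrt(T). *)
have [k hk1 hk2] : exists2 k : nat, Num.sqrt T <= 2 ^+ k * r0 & 2 ^+ k * r0 <= 2 * Num.sqrt T.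
  have ex : exists k : nat, Num.sqrt T <= 2 ^+ k * r0.
    have [m hm] : exists m : nat, Num.sqrt T / r0 < m%:R by exists (Num.bound (Num.sqrt T / r0)); apply: archi_boundP; rewrite divr_ge0// ltW.
    exists m; rewrite -ler_pdivrMr//; apply: le_trans (ltW hm) _.
    by rewrite -natrX ler_nat ltnW// ltn_expl.
  case: (ex_minnP ex) => -[|k] hk kmin; first by exists 0%N => //; rewrite expr0 mul1r; lra.
  exists k.+1 => //; rewrite exprS -mulrA ler_pM2l//; apply/ltW; rewrite ltNge; apply/negP => /kmin.
  by rewrite ltnn.
have [B [mB B0 FB hB]] := dyadic_majorant k r00 M0 (ltW e0) bn (GM i) (Gr i).
set rk := 2 ^+ k * r0 in hk1 hk2 FB hB.
have rk0 : 0 < rk by exact: lt_le_trans hk1.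
have erk : 0 <= e * rk `^ (- (2 * b)) by rewrite mulr_ge0 ?powR_ge0// ltW.
have mB' : measurable_fun setT (EFin \o B) by exact/measurable_EFinP.
have B0' y : (0 <= (EFin \o B) y)%E by rewrite lee_fin.
have h : (heat_sqr T (G i) a <= heatE T (fun y => 1%:E * (EFin \o B) y + (e * rk `^ (- (2 * b)))%:E)%E a)%E.
  apply: le_heatE.
  - exact: measurable_EFin_sqr.
  - by apply: emeasurable_funD => //; apply: emeasurable_funM.
  - by move=> y; rewrite lee_fin sqr_ge0.
  - by move=> y; rewrite mul1e /= -EFinD lee_fin.
apply: (le_trans h); rewrite (heatE_affine a T0 ler01 erk mB' B0') mul1e.
apply: le_trans (leeD (hB T a T0) (lexx _)) _.
rewrite -EFinD lee_fin -/c -/D.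
have p1 : rk `^ (- (2 * b)) <= T `^ (- b).
  rewrite !powRN lef_pV2 ?posrE ?powR_gt0//.
  have -> : T `^ b = Num.sqrt T `^ (2 * b).
    by rewrite -powR12_sqrt ?(ltW T0)// -powRrM; congr (_ `^ _); field.
  by apply: ge0_ler_powR; rewrite ?nnegrE ?(ltW rk0) ?mulr_ge0// ltW.
have p2 : T `^ (- (n%:R / 2)) * rk `^ (n%:R - 2 * b) <= 2 `^ (n%:R - 2 * b) * T `^ (- b).
  apply: le_trans (_ : T `^ (- (n%:R / 2)) * (2 * Num.sqrt T) `^ (n%:R - 2 * b) <= _).
    rewrite ler_wpM2l ?powR_ge0//; apply: ge0_ler_powR; rewrite ?nnegrE ?subr_ge0 ?(ltW rk0) ?(ltW bn)//.
  rewrite (powRM _ (ler0n R 2) (ltW sT0)) mulrCA ler_wpM2l ?powR_ge0//.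
  rewrite -powR12_sqrt ?(ltW T0)// -powRrM -powRD ?(gt_eqF T0) ?implybT//.
  by rewrite le_eqVlt; apply/orP; left; apply/eqP; congr (_ `^ _); field.
have p3 := hT1 T T1T.
have p3' : c * T `^ (- (n%:R / 2)) * (M * (2 * r0) ^+ n) <= eta / 2 * T `^ (- b).
  have -> : T `^ (- (n%:R / 2)) = T `^ (- (n%:R / 2 - b)) * T `^ (- b).
    by rewrite -powRD ?(gt_eqF T0) ?implybT//; congr (_ `^ _); ring.
  have -> : c * (T `^ (- (n%:R / 2 - b)) * T `^ (- b)) * (M * (2 * r0) ^+ n) =
    A * T `^ (- (n%:R / 2 - b)) * T `^ (- b) by rewrite /A; ring.
  by rewrite ler_wpM2r ?powR_ge0.
have cD : 0 <= c * (e * D) by apply: mulr_ge0 => //; apply: mulr_ge0 => //; exact: ltW.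
have p4 := ler_wpM2l cD p2.
have p5 := ler_wpM2l (ltW e0) p1.
have -> : eta * T `^ (- b) = eta / 2 * T `^ (- b) + (c * (e * D) * (2 `^ (n%:R - 2 * b) * T `^ (- b)) + e * T `^ (- b)).
  have : e * X = eta / 2 by rewrite /e divfK// gt_eqF.
  move=> E; have -> : eta * T `^ (- b) = eta / 2 * T `^ (- b) + eta / 2 * T `^ (- b) by field.
  by rewrite -{2}E /X; ring.
rewrite mulrDr -addrA; apply: lerD => //; apply: lerD => //.
by apply: le_trans p4; rewrite le_eqVlt; apply/orP; left; apply/eqP; ring.
Qed.

Lemma bounded_fun_ge0 (h : 'rV[R]_n -> R) : bounded_fun h -> exists2 M, 0 <= M & forall x, `|h x| <= M.
Proof.
move=> [M [_ hM]]; exists (`|M| + 1); first by rewrite addr_ge0.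
by move=> x; apply: (hM (`|M| + 1)) => //; rewrite (le_lt_trans (ler_norm M))// ltrDl.
Qed.

Lemma BC1_heat_gradient (v : 'rV[R]_n -> R) i : BC1 v -> heat_gradient v i (partial i v).
Proof.
move=> [[cv dv] /bounded_fun_ge0[K K0 vK] /(_ i)/bounded_fun_ge0[M M0 vM]].
have [dvi cvi] := dv i.
have mv : measurable_fun setT v by exact: continuous_measurable_rV.
have mp : measurable_fun setT (partial i v) by exact: continuous_measurable_rV.
split => //; first by move=> t x t0; exact: heat_abs_fin t0 mp vM.
move=> t x t0; rewrite (heat_convolutionE x t0 mp); apply: line_is_derive.
have -> : (fun r : R => heat_convolution t v (x + r *: unit_vec i)) =
    (fun r => gexp (fun z => v (x + r *: unit_vec i + Num.sqrt t *: z))).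
  by apply/funext => r; rewrite heat_convolutionE.
have -> : gexp (fun z => partial i v (x + Num.sqrt t *: z)) =
    gexp (fun z => partial i v (x + 0 *: unit_vec i + Num.sqrt t *: z)).
  by apply: eq_gexp => z; rewrite scale0r addr0.
apply: (@is_derive_gexp _ _ (fun r z => v (x + r *: unit_vec i + Num.sqrt t *: z))
  (fun r z => partial i v (x + r *: unit_vec i + Num.sqrt t *: z)) 0 (-1) 1 M 0).
- by rewrite oppr_lt0 ltr01.
- by move=> r _; exact: tame_comp_affine vK.
- move=> r z _.
  have -> : (fun r : R => v (x + r *: unit_vec i + Num.sqrt t *: z)) =
      (fun r => v ((x + Num.sqrt t *: z) + r *: unit_vec i)).
    by apply/funext => q; rewrite addrAC.
  rewrite [x + _ + _]addrAC; exact: (is_derive_line (dvi _)).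
- by move=> r z _; rewrite expr0 mulr1.
Qed.

Lemma BC1_heat_decay (v : 'rV[R]_n -> R) b : 0 < b -> 2 * b < n%:R -> BC1 v ->
  (fun x => enorm (gradient v x)) =o_infty_rV (fun x => enorm x `^ (- b)) ->
  heat_decay b (fun i => partial i v).
Proof.
move=> b0 bn bc /eqoP ho.
have [[cv dv] _ bp] := bc.
have /boolp.choice[M hM] : forall i, exists M : R, 0 <= M /\ forall x, `|partial i v x| <= M.
  by move=> i; have [M M0 hM] := bounded_fun_ge0 (bp i); exists M.
have [MM MM0 hMM] : exists2 MM : R, 0 <= MM & forall i x, `|partial i v x| <= MM.
  exists (\sum_i M i); first by apply: sumr_ge0 => i _; case: (hM i).
  move=> i x; apply: le_trans ((hM i).2 x) _.
  by rewrite (bigD1 i)//= lerDl; apply: sumr_ge0 => j _; case: (hM j).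
apply: (@pointwise_heat_decay b (MM ^+ 2)) => //; first exact: sqr_ge0.
- by move=> i; apply: continuous_measurable_rV; case: (dv i).
- by move=> i y; rewrite -(real_normK (num_real (partial i v y))) lerXn2r ?nnegrE.
move=> e e0; have se : 0 < Num.sqrt e by rewrite sqrtr_gt0.
have [A _ hA] := ho _ se.
exists (`|A| + 1); first by rewrite ltr_wpDl.
move=> i r y rA /existsNP[j hj].
have r0 : 0 < r by apply: lt_le_trans rA; rewrite ltr_wpDl.
have ry : r <= enorm y.
  apply: le_trans (coord_le_enorm y j); rewrite leNgt; apply/negP; rewrite ltr_norml => h.
  by apply: hj; rewrite /= in_itv.
have y0 : 0 < enorm y by exact: lt_le_trans ry.
have Ay : A < enorm y.
  by apply: lt_le_trans ry; apply: lt_le_trans rA; rewrite (le_lt_trans (ler_norm A))// ltrDl.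
have := hA y Ay; rewrite /= (ger0_norm (enorm_ge0 _)) (ger0_norm (powR_ge0 _ _)) => h.
have gi : `|partial i v y| <= Num.sqrt e * r `^ (- b).
  have := coord_le_enorm (gradient v y) i; rewrite mxE => q.
  apply: le_trans q (le_trans h _); rewrite ler_wpM2l ?sqrtr_ge0//.
  rewrite !powRN lef_pV2 ?posrE ?powR_gt0//.
  by apply: ge0_ler_powR; rewrite ?nnegrE ?(ltW r0) ?(ltW y0)// ltW.
rewrite -(real_normK (num_real (partial i v y))).
apply: le_trans (_ : (Num.sqrt e * r `^ (- b)) ^+ 2 <= _).
  by rewrite lerXn2r ?nnegrE// mulr_ge0 ?powR_ge0 ?sqrtr_ge0.
rewrite exprMn sqr_sqrtr ?(ltW e0)// -powR_mulrn ?powR_ge0// -powRrM.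
by rewrite (_ : - b * 2%:R = - (2 * b))//; ring.
Qed.

End gradient_decays.

Section initial_data_decay.
Context {R : realType} {n : nat}.
Variables (p : R) (u0 : 'rV[R]_n -> R) (u : R -> 'rV[R]_n -> R).
Hypothesis p1 : 1 < p.
Hypothesis hn : (3 <= n)%N.
Hypothesis hp : (n%:R + 2) / (n%:R - 2) < p.
Hypothesis hu0 : u0 \in Lfun (lebesgue_rV n) +oo%E.
Hypothesis hu : classical_solution p u0 +oo%E u.
Hypothesis hab :
  (exists q : R, [/\ 2 <= q, q < n%:R * (p - 1) / (p + 1) & gradient_in_Lq u0 q]) \/
  (BC1 u0 /\ (fun x => enorm (gradient u0 x)) =o_infty_rV
         (fun x => enorm x `^ (- (2 / (p - 1)) - 1))).
Local Notation beta := ((p - 1)^-1).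

(** The exponents are matched here through 2 beta + 1 = (p+1)/(p-1): q (2 beta + 1) < n is the upper
    bound on q in (a), and 2 (2 beta + 1) < n, used in case (b), is p > p_S. *)
Lemma initial_data : exists v0 K (g : 'I_n -> 'rV[R]_n -> R),
  [/\ truncation_of u0 v0 K, forall i, heat_gradient v0 i (g i) & heat_decay (2 * beta + 1) g].
Proof.
have p10 : 0 < p - 1 by rewrite subr_gt0.
have n3 : 3 <= n%:R :> R by rewrite (ler_nat R 3).
have b0 : 0 < 2 * beta + 1 by rewrite addr_gt0// mulr_gt0// invr_gt0.
have bE : 2 * beta + 1 = (p + 1) / (p - 1) by field; rewrite gt_eqF.
case: hab => [[q [q2 qn [g [mg fin hg]]]]|[bc ho]].
- have [v0 [K tr]] := initial_truncation hu0; have [mv vK vE] := tr.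
  have mgi i : measurable_fun setT (fun y => g y 0 i) by exact: (measurableT_comp (measurable_coord i) mg).
  have [A A0 hA] := Lq_heat q2 mg fin.
  exists v0, K, (fun i y => g y 0 i); split => //; last first.
    apply: Lq_heat_decay fin => //; rewrite bE mulrA ltr_pdivrMr//.
    by move: qn; rewrite ltr_pdivlMr// addr_gt0// (lt_trans ltr01).
  have wg i : weak_gradient v0 i (fun y => g y 0 i).
    split => //.
      move=> t x t0.
      have msq := measurable_EFin_sqr (mgi i).
      have sq0 y : (0 <= (g y 0%R i ^+ 2)%:E)%E by rewrite lee_fin sqr_ge0.
      apply: (@le_lt_trans _ _ (heatE t (fun y => 1%:E * (g y 0%R i ^+ 2)%:E + 1%:E)%E x)).
        apply: le_heatE.
        - by apply/measurable_EFinP; exact: measurableT_comp.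
        - by apply: emeasurable_funD => //; apply: emeasurable_funM.
        - by move=> y; rewrite lee_fin.
        - move=> y; rewrite mul1e -EFinD lee_fin -(real_normK (num_real (g y 0 i))).
          by have := sqr_ge0 (`|g y 0 i| - 2^-1); rewrite sqrrB -mulr_natl; lra.
      rewrite (heatE_affine x t0 ler01 ler01 msq sq0) mul1e.
      apply: le_lt_trans (leeD (hA i t 1 x t0 ltr01) (lexx _)) _.
      by rewrite -EFinD ltry.
    move=> phi tphi.
    have mphi : measurable_fun setT (partial i phi).
      by apply: continuous_measurable_rV; case: tphi => /(_ [::])[_ /(_ i)[]].
    rewrite -vE//; transitivity (\int[lebesgue_rV n]_x (u0 x * partial i phi x)).
      by apply: eq_Rintegral => y _; rewrite mulrC.
    by rewrite (hg phi tphi i); congr (- _); apply: eq_Rintegral => y _; rewrite mulrC.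
  move=> i; split => //; first by case: (wg i).
  by move=> t x t0; exact: (is_derive_heat_convolution x t0 mv vK (wg i)).
- have [[cu _] /bounded_fun_ge0[K K0 uK] _] := bc.
  exists u0, K, (fun i => partial i u0); split.
  + by split => //; exact: continuous_measurable_rV.
  + by move=> i; exact: BC1_heat_gradient.
  + apply: BC1_heat_decay => //.
      rewrite bE mulrA ltr_pdivrMr//.
      by move: hp; rewrite ltr_pdivrMr; [nra|lra].
    by have -> : - (2 * beta + 1) = - (2 / (p - 1)) - 1 by ring.
Qed.

(** Jensen's inequality turns the bound of [solution_grad_le] into |D_i u(t0)|^2 <= C^2 P_{2 t0}
    (g_i^2). By the semigroup law P_tau of it is C^2 P_{tau + 2 t0} (g_i^2), and the shift by 2 t0
    only helps. *)
Lemma gradient_decay : exists2 t0, 0 < t0 & forall e : R, 0 < e ->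
  exists2 T0, 0 < T0 & forall tau (a : 'rV[R]_n), T0 <= tau ->
    tau `^ (2 * beta + 1) * heat_square_grad (u t0) tau a <= e.
Proof.
have [t0 t00 [C C0 hC]] := solution_grad_le p1 hu0 hu.
have [v0 [K [g [tr hg dec]]]] := initial_data.
exists t0 => // e e0.
have p10 : 0 < p - 1 by rewrite subr_gt0.
have b0 : 0 < 2 * beta + 1 by rewrite addr_gt0// mulr_gt0// invr_gt0.
set b := 2 * beta + 1 in dec b0 *.
pose X := n%:R * C ^+ 2 + 1.
have X0 : 0 < X by rewrite ltr_wpDl// mulr_ge0// sqr_ge0.
have [T0 T00 hT] := dec _ (divr_gt0 e0 X0).
exists T0 => // tau a Ttau; have tau0 : 0 < tau by exact: lt_le_trans Ttau.
have t20 : 0 < 2 * t0 by rewrite mulr_gt0.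
have [K1 K10 hK1] := solution_grad_bound p1 hu0 hu t0 t00.
have sq i : heat_square ('D_(unit_vec i) (u t0)) tau a <= C ^+ 2 * (e / X * (tau + 2 * t0) `^ (- b)).
  have [mgi fin _] := hg i.
  have mD : measurable_fun setT ('D_(unit_vec i) (u t0)).
    apply: continuous_measurable_rV => x.
    apply: (@continuous_slice _ _ (fun t => 'D_(unit_vec i) (u t))).
    by have [_ _ /(_ i)[]] := solution_spec hu x t00.
  rewrite -lee_fin (heat_squareE a tau0 mD (fun x => hK1 i t0 x (lexx t0) (lexx t0))).
  have msq := measurable_EFin_sqr mgi.
  have sq0 y : (0 <= (g i y ^+ 2)%:E)%E by rewrite lee_fin sqr_ge0.
  have mh : measurable_fun setT (heat_sqr (2 * t0) (g i)) by apply: measurable_heatE.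
  have h0 y : (0 <= heat_sqr (2 * t0) (g i) y)%E by exact: heatE_ge0.
  apply: (@le_trans _ _ (heatE tau (fun y => (C ^+ 2)%:E * heat_sqr (2 * t0) (g i) y + 0%:E)%E a)).
    apply: le_heatE.
    - exact: measurable_EFin_sqr.
    - by apply: emeasurable_funD => //; apply: emeasurable_funM.
    - by move=> y; rewrite lee_fin sqr_ge0.
    - move=> y; rewrite adde0; have := hC v0 K i (g i) y tr (hg i).
      have q := heat_abs_sqr t20 mgi (fin _ y t20).
      have A0 := heat_abs_ge0 (2 * t0) (g i) y.
      rewrite -[X in (_ * X)%E](fineK (x := heat_abs (2 * t0) (g i) y)) ?ge0_fin_numE ?fin//.
      set A := fine _ in q *; rewrite -EFinM lee_fin => h.
      apply: le_trans (lee_wpmul2l _ q); last by rewrite lee_fin sqr_ge0.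
      rewrite -EFinM lee_fin -exprMn -(real_normK (num_real ('D_(unit_vec i) (u t0) y))).
      by rewrite lerXn2r ?nnegrE// (le_trans _ h).
  rewrite (heatE_affine a tau0 (sqr_ge0 C) (lexx 0) mh h0) adde0.
  rewrite /heat_sqr heatE_semigroup//.
  rewrite [leRHS]EFinM; apply: lee_wpmul2l; first by rewrite lee_fin sqr_ge0.
  by apply: hT; rewrite (le_trans Ttau)// lerDl ltW.
have tb : tau `^ b * (tau + 2 * t0) `^ (- b) <= 1.
  rewrite powRN ler_pdivrMr ?powR_gt0 ?addr_gt0// mul1r.
  by apply: ge0_ler_powR; [exact: ltW|by rewrite nnegrE ltW|by rewrite nnegrE addr_ge0 ?(ltW tau0) ?(ltW t20)|by rewrite lerDl ltW].
apply: le_trans (_ : tau `^ b * (n%:R * (C ^+ 2 * (e / X * (tau + 2 * t0) `^ (- b)))) <= _).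
  rewrite ler_wpM2l ?powR_ge0//.
  apply: le_trans (ler_sum _ (fun i _ => sq i)) _.
  by rewrite sumr_const card_ord [leRHS]mulr_natl.
have -> : tau `^ b * (n%:R * (C ^+ 2 * (e / X * (tau + 2 * t0) `^ (- b)))) =
  n%:R * C ^+ 2 / X * e * (tau `^ b * (tau + 2 * t0) `^ (- b)) by ring.
have nX : n%:R * C ^+ 2 / X <= 1 by rewrite ler_pdivrMr// mul1r /X lerDl.
have nX0 : 0 <= n%:R * C ^+ 2 / X by rewrite divr_ge0 ?(ltW X0)// mulr_ge0// sqr_ge0.
apply: le_trans (ler_wpM2l _ tb) _; first by rewrite mulr_ge0// ltW.
by rewrite mulr1 -[leRHS]mul1r ler_wpM2r// ltW.
Qed.

End initial_data_decay.

(** * Decay of the solution *)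

Section heat_square_derivative.
Context {R : realType} {n : nat}.
Implicit Types (x y a z : 'rV[R]_n) (v w : 'rV[R]_n -> R) (t K : R).
Local Notation mu := (@lebesgue_rV R n).

(** The weight |z_i|, which comes from differentiating in time, is traded for passing from time 1 to
    time 2. *)
Lemma gexp_coord_sqr_le : exists2 C : R, 0 <= C & forall i w K, measurable_fun setT w ->
  (forall x, `|w x| <= K) -> gexp (fun z => `|z 0 i| * w z ^+ 2) <= C * heat_square w 2 0.
Proof.
have [C C0 hC] := @heat_kernel1_poly R n 1; exists C => // i w K mw wK.
have tw := tame_bounded mw wK.
have tww : tame (fun z => w z ^+ 2) by under eq_fun do rewrite expr2; exact: tameM.
have t1 : tame (fun z => `|z 0 i| * w z ^+ 2) by apply: tameM => //; exact/tame_norm/tame_coord.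
have C20 : (0 < (2 : R)) by [].
rewrite -lee_fin EFinM (heat_squareE _ C20 mw wK) gexp_EFin// /heat_sqr /heatE.
have mk : measurable_fun setT (fun y => ((heat_kernel 2 (0 - y))%:E * (w y ^+ 2)%:E)%E).
  apply: emeasurable_funM; last exact: measurable_EFin_sqr.
  apply/measurable_EFinP; apply: (measurableT_comp (measurable_heat_kernel _)).
  exact: measurable_subr_l.
have k0 y : (0 <= (heat_kernel 2 (0 - y))%:E * (w y ^+ 2)%:E)%E.
  by rewrite -EFinM lee_fin mulr_ge0 ?sqr_ge0// heat_kernel_ge0.
rewrite -ge0_integralZl//.
apply: ge0_le_integral => //.
- move=> z _; rewrite lee_fin; apply: mulr_ge0; first exact: heat_kernel_ge0.
  by rewrite mulr_ge0 ?sqr_ge0.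
- by apply/measurable_EFinP/measurable_funM; [exact: measurable_heat_kernel|case: t1].
- by apply: emeasurable_funM.
- move=> z _; rewrite -!EFinM lee_fin sub0r heat_kernelN mulrA mulrA ler_wpM2r ?sqr_ge0//.
  apply: le_trans (hC z); rewrite expr1 ler_wpM2l ?heat_kernel_ge0//.
  exact: coord_le_bracket.
Qed.

Lemma heat_square_comp v (t : R) a : 0 <= t ->
  heat_square (fun z => v (a + Num.sqrt t *: z)) 2 0 = heat_square v (2 * t) a.
Proof.
move=> t0; apply: eq_gexp => z; congr (v _ ^+ 2).
by rewrite add0r scalerA -sqrtrM// [t * 2]mulrC.
Qed.

Definition heat_square_dt v (t : R) a :=
  gexp (fun z => 2 * v (a + Num.sqrt t *: z) *
    ((2 * Num.sqrt t)^-1 * \sum_(i < n) z 0 i * 'D_(unit_vec i) v (a + Num.sqrt t *: z))).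

Section regular.
Variables (v : 'rV[R]_n -> R) (B K : R).
Hypothesis vB : forall x, `|v x| <= B.
Hypothesis cv : continuous v.
Hypothesis dv : forall i x, derivable v x (unit_vec i).
Hypothesis vK : forall i x, `|'D_(unit_vec i) v x| <= K.
Hypothesis cdv : forall i, continuous (fun x => 'D_(unit_vec i) v x).

Let mv : measurable_fun setT v. Proof. exact: continuous_measurable_rV. Qed.
Let mdv i : measurable_fun setT ('D_(unit_vec i) v).
Proof. by apply: continuous_measurable_rV => x; exact: cdv. Qed.
Let B0 : 0 <= B. Proof. exact: le_trans (normr_ge0 _) (vB 0). Qed.

Let tv (t : R) a : tame (fun z => v (a + Num.sqrt t *: z)).
Proof. exact: tame_comp_affine vB. Qed.

Let tdv i (t : R) a : tame (fun z => 'D_(unit_vec i) v (a + Num.sqrt t *: z)).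
Proof. exact: tame_comp_affine (vK i). Qed.

Let tsum (t : R) a : tame (fun z => \sum_(i < n) z 0 i * 'D_(unit_vec i) v (a + Num.sqrt t *: z)).
Proof. by apply: tame_sum => i; apply: tameM => //; exact: tame_coord. Qed.

Lemma is_derive_heat_square (t : R) a : 0 < t ->
  is_derive t 1 (fun r => heat_square v r a) (heat_square_dt v t a).
Proof.
move=> t0.
have K0 : 0 <= n%:R * `|K| by rewrite mulr_ge0.
apply: (@is_derive_gexp _ _ (fun r z => v (a + Num.sqrt r *: z) ^+ 2)
  (fun r z => 2 * v (a + Num.sqrt r *: z) *
    ((2 * Num.sqrt r)^-1 * \sum_(i < n) z 0 i * 'D_(unit_vec i) v (a + Num.sqrt r *: z)))
  t (t / 2) (t + 1) (2 * B * ((2 * Num.sqrt (t / 2))^-1 * (n%:R * `|K|))) 1).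
- by apply/andP; split; lra.
- by move=> r _; under eq_fun do rewrite expr2; exact: tameM.
- move=> r z /andP[tr _]; have r0 : 0 < r by lra.
  have h1 := @is_derive_directional R n v a z (Num.sqrt r) dv (fun i => @cdv i _).
  have h2 := @is_derive1_comp R (fun s => v (a + s *: z)) Num.sqrt r _ _ h1 (is_derive1_sqrt r0).
  have h3 := is_deriveM h2 h2.
  apply: (is_derive_eq h3); rewrite /GRing.scale/=; ring.
- move=> r z /andP[tr _]; have r0 : 0 < r by lra.
  have t20 : 0 < t / 2 by lra.
  have s0 : 0 < Num.sqrt (t / 2) by rewrite sqrtr_gt0.
  have sr : Num.sqrt (t / 2) <= Num.sqrt r by rewrite ler_wsqrtr// ltW.
  have sr0 : 0 < Num.sqrt r by exact: lt_le_trans sr.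
  rewrite expr1 -!mulrA !normrM mulrA [leRHS]mulrA.
  apply: ler_pM; rewrite ?mulr_ge0//.
    by rewrite ger0_norm// ler_wpM2l.
  apply: ler_pM => //.
    rewrite ger0_norm; last by rewrite invr_ge0 mulr_ge0// ltW.
    by rewrite lef_pV2 ?posrE ?mulr_gt0// ler_wpM2l.
  apply: le_trans (ler_norm_sum _ _ _) _.
  have hi i : true -> `|z 0 i * 'D_(unit_vec i) v (a + Num.sqrt r *: z)| <= `|K| * (1 + enorm z ^+ 2).
    move=> _; rewrite normrM mulrC; apply: ler_pM => //; last exact: coord_le_bracket.
    exact: le_trans (vK _ _) (ler_norm _).
  apply: le_trans (ler_sum _ hi) _.
  by rewrite sumr_const card_ord [leRHS]mulr_natl.
Qed.

Let young (s x y : R) : 0 < s -> `|x| * `|y| <= s * x ^+ 2 + s^-1 * y ^+ 2.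
Proof.
move=> s0; have h : 0 <= s^-1 * (s * `|x| - `|y|) ^+ 2 by rewrite mulr_ge0 ?sqr_ge0// invr_ge0 ltW.
have E : s^-1 * (s * `|x| - `|y|) ^+ 2 = s * `|x| ^+ 2 + s^-1 * `|y| ^+ 2 - 2 * (`|x| * `|y|).
  by field; rewrite gt_eqF.
have p0 : 0 <= `|x| * `|y| by rewrite mulr_ge0.
by rewrite E !real_normK ?num_real// in h; lra.
Qed.

(** The product of v and its gradient is split by Young's inequality with a free parameter s instead
    of Cauchy-Schwarz; s is chosen in [mass_decay]. *)
Lemma heat_square_dt_le (C t s : R) a : 0 < t -> 0 < s ->
  (forall i w K, measurable_fun setT w -> (forall x, `|w x| <= K) ->
    gexp (fun z => `|z 0 i| * w z ^+ 2) <= C * heat_square w 2 0) ->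
  `|heat_square_dt v t a| <= (Num.sqrt t)^-1 *
     (C * (s * (n%:R * heat_square v (2 * t) a) + s^-1 * heat_square_grad v (2 * t) a)).
Proof.
move=> t0 s0 hC; have st : 0 < Num.sqrt t by rewrite sqrtr_gt0.
pose w z := v (a + Num.sqrt t *: z).
pose d i z := 'D_(unit_vec i) v (a + Num.sqrt t *: z).
have tw : tame w := tv t a.
have td i : tame (d i) := tdv i t a.
have tw2 i : tame (fun z => `|z 0 i| * w z ^+ 2).
  by apply: tameM; [exact/tame_norm/tame_coord|under eq_fun do rewrite expr2; exact: tameM].
have td2 i : tame (fun z => `|z 0 i| * d i z ^+ 2).
  by apply: tameM; [exact/tame_norm/tame_coord|under eq_fun do rewrite expr2; exact: tameM].
have tF : tame (fun z => 2 * w z * ((2 * Num.sqrt t)^-1 * \sum_(i < n) z 0 i * d i z)).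
  by apply: tameM; apply: tameZ => //; exact: tsum.
have tG i : tame (fun z => s * (`|z 0 i| * w z ^+ 2) + s^-1 * (`|z 0 i| * d i z ^+ 2)).
  by apply: tameD; apply: tameZ.
apply: le_trans (ler_norm_gexp tF) _.
apply: (@le_trans _ _ (gexp (fun z => (Num.sqrt t)^-1 *
    \sum_(i < n) (s * (`|z 0 i| * w z ^+ 2) + s^-1 * (`|z 0 i| * d i z ^+ 2))))).
  apply: ler_gexp; [exact: tame_norm|by apply: tameZ; exact: tame_sum|move=> z].
  have -> : 2 * w z * ((2 * Num.sqrt t)^-1 * \sum_(i < n) z 0 i * d i z) =
    (Num.sqrt t)^-1 * (w z * \sum_(i < n) z 0 i * d i z) by field; rewrite gt_eqF.
  rewrite normrM ger0_norm ?invr_ge0 ?(ltW st)// ler_wpM2l ?invr_ge0 ?(ltW st)//.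
  rewrite mulr_sumr; apply: le_trans (ler_norm_sum _ _ _) _; apply: ler_sum => i _.
  have -> : s * (`|z 0 i| * w z ^+ 2) + s^-1 * (`|z 0 i| * d i z ^+ 2) =
    `|z 0 i| * (s * w z ^+ 2 + s^-1 * d i z ^+ 2) by ring.
  by rewrite !normrM mulrCA ler_wpM2l//; exact: young.
rewrite gexpZ; last exact: tame_sum.
rewrite ler_wpM2l ?invr_ge0 ?(ltW st)// gexp_sum//.
have hi i : true -> gexp (fun z => s * (`|z 0 i| * w z ^+ 2) + s^-1 * (`|z 0 i| * d i z ^+ 2)) <=
   C * (s * heat_square v (2 * t) a) + C * (s^-1 * heat_square ('D_(unit_vec i) v) (2 * t) a).
  move=> _; rewrite gexpD ?gexpZ//; try exact: tameZ.
  rewrite -(heat_square_comp v a (ltW t0)) -(heat_square_comp ('D_(unit_vec i) v) a (ltW t0)).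
  rewrite !(mulrCA C); apply: lerD; rewrite ler_wpM2l ?invr_ge0 ?(ltW s0)//.
    by apply: (@hC i w B); [case: (tv t a)|move=> x; exact: vB].
  by apply: (@hC i (d i) K); [case: (tdv i t a)|move=> x; exact: vK].
apply: le_trans (ler_sum _ hi) _.
rewrite big_split/= sumr_const card_ord /heat_square_grad mulrDr.
rewrite -!mulr_sumr lerD2r.
by rewrite -[leLHS]mulr_natl mulrCA (mulrCA n%:R s).
Qed.

End regular.
End heat_square_derivative.

Section real_decay.
Context {R : realType}.

(** Integration from infinity: H - (c/b) t^{-b} is nondecreasing, and the a priori bound with C
    makes H tend to 0. The constant C disappears from the conclusion, so a small c gives a small
    H. *)
Lemma decay_of_derivative (H dH : R -> R) (b c t0 C : R) : 0 < b -> 0 <= C -> 0 < t0 ->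
  (forall t, t0 <= t -> is_derive t 1 H (dH t)) ->
  (forall t, t0 <= t -> `|dH t| <= c * t `^ (- b - 1)) ->
  (forall t, t0 <= t -> H t <= C * t `^ (- b)) ->
  forall t, t0 <= t -> H t <= c / b * t `^ (- b).
Proof.
move=> b0 C0 t00 hd hdH hH t t0t; have tp : 0 < t by exact: lt_le_trans t0t.
have c0 : 0 <= c.
  have := le_trans (normr_ge0 _) (hdH t t0t).
  by rewrite pmulr_lge0// powR_gt0.
apply/ler_addgt0Pl => e e0; have [S0 S00 hS] := powR_decay b0 C0 e0.
pose S := Num.max S0 t; have tS : t <= S by rewrite le_max lexx orbT.
pose k := fun r : R => H r + (- (c / b)) * r `^ (- b).
have dk r : Num.min t S <= r <= Num.max t S ->
    is_derive r 1 k (dH r + (- (c / b)) * (- b * r `^ (- b - 1))).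
  move=> hr; have rt : t0 <= r by move: hr; rewrite (min_idPl tS) => /andP[tr _]; exact: le_trans tr.
  have rp : 0 < r by exact: lt_le_trans rt.
  have h2 := @is_deriveZ _ _ _ _ (- (c / b)) _ _ _ (is_derive1_powR (- b) rp).
  exact: (is_deriveD (hd r rt) h2).
have [r] := MVT_between dk; rewrite (min_idPl tS) (max_idPr tS) => /andP[tr rS] E.
have rt : t0 <= r by exact: le_trans tr.
have kS : 0 <= k S - k t.
  rewrite E mulr_ge0 ?subr_ge0//.
  have -> : - (c / b) * (- b * r `^ (- b - 1)) = c * r `^ (- b - 1) by field; rewrite gt_eqF.
  by have := hdH r rt; rewrite ler_norml => /andP[h _]; lra.
have HS : H S <= e.
  by apply: le_trans (hH S (le_trans t0t tS)) _; apply: hS; rewrite le_max lexx.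
have cS : 0 <= c / b * S `^ (- b) by rewrite mulr_ge0 ?powR_ge0// divr_ge0// ltW.
by move: kS; rewrite /k; lra.
Qed.

End real_decay.

Lemma half_powRN {R : realType} (b : R) : (2^-1 : R) `^ (- b) = 2 `^ b.
Proof. by rewrite -powR_inv1// -powRrM mulN1r opprK. Qed.

Section mass_decays.
Context {R : realType} {n : nat}.
Variables (p : R) (u0 : 'rV[R]_n -> R) (u : R -> 'rV[R]_n -> R).
Hypothesis p1 : 1 < p.
Hypothesis hu0 : u0 \in Lfun (lebesgue_rV n) +oo%E.
Hypothesis hu : classical_solution p u0 +oo%E u.
Local Notation beta := ((p - 1)^-1).
Variable t0 : R.
Hypothesis t00 : 0 < t0.
Hypothesis grad_decay : forall e : R, 0 < e ->
  exists2 T0, 0 < T0 & forall tau (a : 'rV[R]_n), T0 <= tau ->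
    tau `^ (2 * beta + 1) * heat_square_grad (u t0) tau a <= e.

Let p10 : 0 < p - 1. Proof. by rewrite subr_gt0. Qed.
Let b0 : 0 < beta. Proof. by rewrite invr_gt0. Qed.
Let pp0 : 0 < p + 1. Proof. by rewrite addr_gt0// (lt_trans ltr01). Qed.

(** First application of [rescaled_mass_le], with t1 = t0. Nothing is known about the mass, so the
    energy is bounded by [potential_max p + 1], and lam is taken large enough for this value. *)
Let mass_bounded : exists C T1, [/\ 0 <= C, 0 < T1 & forall t (a : 'rV[R]_n), T1 <= t ->
  heat_square (u t0) t a <= C * t `^ (- (2 * beta))].
Proof.
have [T1 T10 h1] := grad_decay ltr01.
pose k := 2 * (p - 1) / (p + 1).
have k0 : 0 < k by rewrite divr_gt0// mulr_gt0.
pose X := `|4 * (potential_max p + 1)| / k + 1.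
have X0 : 0 < X by rewrite ltr_wpDl// divr_ge0// ltW.
pose lam := X `^ (p + 1)^-1.
have lam0 : 0 < lam by rewrite powR_gt0.
have lamE : lam `^ (p + 1) = X by rewrite -powRrM mulVf ?gt_eqF// powRr1// ltW.
exists (2 * lam ^+ 2), T1; split=> //; first by rewrite mulr_ge0// sqr_ge0.
move=> t a T1t; have t_0 : 0 < t by exact: lt_le_trans T1t.
have TE : (t0 + t) - t0 = t by ring.
have h := @rescaled_mass_le R n p u0 u p1 hu0 hu (t0 + t) t0 t0 a (potential_max p + 1) lam.
rewrite TE in h; rewrite powRN ler_pdivlMr ?powR_gt0// mulrC.
apply: h => //; first by rewrite ltrDl.
  have := h1 t a T1t.
  have : Num.min (potential_max p) (beta / 2 * (t `^ (2 * beta) * heat_square (u t0) t a)) <= potential_max p.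
    by rewrite ge_min lexx.
  by lra.
rewrite lamE -/k; have -> : k * X = `|4 * (potential_max p + 1)| + k by rewrite /X; field; rewrite gt_eqF.
by apply: le_lt_trans (ler_norm _) _; rewrite ltrDl.
Qed.

Lemma mass_decay e : 0 < e -> exists2 T2, 0 < T2 & forall t (a : 'rV[R]_n), T2 <= t ->
  t `^ (2 * beta) * heat_square (u t0) t a <= e.
Proof.
move=> e0; have [C1 [T1 [C10 T10 hC1]]] := mass_bounded.
have [C C0 hC] := @gexp_coord_sqr_le R n.
have bb0 : 0 < 2 * beta by rewrite mulr_gt0.
(* The derivative is to be at most c r^{-2 beta - 1}, since integration divides c by 2 beta. The
   Young parameter is rho / sqrt(r); X makes the term with the mass at most c / 2, and Y the term
   with the gradient. *)
pose c := e * (2 * beta); have c0 : 0 < c by rewrite mulr_gt0.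
pose X := 2 * (C * (n%:R * C1) + 1).
have X0 : 0 < X by rewrite mulr_gt0// ltr_wpDl// !mulr_ge0.
pose rho := c / X; have rho0 : 0 < rho by rewrite divr_gt0.
pose Y := 2 * (C + 1); have Y0 : 0 < Y by rewrite mulr_gt0// ltr_wpDl.
have e'0 : 0 < c * rho / Y by rewrite !divr_gt0// mulr_gt0.
have [T2 T20 hT2] := grad_decay e'0.
have [B B0 uB] := solution_bounded hu t0.
have [K K0 hK] := solution_grad_bound p1 hu0 hu t0 t00.
have vB x : `|u t0 x| <= B by exact: uB.
have cv : continuous (u t0).
  by move=> x; apply: continuous_slice; exact: (solution_continuous hu).
have dv i x : derivable (u t0) x (unit_vec i) by exact: (solution_derivable hu).
have vK i x : `|'D_(unit_vec i) (u t0) x| <= K by exact: hK.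
have cdv i : continuous (fun x => 'D_(unit_vec i) (u t0) x).
  move=> x; apply: (@continuous_slice R n (fun t => 'D_(unit_vec i) (u t))).
  by have [_ _ /(_ i)[]] := solution_spec hu x t00.
pose T3 := Num.max T1 T2; have T30 : 0 < T3 by rewrite lt_max T10.
exists T3 => // t a T3t; have t_0 : 0 < t by exact: lt_le_trans T3t.
rewrite mulrC -ler_pdivlMr ?powR_gt0// -powRN.
have -> : e = c / (2 * beta) by rewrite /c mulfK// gt_eqF.
have T3P r : T3 <= r -> [/\ 0 < r, T1 <= r & T2 <= r].
  move=> h; split; first exact: lt_le_trans h.
    by apply: le_trans h; rewrite le_max lexx.
  by apply: le_trans h; rewrite le_max lexx orbT.
apply: (@decay_of_derivative R (fun r => heat_square (u t0) r a) (fun r => heat_square_dt (u t0) r a)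
  (2 * beta) c T3 C1 bb0 C10 T30 _ _ _ t T3t).
- by move=> r /T3P[r0 _ _]; apply: (is_derive_heat_square vB cv dv vK cdv).
- move=> r /T3P[r0 T1r T2r].
  have sr0 : 0 < Num.sqrt r by rewrite sqrtr_gt0.
  have s0 : 0 < rho / Num.sqrt r by rewrite divr_gt0.
  have hdt := heat_square_dt_le vB cv vK cdv a r0 s0 hC.
  apply: (le_trans hdt).
  have r2 : r <= 2 * r by lra.
  have r20 : 0 < 2 * r by lra.
  have pw k : 0 <= k -> (2 * r) `^ (- k) <= r `^ (- k).
    move=> k0; rewrite !powRN lef_pV2 ?posrE ?powR_gt0//.
    by apply: ge0_ler_powR; rewrite ?nnegrE ?(ltW r0) ?(ltW r20).
  have hm : heat_square (u t0) (2 * r) a <= C1 * r `^ (- (2 * beta)).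
    apply: le_trans (hC1 (2 * r) a (le_trans T1r r2)) _; rewrite ler_wpM2l//.
    exact: pw (ltW bb0).
  have b10 : 0 < 2 * beta + 1 by rewrite addr_gt0.
  have hg : heat_square_grad (u t0) (2 * r) a <= c * rho / Y * r `^ (- (2 * beta + 1)).
    apply: (@le_trans _ _ (c * rho / Y * (2 * r) `^ (- (2 * beta + 1)))).
      by rewrite powRN ler_pdivlMr ?powR_gt0// mulrC hT2// (le_trans T2r).
    by rewrite ler_wpM2l ?(ltW e'0)//; exact: pw (ltW b10).
  have sq : Num.sqrt r * Num.sqrt r = r by rewrite -expr2 sqr_sqrtr// ltW.
  have rE : r `^ (- (2 * beta)) = r `^ (- (2 * beta) - 1) * r.
    by rewrite -[X in _ = _ * X]powRr1 ?(ltW r0)// -powRD ?(gt_eqF r0) ?implybT//; congr (_ `^ _); ring.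
  have rE1 : r `^ (- (2 * beta + 1)) = r `^ (- (2 * beta) - 1) by congr (_ `^ _); ring.
  set P := r `^ (- (2 * beta) - 1) in rE rE1 *.
  have P0 : 0 <= P by exact: powR_ge0.
  apply: (@le_trans _ _ ((Num.sqrt r)^-1 * (C * (rho / Num.sqrt r * (n%:R * (C1 * (P * r))) +
     (rho / Num.sqrt r)^-1 * (c * rho / Y * P))))).
    rewrite ler_wpM2l ?invr_ge0 ?(ltW sr0)// ler_wpM2l// lerD//.
      by rewrite ler_wpM2l ?(ltW s0)// ler_wpM2l// -rE.
    by rewrite ler_wpM2l ?invr_ge0 ?(ltW s0)// -rE1.
  have -> : (Num.sqrt r)^-1 * (C * (rho / Num.sqrt r * (n%:R * (C1 * (P * r))) +
     (rho / Num.sqrt r)^-1 * (c * rho / Y * P))) =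
     (C * (n%:R * C1) * rho + C * c / Y) * P.
    rewrite -[X in P * X]sq; field.
    by rewrite !gt_eqF.
  rewrite ler_wpM2r//.
  have q1 : C * (n%:R * C1) * rho <= c / 2.
    rewrite /rho mulrA ler_pdivrMr// /X.
    have E : c / 2 * (2 * (C * (n%:R * C1) + 1)) = C * (n%:R * C1) * c + c by field.
    by rewrite E lerDl ltW.
  have q2 : C * c / Y <= c / 2.
    rewrite ler_pdivrMr// /Y.
    have E : c / 2 * (2 * (C + 1)) = C * c + c by field.
    by rewrite E lerDl ltW.
  by lra.
- by move=> r /T3P[r0 T1r _]; exact: hC1.
Qed.

(** Second application: the energy is evaluated at t0 on the scale t + tau - t0, and the mass at the
    later time t. Only the sum t + tau has to be large; tau itself may be small. *)
Lemma mass_small e : 0 < e -> exists2 T3, t0 <= T3 & forall t tau (a : 'rV[R]_n),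
  t0 <= t -> 0 < tau -> T3 <= t + tau -> tau `^ (2 * beta) * heat_square (u t) tau a <= e.
Proof.
move=> e0; pose lam := Num.sqrt (e / 2).
have lam0 : 0 < lam by rewrite sqrtr_gt0 divr_gt0.
have lamE : 2 * lam ^+ 2 = e by rewrite sqr_sqrtr ?divr_ge0 ?(ltW e0)//; field.
pose k := 2 * (p - 1) / (p + 1).
have k0 : 0 < k by rewrite divr_gt0// mulr_gt0.
(* Gradient and mass contribute at most eps / 2 each to the energy, and 4 eps is half of the
   threshold. *)
pose eps := k * lam `^ (p + 1) / 8.
have kl0 : 0 < k * lam `^ (p + 1) by rewrite mulr_gt0// powR_gt0.
have eps0 : 0 < eps by rewrite divr_gt0.
have [T1 T10 h1] := grad_decay eps0.
have eb0 : 0 < eps / beta by rewrite divr_gt0.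
have [T2 T20 h2] := mass_decay eb0.
exists (t0 + Num.max T1 T2); first by rewrite lerDl le_max (ltW T10).
move=> t tau a t0t tau0 hT; rewrite -lamE.
have tauE : t + tau - t = tau by ring.
have h := @rescaled_mass_le R n p u0 u p1 hu0 hu (t + tau) t0 t a eps lam t00 t0t.
rewrite tauE in h; apply: h => //; first by rewrite ltrDl.
  have hm : Num.max T1 T2 <= t + tau - t0 by lra.
  have m1 : T1 <= t + tau - t0 by apply: le_trans hm; rewrite le_max lexx.
  have m2 : T2 <= t + tau - t0 by apply: le_trans hm; rewrite le_max lexx orbT.
  have g1 := h1 _ a m1; have g2 := h2 _ a m2.
  have g3 : beta / 2 * ((t + tau - t0) `^ (2 * beta) * heat_square (u t0) (t + tau - t0) a) <= eps / 2.
    have -> : eps / 2 = beta / 2 * (eps / beta) by field; rewrite gt_eqF.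
    by rewrite ler_wpM2l// divr_ge0// ltW.
  have : Num.min (potential_max p) (beta / 2 * ((t + tau - t0) `^ (2 * beta) *
      heat_square (u t0) (t + tau - t0) a)) <= eps / 2 by rewrite ge_min g3 orbT.
  by lra.
by rewrite -/k /eps; lra.
Qed.

End mass_decays.

(** * From small Gaussian mass to uniform decay *)

Section bootstrap.
Context {R : realType} {n : nat}.
Variables (p : R) (u0 : 'rV[R]_n -> R) (u : R -> 'rV[R]_n -> R).
Hypothesis p1 : 1 < p.
Hypothesis hu0 : u0 \in Lfun (lebesgue_rV n) +oo%E.
Hypothesis hu : classical_solution p u0 +oo%E u.
Local Notation beta := ((p - 1)^-1).
Local Notation f := (power_nonlinearity p).
Implicit Types (x y : 'rV[R]_n).

Let p10 : 0 < p - 1. Proof. by rewrite subr_gt0. Qed.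
Let b0 : 0 < beta. Proof. by rewrite invr_gt0. Qed.

(** Average |v| <= v^2 / (2M) + M / 2. *)
Lemma heat_convolution_norm_le (g : 'rV[R]_n -> R) (K t M : R) x : 0 < t -> 0 < M ->
  measurable_fun setT g -> (forall y, `|g y| <= K) -> heat_square g t x <= M ^+ 2 ->
  heat_convolution t (fun y => `|g y|) x <= M.
Proof.
move=> t0 M0 mg gK hM.
have mg' : measurable_fun setT (fun y => `|g y|) by exact: measurableT_comp.
rewrite heat_convolutionE//.
have tg : tame (fun z => g (x + Num.sqrt t *: z)) by exact: tame_comp_affine gK.
have tg2 : tame (fun z => g (x + Num.sqrt t *: z) ^+ 2).
  by under eq_fun do rewrite expr2; exact: tameM.
apply: (@le_trans _ _ (gexp (fun z => (2 * M)^-1 * g (x + Num.sqrt t *: z) ^+ 2 + M / 2))).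
  apply: ler_gexp; [exact: tame_norm|by apply: tameD; [exact: tameZ|exact: tame_cst]|move=> z].
  set v := g _.
  have h : 0 <= (2 * M)^-1 * (`|v| - M) ^+ 2 by rewrite mulr_ge0 ?sqr_ge0// invr_ge0 mulr_ge0// ltW.
  have E : (2 * M)^-1 * (`|v| - M) ^+ 2 = (2 * M)^-1 * `|v| ^+ 2 + M / 2 - `|v|.
    by field; rewrite gt_eqF.
  by rewrite E real_normK ?num_real// subr_ge0 in h.
rewrite gexpD; [|exact: tameZ|exact: tame_cst].
rewrite (gexpZ _ tg2) gexp_cst.
apply: (@le_trans _ _ ((2 * M)^-1 * M ^+ 2 + M / 2)).
  by rewrite lerD2r ler_wpM2l// invr_ge0 mulr_ge0// ltW.
by rewrite le_eqVlt; apply/orP; left; apply/eqP; field; rewrite gt_eqF.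
Qed.

Lemma clamp_bound (K v : R) : 0 <= K -> `|Num.max (- K) (Num.min K v)| <= K.
Proof.
by move=> K0; rewrite ler_norml le_max lexx/= ge_max ge_min lexx andbT; lra.
Qed.

Lemma clamp_id (K v : R) : `|v| <= K -> Num.max (- K) (Num.min K v) = v.
Proof. by rewrite ler_norml => /andP[h1 h2]; rewrite (min_idPr h2) (max_idPr h1). Qed.

Section small_mass.
Variables (t0 T1 delta eta : R).
Hypothesis t00 : 0 < t0.
Hypothesis t0T1 : t0 <= T1.
Hypothesis delta0 : 0 < delta.
Hypothesis eta0 : 0 < eta.
Hypothesis mass : forall t tau a, t0 <= t -> 0 < tau -> T1 <= t + tau ->
  tau `^ (2 * beta) * heat_square (u t) tau a <= delta ^+ 2.
Hypothesis small : 2 `^ beta * (delta + eta `^ p) <= eta / 2.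

Let T10 : 0 < T1. Proof. exact: lt_le_trans t0T1. Qed.

(* The solution is restarted at the midpoint of [T1, s]: the initial term is controlled by the
   Gaussian mass, and the source by the assumed decay. *)
Lemma midpoint_improve s x : T1 < s ->
  (forall r y, T1 < r -> r < s -> `|u r y| <= eta * (r - T1) `^ (- beta)) ->
  `|u s x| <= eta / 2 * (s - T1) `^ (- beta).
Proof.
move=> T1s hr; pose m := (s + T1) / 2; pose d := (s - T1) / 2.
have d0 : 0 < d by rewrite divr_gt0// subr_gt0.
have s0 : 0 < s by exact: lt_trans T1s.
have T1m : T1 < m by rewrite /m; lra.
have ms : m < s by rewrite /m; lra.
have m0 : 0 < m by exact: lt_trans T1m.
have smd : s - m = d by rewrite /m /d; field.
have mTd : m - T1 = d by rewrite /m /d; field.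
pose K := eta * d `^ (- beta).
have K0 : 0 <= K by rewrite mulr_ge0 ?powR_ge0// ltW.
have [B B0 uB] := solution_bounded hu s.
have jU := joint_bounded_solution hu B0 uB.
(* The bound K holds on [m, s) only. Clamping u to [-K, K] leaves the source unchanged there and
   makes it bounded by K^p at all times. *)
pose F r y := f (Num.max (- K) (Num.min K (time_cut s u r y))).
have jF : joint_bounded F (K `^ p).
  split; last by move=> r y; apply: power_bound => //; exact: clamp_bound.
  apply: (measurableT_comp (measurable_power p)).
  apply: measurable_maxr; first exact: measurable_cst.
  by apply: measurable_minr; [exact: measurable_cst|case: jU].
have uK r y : m <= r -> r < s -> `|u r y| <= K.
  move=> mr rs; apply: le_trans (hr r y (lt_le_trans T1m mr) rs) _.
  rewrite ler_wpM2l ?(ltW eta0)// !powRN lef_pV2 ?posrE ?powR_gt0//; last by lra.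
  apply: ge0_ler_powR; rewrite ?nnegrE ?(ltW b0) ?(ltW d0)//; first by lra.
  by rewrite -mTd lerD2r.
have mu_ : mild (time_cut s u) F m s.
  apply: (mild_eq_source (@solution_mild R n p u0 u p1 hu0 hu s m m0)) => r y mr rs.
  rewrite /F /source clamp_id//; rewrite time_cutE ?(ltW rs)//; last exact: lt_le_trans mr.
  exact: uK.
have mum : measurable_fun setT (time_cut s u m).
  by rewrite time_cutE ?(ltW ms)//; apply: continuous_measurable_rV => y;
    apply: continuous_slice; exact: (solution_continuous hu).
have umB y : `|time_cut s u m y| <= B by case: jU.
have := mild_sup_bound x mu_ jF (lexx m) ms (lexx s) mum umB.
rewrite smd !time_cutE ?(ltW ms)// => h; apply: (le_trans h).
have umm : measurable_fun setT (u m) by rewrite time_cutE ?(ltW ms)// in mum.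
have umB' y : `|u m y| <= B by apply: uB => //; exact: ltW.
have dE : d `^ (- beta) = 2 `^ beta * (s - T1) `^ (- beta).
  have dE : d = 2^-1 * (s - T1) by rewrite /d mulrC.
  rewrite dE powRM ?subr_ge0 ?(ltW T1s)//; congr (_ * _).
  exact: half_powRN.
have M0 : 0 < delta * d `^ (- beta) by rewrite mulr_gt0// powR_gt0.
have hc : heat_convolution d (fun y => `|u m y|) x <= delta * d `^ (- beta).
  apply: (heat_convolution_norm_le d0 M0 umm umB').
  have h2 := @mass m d x (le_trans t0T1 (ltW T1m)) d0.
  rewrite -smd subrKC in h2; rewrite smd in h2.
  have dd : d `^ (2 * beta) * d `^ (- beta) ^+ 2 = 1.
    rewrite -powR_mulrn ?powR_ge0// -powRrM -powRD ?(gt_eqF d0) ?implybT//.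
    by rewrite (_ : _ + _ = 0) ?powRr0//; ring.
  have dp : 0 < d `^ (2 * beta) by rewrite powR_gt0.
  rewrite -(ler_pM2l dp) exprMn mulrCA dd mulr1; apply: h2.
  exact: ltW.
(* Scale invariance again: 1 - p beta = - beta. *)
have Kp : K `^ p * d = eta `^ p * d `^ (- beta).
  rewrite /K powRM ?powR_ge0 ?(ltW eta0)// -mulrA; congr (_ * _).
  rewrite -powRrM -[X in _ * X]powRr1 ?(ltW d0)// -powRD ?(gt_eqF d0) ?implybT//.
  by congr (_ `^ _); field; rewrite gt_eqF.
rewrite Kp; apply: (@le_trans _ _ ((delta + eta `^ p) * d `^ (- beta))).
  by rewrite mulrDl lerD2r.
rewrite dE mulrCA mulrA ler_wpM2r ?powR_ge0//.
Qed.

(** Continuation in steps of a fixed length h. At the last time s1 reached, [midpoint_improve]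
    halves the constant. Up to s1 + h the weight (r - T1)^{-beta} loses at most a factor 3/2 and the
    source adds at most eta / 4, so the constant is at most 3/4 + 1/4 times eta again. *)
Lemma small_mass_decay s x : T1 < s -> `|u s x| <= eta * (s - T1) `^ (- beta).
Proof.
have [B' B'0 uB'] := solution_bounded hu s; pose B := B' + 1.
have B0 : 0 < B by rewrite ltr_wpDl.
have uB t y : 0 < t -> t <= s -> `|u t y| <= B.
  by move=> t_0 ts; apply: le_trans (uB' t y t_0 ts) _; rewrite lerDl.
have jU := joint_bounded_solution hu (ltW B0) uB.
have jF := joint_bounded_source p1 jU.
have sm : mild (time_cut s u) (source p u s) T1 s  := @solution_mild R n p u0 u p1 hu0 hu s T1 T10.
(* Up to T1 + sg the claim is weaker than |u| <= B, which starts the induction. *)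
pose sg := (eta / B) `^ (p - 1).
have sg0 : 0 < sg by rewrite powR_gt0// divr_gt0.
have sgE : eta * sg `^ (- beta) = B.
  rewrite /sg powRN -powRrM mulfV ?gt_eqF// powRr1 ?divr_ge0 ?(ltW eta0) ?(ltW B0)//.
  by field; rewrite !gt_eqF.
have pwN a b : 0 < a -> a <= b -> b `^ (- beta) <= a `^ (- beta).
  move=> a0 ab; have bp : 0 < b by exact: lt_le_trans ab.
  rewrite !powRN lef_pV2 ?posrE ?powR_gt0//.
  by apply: ge0_ler_powR; rewrite ?nnegrE ?(ltW b0) ?(ltW a0) ?(ltW bp).
move=> T1s; pose L := (s - T1) `^ (- beta).
have L0 : 0 < L by rewrite powR_gt0// subr_gt0.
have Bp0 : 0 < B `^ p by rewrite powR_gt0.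
(* So that (1 + c)^beta = 3/2; the step h <= sg c then keeps r - T1 <= (1 + c) (s1 - T1). *)
pose c := (3 / 2 : R) `^ (p - 1) - 1.
have c0 : 0 < c.
  rewrite subr_gt0 -[ltLHS](powRr0 (3 / 2)).
  apply: gt0_ltr_powR_exp || by rewrite /powR; case: ifPn; [lra|move=> _; rewrite ltr_expR mul0r mulr_gt0// ln_gt0//; lra].
pose h := Num.min (sg * c) (eta / 4 * L / B `^ p).
have h0 : 0 < h by rewrite lt_min !mulr_gt0 ?invr_gt0.
have hB : B `^ p * h <= eta / 4 * L.
  by rewrite mulrC -ler_pdivlMr// ge_min lexx orbT.
have hc : h <= sg * c by rewrite ge_min lexx.
suff H (k : nat) : forall r y, T1 < r -> r <= s -> r <= T1 + sg + k%:R * h ->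
    `|u r y| <= eta * (r - T1) `^ (- beta).
  have [k hk] : exists k : nat, (s - T1) / h < k%:R.
    by exists (Num.bound ((s - T1) / h)); apply: archi_boundP; apply: divr_ge0; apply: ltW => //; rewrite subr_gt0.
  apply: (H k s x T1s (lexx s)); rewrite ltr_pdivrMr// in hk; lra.
elim: k => [|k IH] r y T1r rs rk.
  apply: le_trans (uB r y (lt_trans T10 T1r) rs) _.
  rewrite -sgE ler_wpM2l ?(ltW eta0)// pwN ?subr_gt0//; lra.
have [rk'|kr] := leP r (T1 + sg + k%:R * h); first exact: IH.
pose s1 := T1 + sg + k%:R * h.
have kh0 : 0 <= k%:R * h by rewrite mulr_ge0// ltW.
have s1T : sg <= s1 - T1 by rewrite /s1; lra.
have T1s1 : T1 < s1 by rewrite /s1; lra.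
have s1r : s1 < r by [].
have s1s : s1 < s by exact: lt_le_trans rs.
have s10 : 0 < s1 by exact: lt_trans T1s1.
have r0 : 0 < r by exact: lt_trans s1r.
have rsh : r - s1 <= h by move: rk; rewrite -addn1 natrD mulrDl mul1r /s1; lra.
have hs1 z : `|u s1 z| <= eta / 2 * (s1 - T1) `^ (- beta).
  apply: midpoint_improve => // t w T1t ts1; apply: IH => //.
    exact: le_trans (ltW ts1) (ltW s1s).
  exact: ltW.
have mus : measurable_fun setT (u s1).
  by apply: continuous_measurable_rV => z; apply: continuous_slice; exact: (solution_continuous hu).
have := @mild_sup_bound R n (time_cut s u) (source p u s) T1 s s1 r (B `^ p)
  (eta / 2 * (s1 - T1) `^ (- beta)) y sm jF (ltW T1s1) s1r rs.
rewrite !time_cutE ?(ltW s1s)// => /(_ mus hs1) hu1; apply: (le_trans hu1).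
have V0 : 0 <= eta / 2 * (s1 - T1) `^ (- beta) by rewrite mulr_ge0 ?powR_ge0// divr_ge0// ltW.
have rs0 : 0 < r - s1 by rewrite subr_gt0.
have mus' : measurable_fun setT (fun y => `|u s1 y|) by exact: measurableT_comp.
have hcv : heat_convolution (r - s1) (fun y => `|u s1 y|) y <= eta / 2 * (s1 - T1) `^ (- beta).
  rewrite heat_convolutionE//.
  have mg := measurable_comp_affine y (Num.sqrt (r - s1)) mus'.
  have gb z : `|(`|u s1 (y + Num.sqrt (r - s1) *: z)|)| <= eta / 2 * (s1 - T1) `^ (- beta).
    by rewrite normr_id.
  exact: le_trans (ler_norm _) (gexp_bounded mg gb).
have c10 : 0 < 1 + c by rewrite addr_gt0.
have r1 : r - T1 <= (1 + c) * (s1 - T1).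
  have : sg * c <= c * (s1 - T1) by rewrite mulrC ler_wpM2l// ltW.
  by lra.
have rT0 : 0 < r - T1 by rewrite subr_gt0.
have s1T0 : 0 < s1 - T1 by rewrite subr_gt0.
have g1 : (s1 - T1) `^ (- beta) <= 3 / 2 * (r - T1) `^ (- beta).
  have h1 := pwN _ _ rT0 r1.
  rewrite (powRM _ (ltW c10) (ltW s1T0)) in h1.
  have cE : (1 + c) `^ (- beta) = (3 / 2)^-1.
    rewrite /c addrCA subrr addr0 powRN -powRrM mulfV ?gt_eqF// powRr1//; lra.
  rewrite cE in h1; move: h1; set Y := _ `^ _; set Z := _ `^ _; lra.
have g2 : B `^ p * (r - s1) <= eta / 4 * (r - T1) `^ (- beta).
  apply: (@le_trans _ _ (B `^ p * h)); first by rewrite ler_wpM2l// ltW.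
  apply: (le_trans hB); rewrite ler_wpM2l ?divr_ge0 ?(ltW eta0)//.
  by apply: pwN => //; rewrite lerD2r.
have e20 : 0 <= eta / 2 by rewrite divr_ge0// ltW.
have g3 := ler_wpM2l e20 g1.
have := lerD (le_trans hcv g3) g2.
by move/le_trans; apply; rewrite le_eqVlt; apply/orP; left; apply/eqP; field.
Qed.

End small_mass.

Lemma solution_decay t0 : 0 < t0 ->
  (forall e : R, 0 < e -> exists2 T3, t0 <= T3 & forall t tau (a : 'rV[R]_n),
    t0 <= t -> 0 < tau -> T3 <= t + tau -> tau `^ (2 * beta) * heat_square (u t) tau a <= e) ->
  forall e : R, 0 < e -> exists2 T, 0 < T & forall s x, T <= s -> s `^ beta * `|u s x| <= e.
Proof.
move=> t00 hm e e0; pose w := 2 `^ (beta + 2) : R; have w0 : 0 < w by rewrite powR_gt0.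
have tb0 : 0 < (2 : R) `^ beta by rewrite powR_gt0.
have wE : w = 2 `^ beta * 4.
  rewrite /w powRD ?pnatr_eq0 ?implybT//; congr (_ * _); rewrite powR_mulrn//; lra.
(* The first bound gives eta^p <= eta / w, so that with delta = eta / w the smallness condition
   holds. The second compensates the factor 2^beta lost in replacing s - T1 by s / 2 for s >= 2
   T1. *)
pose eta := Num.min (w^-1 `^ beta) (e / 2 `^ beta).
have eta0 : 0 < eta by rewrite lt_min powR_gt0 ?invr_gt0//= divr_gt0.
pose delta := eta / w; have delta0 : 0 < delta by rewrite divr_gt0.
have etap : eta `^ p <= eta / w.
  have -> : eta `^ p = eta * eta `^ (p - 1).
    by rewrite -[X in X * _]powRr1 ?(ltW eta0)// -powRD ?(gt_eqF eta0) ?implybT//; congr (_ `^ _); ring.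
  rewrite ler_wpM2l ?(ltW eta0)//.
  have -> : w^-1 = (w^-1 `^ beta) `^ (p - 1) by rewrite -powRrM mulVf ?gt_eqF// powRr1// invr_ge0 ltW.
  apply: ge0_ler_powR; rewrite ?nnegrE ?powR_ge0 ?(ltW p10) ?(ltW eta0)//.
  by rewrite ge_min lexx.
have small : 2 `^ beta * (delta + eta `^ p) <= eta / 2.
  apply: (@le_trans _ _ (2 `^ beta * (eta / w + eta / w))); first by rewrite ler_wpM2l ?(ltW tb0)// lerD2l.
  rewrite le_eqVlt; apply/orP; left; apply/eqP; rewrite wE; field; rewrite gt_eqF//.
have [T1 t0T1 mass] := hm _ (exprn_gt0 2 delta0).
have T10 : 0 < T1 by exact: lt_le_trans t0T1.
exists (2 * T1) => [|s x Ts]; first by rewrite mulr_gt0.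
have T1s : T1 < s by lra.
have s0 : 0 < s by exact: lt_trans T1s.
have h := small_mass_decay t00 t0T1 delta0 eta0 mass small x T1s.
have sb : 0 < s `^ beta by rewrite powR_gt0.
rewrite mulrC -ler_pdivlMr//; apply: (le_trans h).
apply: (@le_trans _ _ (e / 2 `^ beta * (s / 2) `^ (- beta))).
  apply: ler_pM; rewrite ?powR_ge0 ?(ltW eta0)//; first by rewrite ge_min lexx orbT.
  have s20 : 0 < s / 2 by rewrite divr_gt0.
  have sT : 0 < s - T1 by rewrite subr_gt0.
  rewrite !powRN lef_pV2 ?posrE ?powR_gt0//.
  by apply: ge0_ler_powR; rewrite ?nnegrE ?(ltW b0) ?(ltW s20) ?(ltW sT)//; lra.
have -> : s / 2 = 2^-1 * s by rewrite mulrC.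
rewrite powRM ?invr_ge0 ?(ltW s0)// half_powRN powRN.
rewrite le_eqVlt; apply/orP; left; apply/eqP; field.
by rewrite !gt_eqF.
Qed.

End bootstrap.

Lemma cvge0_of_le {R : realType} (F : R -> \bar R) :
  (forall e : R, 0 < e -> exists T : R, forall t, T <= t -> (0 <= F t <= e%:E)%E) ->
  F @ +oo%R --> 0%E.
Proof.
move=> h; apply/fine_cvgP; split.
  have [T hT] := h 1 ltr01; exists T; split; first exact: num_real.
  move=> t /ltW /hT /andP[a b]; rewrite ge0_fin_numE//.
  exact: le_lt_trans b (ltry _).
apply/cvgrPdist_le => e e0; have [T hT] := h e e0.
exists T; split; first exact: num_real.
move=> t /ltW /hT /andP[a b]; rewrite sub0r normrN/=.
have fF : F t \is a fin_num by rewrite ge0_fin_numE//; exact: le_lt_trans b (ltry _).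
by rewrite ger0_norm ?fine_ge0// -lee_fin fineK.
Qed.

Theorem theorem1 (R : realType) (n : nat) (p : R) (u0 : 'rV[R]_n -> R)
    (hn : (3 <= n)%N)
    (hp : (n%:R + 2) / (n%:R - 2) < p)
    (hu0 : u0 \in Lfun (lebesgue_rV n) +oo%E)
    (hab :
      (exists q : R, [/\ 2 <= q, q < n%:R * (p - 1) / (p + 1) &
                         gradient_in_Lq u0 q]) \/
      (BC1 u0 /\
       (fun x => enorm (gradient u0 x)) =o_infty_rV
         (fun x => enorm x `^ (- (2 / (p - 1)) - 1))))
    (Tmax : \bar R) (u : R -> 'rV[R]_n -> R)
    (hu : maximal_classical_solution p u0 Tmax u)
    (hglobal : Tmax = +oo%E) :
  (ereal_sup [set Linfty_norm (u t) | t in `[0%R, +oo[] < +oo)%E /\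
  ((fun t : R => (t `^ (1 / (p - 1)))%:E * Linfty_norm (u t))%E @ +oo%R
     --> 0%E).
Proof.
subst Tmax; have [hcl _] := hu.
have n20 : 0 < n%:R - 2 :> R by rewrite subr_gt0 (ltr_nat R 2 n).
have p1 : 1 < p.
  by apply: lt_trans hp; rewrite ltr_pdivlMr// mul1r; lra.
have p10 : 0 < p - 1 by rewrite subr_gt0.
have b0 : 0 < (p - 1)^-1 by rewrite invr_gt0.
have [t0 t00 gd] := gradient_decay p1 hn hp hu0 hcl hab.
have ms := mass_small p1 hu0 hcl t00 gd.
have sd := solution_decay p1 hu0 hcl t00 ms.
split.
  have [T T0 hT] := sd 1 ltr01.
  (* Beyond 1 the weight t^beta is at least 1, so the decay bounds u itself; up to T' boundedness is
     part of the notion of solution. *)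
  pose T' := Num.max T 1; have T'0 : 0 < T' by rewrite lt_max T0.
  have [_ _ _ hb _] := hcl; have := hb T' (ltry _); set S := ereal_sup _ => Soo.
  apply: (@le_lt_trans _ _ (Order.max S 1%:E)); last by rewrite gt_max Soo ltry.
  apply: ge_ereal_sup => _ [t + <-]; rewrite /= in_itv/= andbT => tge0.
  have [tT|Tt] := leP t T'; rewrite le_max; apply/orP.
    by left; apply: ereal_sup_ubound; exists t => //=; rewrite in_itv/= tge0.
  right; apply: Linfty_norm_le => // x.
  have Tt' : T <= t by apply: le_trans (ltW Tt); rewrite le_max lexx.
  have t1 : 1 <= t by apply: le_trans (ltW Tt); rewrite le_max lexx orbT.
  apply: le_trans (hT t x Tt'); rewrite ler_peMl// -[leLHS](powRr0 t).
  by rewrite ler_powR// ltW.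
apply: cvge0_of_le => e e0; have [T T0 hT] := sd e e0.
exists T => t Tt; have t_0 : 0 < t by exact: lt_le_trans Tt.
have tb0 : 0 < t `^ (1 / (p - 1)) by rewrite powR_gt0.
have et0 : 0 <= e / t `^ (1 / (p - 1)) by rewrite divr_ge0// ltW.
apply/andP; split; first by rewrite mule_ge0 ?lee_fin ?(ltW tb0)//; exact: Lnorm_ge0.
have hL : (Linfty_norm (u t) <= (e / t `^ (1 / (p - 1)))%:E)%E.
  apply: Linfty_norm_le => // x; rewrite ler_pdivlMr// mulrC div1r.
  exact: hT.
apply: le_trans (lee_wpmul2l _ hL) _; first by rewrite lee_fin ltW.
by rewrite -EFinM lee_fin mulrCA divff ?gt_eqF// mulr1.
Qed.
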